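(* For every closed $\mathsf{rlGL}$ formula $\varphi$: 1. $\vdash_{\mathsf{rlGL}+G}\varphi$ iff $[\![\varphi]\!]^{\mathcal N}=W$ for every Kripke structure $\mathcal N=(W,V,E)$; 2. $\vdash_{\mathsf{rlGL}}\varphi$ iff $[\![\varphi]\!]^{\mathcal N}=W$ for every monotone neighbourhood structure $\mathcal N=(W,V,E)$.
   Context: A monotone neighbourhood structure is $\mathcal N=(W,V,E)$ with $V:\mathbb A\to\mathcal P(W)$ and monotone $E(a):\mathcal P(W)\to\mathcal P(W)$ for atomic games $a$; it is Kripke if each $E(a)(A)=\{r:\exists s\in A,\ rR_as\}$ for a relation $R_a$. $w^d(A)=W\setminus w(W\setminus A)$. Valuations $I$ map variables to monotone maps $\mathcal P(W)\to\mathcal P(W)$. Recursive game logic in normal form: formulas $\varphi::=P\mid\neg P\mid\varphi\lor\varphi\mid\varphi\land\varphi\mid\langle\alpha\rangle\varphi$; games $\alpha::=a\mid a^d\mid x\mid x^d\mid?\varphi\mid?^d\varphi\mid\alpha\cup\alpha\mid\alpha\cap\alpha\mid\alpha;\alpha\mid\mu x.\alpha\mid\nu x.\alpha$; no variable free in a test formula; bound variables never occur as $x^d$. Semantics: $V(P)$, $W\setminus V(P)$, union, intersection, $[\![\langle\alpha\rangle\varphi]\!]_I=[\![\alpha]\!]_I([\![\varphi]\!]_I)$; $E(a)$, $E(a)^d$, $I(x)$, $I(x)^d$; $[\![?\varphi]\!]_I(A)=[\![\varphi]\!]_I\cap A$, $[\![?^d\varphi]\!]_I(A)=(W\setminus[\![\varphi]\!]_I)\cup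 A$; pointwise $\cup,\cap$; composition; least/greatest fixpoints (pointwise order) of $u\mapsto[\![\alpha]\!]_{I[x\mapsto u]}$ for $\mu x.\alpha,\nu x.\alpha$. $\mathsf{rlGL}$: formulas with no subgame $\beta;\gamma$ having a free variable in $\beta$. $\top:=P\lor\neg P$, $\bot:=P\land\neg P$, $\to$ via syntactic complement. Syntactic complement $\overline{\cdot}$/dual $\cdot^\partial$: $\overline P=\neg P$, $\overline{\neg P}=P$, swap $\lor/\land$, $\overline{\langle\alpha\rangle\varphi}=\langle\alpha^\partial\rangle\overline\varphi$; $a^\partial=a^d$, $(a^d)^\partial=a$, $x^\partial=x$, $(x^d)^\partial=x^d$, $(?\varphi)^\partial=?^d\varphi$, $(?^d\varphi)^\partial=?\varphi$, swap $\cup/\cap$, $(\alpha;\beta)^\partial=\alpha^\partial;\beta^\partial$, $(\mu x.\alpha)^\partial=\nu x.\alpha^\partial$, $(\nu x.\alpha)^\partial=\mu x.\alpha^\partial$; $\neg\psi$ for non-literal $\psi$ means $\overline\psi$. Calculus $\vdash_{\mathsf{rlGL}}$ (Hilbert proofs all of whose formulas are $\mathsf{rlGL}$ formulas): propositional tautologies; $\langle\alpha^\partial\rangle\varphi\leftrightarrow\neg\langle\alpha\rangle\neg\varphi$; $\langle?\varphi\rangle\psi\leftrightarrow\varphi\land\psi$; $\langle\alpha\cup\beta\rangle\varphi\leftrightarrow\langle\alpha\rangle\varphi\lor\langle\beta\rangle\varphi$; $\langle\alpha;\beta\rangle\varphi\leftrightarrow\langle\alpha\rangle\langle\beta\rangle\varphi$;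 $\langle\alpha[x:=\mu x.\alpha]\rangle\varphi\to\langle\mu x.\alpha\rangle\varphi$; bound renaming $\langle\sigma x.\alpha\rangle\varphi\leftrightarrow\langle\sigma y.\alpha[x:=y]\rangle\varphi$ for fresh $y$, $\sigma\in\{\mu,\nu\}$; rules: modus ponens; from $\langle\alpha[x:=\beta;?\psi;?^d\bot]\rangle\varphi\to\langle\beta\rangle\psi$ infer $\langle\mu x.\alpha\rangle\varphi\to\langle\beta\rangle\psi$; from $\varphi\to\psi$ infer $\langle\alpha\rangle\varphi\to\langle\alpha\rangle\psi$. $\vdash_{\mathsf{rlGL}+G}$ additionally has, for atomic $a$ (with $[a]\varphi:=\langle a^d\rangle\varphi$), the axioms $[a]\varphi\land[a]\psi\leftrightarrow[a](\varphi\land\psi)$, $[a](\varphi\lor\psi)\to\langle a\rangle\varphi\lor[a]\psi$, $[a]\top$. *)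

(* Defs.v *)
From mathcomp Require Import all_boot.
From mathcomp Require Import boolp classical_sets.

Set Implicit Arguments.
Unset Strict Implicit.
Unset Printing Implicit Defensive.

Local Open Scope classical_set_scope.

(* The signature is arbitrary: Prp is the type of propositional symbols and   *)
(* Act the type of atomic games.  Game variables are natural numbers.         *)

Inductive formula (Prp Act : Type) : Type :=
| FProp of Prp
| FNProp of Prp
| FOr of formula Prp Act & formula Prp Act
| FAnd of formula Prp Act & formula Prp Act
| FDia of game Prp Act & formula Prp Act
with game (Prp Act : Type) : Type :=
| GAct of Act
| GActD of Act
| GVar of nat
| GVarD of nat
| GTest of formula Prp Act
| GTestD of formula Prp Act
| GCup of game Prp Act & game Prp Act
| GCap of game Prp Act & game Prp Act
| GSeq of game Prp Act & game Prp Act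
| GMu of nat & game Prp Act
| GNu of nat & game Prp Act.

Arguments FProp {Prp Act} _.
Arguments FNProp {Prp Act} _.
Arguments GAct {Prp Act} _.
Arguments GActD {Prp Act} _.
Arguments GVar {Prp Act} _.
Arguments GVarD {Prp Act} _.

Fixpoint fvf (Prp Act : Type) (phi : formula Prp Act) : seq nat :=
  match phi with
  | FProp _ | FNProp _ => [::]
  | FOr p q | FAnd p q => fvf p ++ fvf q
  | FDia a p => fvg a ++ fvf p
  end
with fvg (Prp Act : Type) (alpha : game Prp Act) : seq nat :=
  match alpha with
  | GAct _ | GActD _ => [::]
  | GVar x | GVarD x => [:: x]
  | GTest p | GTestD p => fvf p
  | GCup a b | GCap a b | GSeq a b => fvg a ++ fvg b
  | GMu x a | GNu x a => [seq z <- fvg a | z != x]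
  end.

Definition closedf (Prp Act : Type) (phi : formula Prp Act) : bool :=
  nilp (fvf phi).

(* All variables, free, bound or in binding position. *)
Fixpoint varsf (Prp Act : Type) (phi : formula Prp Act) : seq nat :=
  match phi with
  | FProp _ | FNProp _ => [::]
  | FOr p q | FAnd p q => varsf p ++ varsf q
  | FDia a p => varsg a ++ varsf p
  end
with varsg (Prp Act : Type) (alpha : game Prp Act) : seq nat :=
  match alpha with
  | GAct _ | GActD _ => [::]
  | GVar x | GVarD x => [:: x]
  | GTest p | GTestD p => varsf p
  | GCup a b | GCap a b | GSeq a b => varsg a ++ varsg b
  | GMu x a | GNu x a => x :: varsg a
  end.

(* The variables x with a free occurrence of the form x^d. *)
Fixpoint dfvf (Prp Act : Type) (phi : formula Prp Act) : seq nat :=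
  match phi with
  | FProp _ | FNProp _ => [::]
  | FOr p q | FAnd p q => dfvf p ++ dfvf q
  | FDia a p => dfvg a ++ dfvf p
  end
with dfvg (Prp Act : Type) (alpha : game Prp Act) : seq nat :=
  match alpha with
  | GAct _ | GActD _ | GVar _ => [::]
  | GVarD x => [:: x]
  | GTest p | GTestD p => dfvf p
  | GCup a b | GCap a b | GSeq a b => dfvg a ++ dfvg b
  | GMu x a | GNu x a => [seq z <- dfvg a | z != x]
  end.

(* Normal form: tests are closed, and no binder binds an occurrence x^d. *)
Fixpoint normalf (Prp Act : Type) (phi : formula Prp Act) : bool :=
  match phi with
  | FProp _ | FNProp _ => true
  | FOr p q | FAnd p q => normalf p && normalf q
  | FDia a p => normalg a && normalf p
  end
with normalg (Prp Act : Type) (alpha : game Prp Act) : bool :=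
  match alpha with
  | GAct _ | GActD _ | GVar _ | GVarD _ => true
  | GTest p | GTestD p => normalf p && closedf p
  | GCup a b | GCap a b | GSeq a b => normalg a && normalg b
  | GMu x a | GNu x a => normalg a && (x \notin dfvg a)
  end.

(* Right-linearity: no subgame b ; c has a free variable in b. *)
Fixpoint rlinf (Prp Act : Type) (phi : formula Prp Act) : bool :=
  match phi with
  | FProp _ | FNProp _ => true
  | FOr p q | FAnd p q => rlinf p && rlinf q
  | FDia a p => rling a && rlinf p
  end
with rling (Prp Act : Type) (alpha : game Prp Act) : bool :=
  match alpha with
  | GAct _ | GActD _ | GVar _ | GVarD _ => true
  | GTest p | GTestD p => rlinf p
  | GCup a b | GCap a b => rling a && rling b
  | GSeq a b => [&& rling a, rling b & nilp (fvg a)]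
  | GMu _ a | GNu _ a => rling a
  end.

Definition rlGL (Prp Act : Type) (phi : formula Prp Act) : bool :=
  normalf phi && rlinf phi.

Fixpoint dual (Prp Act : Type) (alpha : game Prp Act) : game Prp Act :=
  match alpha with
  | GAct a => GActD a
  | GActD a => GAct a
  | GVar x => GVar x
  | GVarD x => GVarD x
  | GTest p => GTestD p
  | GTestD p => GTest p
  | GCup a b => GCap (dual a) (dual b)
  | GCap a b => GCup (dual a) (dual b)
  | GSeq a b => GSeq (dual a) (dual b)
  | GMu x a => GNu x (dual a)
  | GNu x a => GMu x (dual a)
  end.

Fixpoint compl (Prp Act : Type) (phi : formula Prp Act) : formula Prp Act :=
  match phi with
  | FProp P => FNProp P
  | FNProp P => FProp P
  | FOr p q => FAnd (compl p) (compl q)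
  | FAnd p q => FOr (compl p) (compl q)
  | FDia a p => FDia (dual a) (compl p)
  end.

Definition FImp (Prp Act : Type) (p q : formula Prp Act) : formula Prp Act :=
  FOr (compl p) q.
Definition FIff (Prp Act : Type) (p q : formula Prp Act) : formula Prp Act :=
  FAnd (FImp p q) (FImp q p).
Definition FTop (Prp Act : Type) (P0 : Prp) : formula Prp Act :=
  FOr (FProp P0) (FNProp P0).
Definition FBot (Prp Act : Type) (P0 : Prp) : formula Prp Act :=
  FAnd (FProp P0) (FNProp P0).
Definition FBox (Prp Act : Type) (a : Act) (p : formula Prp Act) :
  formula Prp Act := FDia (GActD a) p.

(* Literal replacement of the free occurrences of x by b; capture is excluded *)
(* separately by [free_for].  The calculus only substitutes for variables     *)
(* bound in a normal form, so leaving x^d untouched is immaterial.            *)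
Fixpoint substf (Prp Act : Type) (x : nat) (b : game Prp Act)
    (phi : formula Prp Act) : formula Prp Act :=
  match phi with
  | FProp P => FProp P
  | FNProp P => FNProp P
  | FOr p q => FOr (substf x b p) (substf x b q)
  | FAnd p q => FAnd (substf x b p) (substf x b q)
  | FDia a p => FDia (substg x b a) (substf x b p)
  end
with substg (Prp Act : Type) (x : nat) (b : game Prp Act)
    (alpha : game Prp Act) : game Prp Act :=
  match alpha with
  | GAct a => GAct a
  | GActD a => GActD a
  | GVar y => if y == x then b else GVar y
  | GVarD y => GVarD y
  | GTest p => GTest (substf x b p)
  | GTestD p => GTestD (substf x b p)
  | GCup c d => GCup (substg x b c) (substg x b d)
  | GCap c d => GCap (substg x b c) (substg x b d)
  | GSeq c d => GSeq (substg x b c) (substg x b d)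
  | GMu y c => if y == x then GMu y c else GMu y (substg x b c)
  | GNu y c => if y == x then GNu y c else GNu y (substg x b c)
  end.

(* b is free for x in alpha: no free occurrence of x lies in the scope of a   *)
(* binder for a free variable of b.                                           *)
Fixpoint free_forf (Prp Act : Type) (b : game Prp Act) (x : nat)
    (phi : formula Prp Act) : bool :=
  match phi with
  | FProp _ | FNProp _ => true
  | FOr p q | FAnd p q => free_forf b x p && free_forf b x q
  | FDia a p => free_for b x a && free_forf b x p
  end
with free_for (Prp Act : Type) (b : game Prp Act) (x : nat)
    (alpha : game Prp Act) : bool :=
  match alpha with
  | GAct _ | GActD _ | GVar _ | GVarD _ => true
  | GTest p | GTestD p => free_forf b x p
  | GCup c d | GCap c d | GSeq c d => free_for b x c && free_for b x d
  | GMu y c | GNu y c =>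
      (x \notin fvg (GMu y c)) || ((y \notin fvg b) && free_for b x c)
  end.

Definition monotone_map (W : Type) (u : set W -> set W) : Prop :=
  {homo u : A B / A `<=` B}.

Definition dual_map (W : Type) (u : set W -> set W) : set W -> set W :=
  fun A => ~` u (~` A).

Record mnstruct (Prp Act : Type) : Type := MNStruct {
  world :> Type;
  mval : Prp -> set world;
  mnbhd : Act -> set world -> set world;
  mnbhd_monotone : forall a, monotone_map (mnbhd a)
}.

Definition is_kripke (Prp Act : Type) (N : mnstruct Prp Act) : Prop :=
  forall a, exists R : N -> N -> Prop,
    forall A, mnbhd a A = [set r | exists2 s, A s & R r s].

Definition map_le (W : Type) (u v : set W -> set W) : Prop :=
  forall A, u A `<=` v A.

Definition fixpoint_of (W : Type) (F : (set W -> set W) -> (set W -> set W))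
  (u : set W -> set W) : Prop := monotone_map u /\ F u = u.

(* The default value idfun is only used if there is no least (greatest)       *)
(* fixpoint, which does not happen for games in normal form.                  *)
Definition lfp (W : Type) (F : (set W -> set W) -> (set W -> set W)) :
    set W -> set W :=
  xget (idfun : {classic set W -> set W})
       [set u | fixpoint_of F u /\
                      forall v, fixpoint_of F v -> map_le u v].
Definition gfp (W : Type) (F : (set W -> set W) -> (set W -> set W)) :
    set W -> set W :=
  xget (idfun : {classic set W -> set W})
       [set u | fixpoint_of F u /\
                      forall v, fixpoint_of F v -> map_le v u].

Definition update (W : Type) (I : nat -> set W -> set W) (x : nat)
  (u : set W -> set W) : nat -> set W -> set W :=
  fun y => if y == x then u else I y.

Fixpoint semf (Prp Act : Type) (N : mnstruct Prp Act)
    (I : nat -> set N -> set N) (phi : formula Prp Act) : set N :=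
  match phi with
  | FProp P => mval P
  | FNProp P => ~` mval P
  | FOr p q => semf I p `|` semf I q
  | FAnd p q => semf I p `&` semf I q
  | FDia a p => semg I a (semf I p)
  end
with semg (Prp Act : Type) (N : mnstruct Prp Act)
    (I : nat -> set N -> set N) (alpha : game Prp Act) : set N -> set N :=
  match alpha with
  | GAct a => mnbhd a
  | GActD a => dual_map (mnbhd a)
  | GVar x => I x
  | GVarD x => dual_map (I x)
  | GTest p => fun A => semf I p `&` A
  | GTestD p => fun A => ~` semf I p `|` A
  | GCup a b => fun A => semg I a A `|` semg I b A
  | GCap a b => fun A => semg I a A `&` semg I b A
  | GSeq a b => fun A => semg I a (semg I b A)
  | GMu x a => lfp (fun u => semg (update I x u) a)
  | GNu x a => gfp (fun u => semg (update I x u) a)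
  end.

(* [[phi]] = W under every monotone valuation of the game variables, which    *)
(* are irrelevant when phi is closed.                                         *)
Definition true_in (Prp Act : Type) (N : mnstruct Prp Act)
    (phi : formula Prp Act) : Prop :=
  forall I : nat -> set N -> set N,
    (forall x, monotone_map (I x)) -> semf I phi = [set: N].

(* Truth assignments on formulas which treat complementation as negation, so  *)
(* that the prime formulas <alpha>psi and their complements are opposite.     *)
Definition tautology (Prp Act : Type) (phi : formula Prp Act) : Prop :=
  forall v : formula Prp Act -> bool,
    (forall p, v (compl p) = ~~ v p) ->
    (forall p q, v (FOr p q) = v p || v q) ->
    (forall p q, v (FAnd p q) = v p && v q) ->
    v phi.

Inductive axiom_rlGL (Prp Act : Type) : formula Prp Act -> Prop :=
| ax_taut p : tautology p -> axiom_rlGL p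
| ax_dual a p :
    axiom_rlGL (FIff (FDia (dual a) p) (compl (FDia a (compl p))))
| ax_test p q : axiom_rlGL (FIff (FDia (GTest p) q) (FAnd p q))
| ax_cup a b p :
    axiom_rlGL (FIff (FDia (GCup a b) p) (FOr (FDia a p) (FDia b p)))
| ax_seq a b p :
    axiom_rlGL (FIff (FDia (GSeq a b) p) (FDia a (FDia b p)))
| ax_unfold x a p : free_for (GMu x a) x a ->
    axiom_rlGL (FImp (FDia (substg x (GMu x a) a) p) (FDia (GMu x a) p))
| ax_rename_mu x y a p : y \notin varsg a ->
    axiom_rlGL (FIff (FDia (GMu x a) p)
                     (FDia (GMu y (substg x (GVar y) a)) p))
| ax_rename_nu x y a p : y \notin varsg a ->
    axiom_rlGL (FIff (FDia (GNu x a) p)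
                     (FDia (GNu y (substg x (GVar y) a)) p)).

Inductive axiom_G (Prp Act : Type) (P0 : Prp) : formula Prp Act -> Prop :=
| ax_box_and a p q :
    axiom_G P0 (FIff (FAnd (FBox a p) (FBox a q)) (FBox a (FAnd p q)))
| ax_box_or a p q :
    axiom_G P0 (FImp (FBox a (FOr p q)) (FOr (FDia (GAct a) p) (FBox a q)))
| ax_box_top a : axiom_G P0 (FBox a (FTop Act P0)).

(* Theorems of the Hilbert calculus over the axioms Ax; P0 is the symbol used *)
(* in FBot.  In the fixpoint rule no capture is possible: if x occurs free in *)
(* a, then b and q are closed because the premise is an rlGL formula.         *)
Inductive provable (Prp Act : Type) (P0 : Prp)
    (Ax : formula Prp Act -> Prop) : formula Prp Act -> Prop :=
| prv_ax p : Ax p -> rlGL p -> provable P0 Ax p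
| prv_mp p q :
    provable P0 Ax p -> provable P0 Ax (FImp p q) -> rlGL q ->
    provable P0 Ax q
| prv_fix x a b p q :
    provable P0 Ax
      (FImp (FDia (substg x
               (GSeq b (GSeq (GTest q) (GTestD (FBot Act P0)))) a) p)
            (FDia b q)) ->
    rlGL (FImp (FDia (GMu x a) p) (FDia b q)) ->
    provable P0 Ax (FImp (FDia (GMu x a) p) (FDia b q))
| prv_mon a p q :
    provable P0 Ax (FImp p q) -> rlGL (FImp (FDia a p) (FDia a q)) ->
    provable P0 Ax (FImp (FDia a p) (FDia a q)).

Definition provable_rlGL (Prp Act : Type) (P0 : Prp)
    (phi : formula Prp Act) : Prop :=
  provable P0 (@axiom_rlGL Prp Act) phi.

Definition provable_rlGL_G (Prp Act : Type) (P0 : Prp)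
    (phi : formula Prp Act) : Prop :=
  provable P0 (fun p => axiom_rlGL p \/ axiom_G P0 p) phi.

(* Main.v *)
(** Soundness: free game variables are interpreted by the identity, which is its
own dual. In a right-linear game a bound variable is only reached at the
continuation of its binder, so that the fixpoints over monotone maps reduce, at
every argument, to fixpoints over sets.

Completeness: modulo provable equivalence the closed formulas form a Boolean
algebra in which the unfolding axiom and the induction rule make the value of
<mu x.alpha>phi a least fixpoint of the map b |-> <alpha[x := b]>phi. All
systems of fixpoint equations over modal operators can therefore be solved in
this algebra, and a formula amounts to an alternating parity automaton. Such an
automaton lies, in the algebra, below its tableau, a nondeterministic parity
automaton obtained by determinizing the trace condition; the inequality is
proved one fixpoint variable at a time by following finitely many threads
jointly. The tool is Kozen's strengthening: if c meets mu x.f(x), then it meets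
f(mu x.(f(x) and not c)). Decorating the least fixpoints of a thread with such
restrictions, ordered by the time of their last reset, shows that no infinite
sequence of nonzero configurations regenerates a least fixpoint forever without
regenerating a larger variable. For the same reason the nonzero configurations
of the tableau are the worlds of a model. Over neighbourhood structures the
tableau uses the global modality "b is nonzero", which is adjoined to the
algebra beforehand. *)

Require Import Defs.
From mathcomp Require Import all_boot.
From mathcomp Require Import boolp zify.

Set Implicit Arguments.
Unset Strict Implicit.
Unset Printing Implicit Defensive.

(** * Boolean algebras and fixpoints *)

(** The algebra of closed formulas need not be complete: a least fixpoint is only a least prefixed
    point, without ordinal approximants, so a regeneration cannot be given a rank. Restrictors
    replace ranks: a repeated configuration would lie below both a context and its negation. The
    comparison with the tableau raises a level [k]: states of index at least [k] are constants, and
    passing to [k.+1] unfolds one more. For a least fixpoint the tableau value at [k] proves to be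
    prefixed; for a greatest one the fixpoint itself is kept as the constant, and a thread for its
    body is spawned where the constant is met. Several threads may choose different disjuncts at the
    same state. Seniority decides, and along a trace the holder never becomes more junior except at
    the greatest fixpoint [k], so a bad trace of the tableau ends up inside a single thread. Without
    normality a diamond and a box can be combined only in pairs, and the combination is merely known
    to be nonzero; this is all that the global modality records. *)

Record balg : Type := Balg {
  bcar :> Type;
  ble : bcar -> bcar -> Prop;
  bmeet : bcar -> bcar -> bcar;
  bneg : bcar -> bcar;
  bbot : bcar;
  ble_refl : forall a, ble a a;
  ble_trans : forall b a c, ble a b -> ble b c -> ble a c;
  ble_anti : forall a b, ble a b -> ble b a -> a = b;
  ble_meet : forall a b c, ble c (bmeet a b) <-> ble c a /\ ble c b;
  bbot_le : forall a, ble bbot a;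
  bneg_adj : forall a b, ble (bmeet a b) bbot <-> ble a (bneg b);
  bnegK : forall a, bneg (bneg a) = a }.

Arguments bbot {_}.
#[global] Hint Resolve ble_refl bbot_le : core.

Notation "a <<= b" := (ble a b) (at level 70, no associativity).
Notation "a ⊓ b" := (bmeet a b) (at level 40, left associativity).

Definition btop {B : balg} : B := bneg bbot.
Definition bjoin {B : balg} (a b : B) : B := bneg (bneg a ⊓ bneg b).
Notation "a ⊔ b" := (bjoin a b) (at level 50, left associativity).

Definition bnz {B : balg} (a : B) : Prop := ~ (a <<= bbot).

Definition bmeets {B : balg} (T : finType) (f : T -> B) : B :=
  \big[@bmeet B/btop]_(i : T) f i.
Definition bjoins {B : balg} (T : finType) (f : T -> B) : B :=
  bneg (bmeets (fun i => bneg (f i))).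

Section BalgTheory.
Variable B : balg.
Implicit Types a b c d : B.

Lemma meetl a b : a ⊓ b <<= a.
Proof. by have /ble_meet[] := ble_refl (a ⊓ b). Qed.

Lemma meetr a b : a ⊓ b <<= b.
Proof. by have /ble_meet[] := ble_refl (a ⊓ b). Qed.

Lemma le_meet a b c : c <<= a -> c <<= b -> c <<= a ⊓ b.
Proof. by move=> ca cb; apply/ble_meet. Qed.

Lemma meet_mono a b c d : a <<= c -> b <<= d -> a ⊓ b <<= c ⊓ d.
Proof.
move=> ac bd; apply: le_meet.
  exact: ble_trans (meetl _ _) ac.
exact: ble_trans (meetr _ _) bd.
Qed.

Lemma meetC a b : a ⊓ b = b ⊓ a.
Proof. by apply: ble_anti; apply: le_meet; rewrite ?meetl; auto using meetl, meetr. Qed.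

Lemma meetA a b c : a ⊓ (b ⊓ c) = a ⊓ b ⊓ c.
Proof.
apply: ble_anti; repeat apply: le_meet; eauto using meetl, meetr, ble_trans.
Qed.

Lemma meet_top a : a ⊓ btop = a.
Proof.
apply: ble_anti; first exact: meetl.
apply: le_meet => //; apply/bneg_adj; exact: meetr.
Qed.

Lemma le_top a : a <<= btop.
Proof. by apply/bneg_adj; exact: meetr. Qed.

Lemma le_neg a b : a <<= b -> bneg b <<= bneg a.
Proof.
move=> ab; apply/bneg_adj; apply: ble_trans (_ : bneg b ⊓ b <<= _).
  exact: meet_mono.
by apply/bneg_adj.
Qed.

Lemma le_negr a b : a <<= bneg b <-> b <<= bneg a.
Proof. by split=> /le_neg; rewrite bnegK. Qed.

Lemma le_negl a b : bneg a <<= b <-> bneg b <<= a.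
Proof. by split=> /le_neg; rewrite bnegK. Qed.

Lemma neg_le a b : bneg a <<= bneg b <-> b <<= a.
Proof. by split=> /le_neg; rewrite ?bnegK. Qed.

Lemma le_joinP a b c : a ⊔ b <<= c <-> a <<= c /\ b <<= c.
Proof. by rewrite /bjoin le_negl ble_meet !neg_le. Qed.

Lemma join_mono a b c d : a <<= c -> b <<= d -> a ⊔ b <<= c ⊔ d.
Proof. by move=> ac bd; apply: le_neg; apply: meet_mono; exact: le_neg. Qed.

Lemma nz_le a b : bnz a -> a <<= b -> bnz b.
Proof. by move=> na ab nb; apply: na; apply: ble_trans ab nb. Qed.

Lemma le_nz a b : a <<= b <-> ~ bnz (a ⊓ bneg b).
Proof.
rewrite /bnz notK bneg_adj bnegK //.
Qed.

Lemma meet_neg a : a ⊓ bneg a <<= bbot.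
Proof. by apply/bneg_adj; rewrite bnegK. Qed.

Lemma neg_top : bneg (@btop B) = bbot. Proof. exact: bnegK. Qed.

Lemma nz_join a b c : bnz (c ⊓ (a ⊔ b)) -> bnz (c ⊓ a) \/ bnz (c ⊓ b).
Proof.
move=> nz; have [h|/contrapT ha] := pselect (bnz (c ⊓ a)); first by left.
have [h|/contrapT hb] := pselect (bnz (c ⊓ b)); first by right.
case: nz; apply/bneg_adj; rewrite bnegK; apply: le_meet; exact/bneg_adj.
Qed.

Lemma le_meets (T : finType) (f : T -> B) c :
  c <<= bmeets f <-> forall i, c <<= f i.
Proof.
rewrite /bmeets; split.
  move=> h i; move: h; have : i \in index_enum T by rewrite mem_index_enum.
  elim: (index_enum T) => // j s IH; rewrite inE big_cons => /orP[/eqP<-|/IH h] /ble_meet[] //.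
by move=> h; elim/big_rec: _ => [|i x _ cx]; [exact: le_top | exact: le_meet].
Qed.

Lemma meets_le (T : finType) (f : T -> B) i : bmeets f <<= f i.
Proof. by move: i; apply/le_meets. Qed.

Lemma meets_mono (T : finType) (f g : T -> B) :
  (forall i, f i <<= g i) -> bmeets f <<= bmeets g.
Proof. by move=> fg; apply/le_meets => i; apply: ble_trans (fg i); exact: meets_le. Qed.

Lemma joins_le (T : finType) (f : T -> B) c :
  bjoins f <<= c <-> forall i, f i <<= c.
Proof.
rewrite /bjoins le_negl le_meets; split=> h i; move: (h i); by rewrite neg_le.
Qed.

Lemma le_joins (T : finType) (f : T -> B) i : f i <<= bjoins f.
Proof. by move: i; apply/joins_le. Qed.

Lemma joins_mono (T : finType) (f g : T -> B) :
  (forall i, f i <<= g i) -> bjoins f <<= bjoins g.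
Proof. by move=> fg; apply/joins_le => i; apply: ble_trans (le_joins _ i). Qed.

Lemma nz_joins (T : finType) (f : T -> B) c :
  bnz (c ⊓ bjoins f) -> exists i, bnz (c ⊓ f i).
Proof.
move=> nz; apply: contrapT => no; apply: nz; apply/bneg_adj; rewrite bnegK.
apply/le_meets => i; apply/bneg_adj; apply: contrapT => ni.
by apply: no; exists i.
Qed.

Lemma nz_negmeets (T : finType) (f : T -> B) c :
  bnz (c ⊓ bneg (bmeets f)) -> exists i, bnz (c ⊓ bneg (f i)).
Proof.
have -> : bmeets f = bmeets (fun i => bneg (bneg (f i))).
  by congr bmeets; apply: funext => i; rewrite bnegK.
exact: nz_joins.
Qed.

(* Finite distributivity, in the form of a simultaneous choice of disjuncts. *)
Lemma nz_choose (I : finType) (T : I -> finType) (f : forall i, T i -> B) c :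
  bnz (c ⊓ bmeets (fun i => bjoins (f i))) ->
  exists g : forall i, T i, bnz (c ⊓ bmeets (fun i => f i (g i))).
Proof.
move=> nz.
(* The disjuncts are chosen one index at a time; [None] marks an index that still contributes its
   whole join. *)
suff [g hg] : exists g : forall i, option (T i),
    (forall i, i \in index_enum I -> exists x, g i = Some x) /\
    bnz (c ⊓ bmeets (fun i => if g i is Some x then f i x else bjoins (f i))).
  have gP i : {x | g i = Some x}.
    by apply: cid; apply: hg.1; rewrite mem_index_enum.
  exists (fun i => projT1 (gP i)); apply: nz_le hg.2 _.
  by apply: meet_mono => //; apply: meets_mono => i; case: (gP i) => x /= ->.
elim: (index_enum I) => [|i0 s [g [gs gz]]]; first by exists (fun=> None).
case E: (g i0) => [x|].
  exists g; split => // i; rewrite inE => /orP[/eqP->|]; first by exists x.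
  exact: gs.
set m := bmeets _ in gz.
have : bnz (c ⊓ m ⊓ bjoins (f i0)).
  apply: nz_le gz _; apply: le_meet => //; apply: ble_trans (meetr _ _) _.
  by apply: ble_trans (meets_le _ i0) _; rewrite E.
move=> /nz_joins[x nx].
exists (fun i => match pselect (i0 = i) with
          | left e => Some (ecast j (T j) e x) | right _ => g i end); split.
  move=> i; rewrite inE => /orP[/eqP->|si]; case: pselect => // e.
  + by eexists.
  + by eexists.
  + exact: gs.
apply: nz_le nx _; rewrite -meetA; apply: meet_mono => //.
apply/le_meets => i; case: pselect => [e|_]; last first.
  by apply: ble_trans (meetl _ _) _; exact: meets_le.
by case: i / e => /=; exact: meetr.
Qed.

Definition monof (f : B -> B) := forall a b, a <<= b -> f a <<= f b.

Definition islfp (f : B -> B) x := f x <<= x /\ forall z, f z <<= z -> x <<= z.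
Definition haslfp f := exists x, islfp f x.
(** A least prefixed point may fail to exist, as the algebra need not be complete; [bbot] is then a
    placeholder. *)
Definition lfpB f : B := if pselect (haslfp f) is left e then projT1 (cid e) else bbot.
Definition fdual (f : B -> B) x := bneg (f (bneg x)).
Definition gfpB f : B := bneg (lfpB (fdual f)).

Lemma lfpP f : haslfp f -> islfp f (lfpB f).
Proof. by rewrite /lfpB; case: pselect => // e _; case: (cid e). Qed.

Lemma islfp_uniq f x y : islfp f x -> islfp f y -> x = y.
Proof. by move=> [fx mx] [fy my]; apply: ble_anti; auto. Qed.

Lemma lfp_eq f x : islfp f x -> lfpB f = x.
Proof.
move=> h; have hx : haslfp f by exists x.
  exact: islfp_uniq (lfpP hx) h.
Qed.

Lemma lfp_le f z : haslfp f -> f z <<= z -> lfpB f <<= z.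
Proof. by case/lfpP => _; apply. Qed.

Lemma lfpE f : monof f -> haslfp f -> f (lfpB f) = lfpB f.
Proof. by move=> mf /lfpP[fx mx]; apply: ble_anti => //; apply: mx; exact: mf. Qed.

Lemma lfp_mono f g : haslfp f -> haslfp g -> (forall x, f x <<= g x) ->
  lfpB f <<= lfpB g.
Proof.
move=> hf /lfpP[gx _] fg; apply: lfp_le => //; apply: ble_trans (fg _) gx.
Qed.

Lemma fdualK f : fdual (fdual f) = f.
Proof. by apply: funext => x; rewrite /fdual !bnegK. Qed.

Lemma fdual_mono f : monof f -> monof (fdual f).
Proof. by move=> mf a b ab; apply: le_neg; apply: mf; apply: le_neg. Qed.

Lemma gfpE f : monof f -> haslfp (fdual f) -> f (gfpB f) = gfpB f.
Proof.
move=> mf hf; have /(congr1 (@bneg B)) := lfpE (fdual_mono mf) hf.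
by rewrite {1}/fdual bnegK.
Qed.

Lemma gfp_ge f z : haslfp (fdual f) -> z <<= f z -> z <<= gfpB f.
Proof.
move=> hf zf; apply/le_negr; apply: lfp_le => //; rewrite /fdual bnegK.
exact: le_neg.
Qed.

Lemma gfp_mono f g : haslfp (fdual f) -> haslfp (fdual g) ->
  (forall x, f x <<= g x) -> gfpB f <<= gfpB g.
Proof.
move=> hf hg fg; apply: le_neg; apply: lfp_mono => // x; exact: le_neg.
Qed.

Lemma lfp_dual f : lfpB (fdual f) = bneg (gfpB f).
Proof. by rewrite /gfpB bnegK. Qed.

Lemma gfp_dual f : gfpB (fdual f) = bneg (lfpB f).
Proof. by rewrite /gfpB fdualK. Qed.

End BalgTheory.

(** * Hierarchical equation systems *)

Definition upd {T} (y : nat -> T) (j : nat) (x : T) : nat -> T :=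
  fun i => if i == j then x else y i.

Lemma upd_same T (y : nat -> T) j x : upd y j x j = x.
Proof. by rewrite /upd eqxx. Qed.

Lemma upd_ne T (y : nat -> T) j x i : i != j -> upd y j x i = y i.
Proof. by rewrite /upd => /negbTE->. Qed.

(* [hmu j] marks the least fixpoints; a larger index binds further out. *)
Record hes (B : balg) := Hes {
  hfun : nat -> (nat -> B) -> B; hmu : nat -> bool; hbase : B }.

Section Hes.
Variables (B : balg) (h : hes B).
Local Notation F := (hfun h).
Local Notation mu := (hmu h).
Implicit Types (y z t : nat -> B).

Definition fxp (b : bool) (f : B -> B) (t : B) : B :=
  if b then lfpB (fun x => f x ⊓ t) else gfpB f.

(** Gaussian elimination: the components of [y] from [j] on are parameters, and the equations below
    [j] are solved in terms of them, smaller indices nested inside larger ones. *)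
Fixpoint sol (j : nat) y : nat -> B :=
  if j is j'.+1 then
    sol j' (upd y j' (fxp (mu j') (fun x => F j' (sol j' (upd y j' x))) btop))
  else y.

Definition lev j y : B -> B := fun x => F j (sol j (upd y j x)).

Lemma solS j y : sol j.+1 y = sol j (upd y j (fxp (mu j) (lev j y) btop)).
Proof. by []. Qed.

(** In place of completeness only the fixpoints actually used are required. They include the least
    fixpoints cut down by an arbitrary [t], because restrictors are arbitrary elements. *)
Record hes_good : Prop := HesGood {
  hgood_mono : forall j y z, (forall i, y i <<= z i) -> F j y <<= F j z;
  hgood_lfp : forall j y (t : B), haslfp (fun x => lev j y x ⊓ t);
  hgood_gfp : forall j y, haslfp (fdual (lev j y)) }.

Hypothesis good : hes_good.

Lemma sol_ge j y i : j <= i -> sol j y i = y i.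
Proof.
elim: j y => // j IH y ji; rewrite solS IH ?(ltnW ji) // upd_ne //.
by rewrite neq_ltn ji orbT.
Qed.

Lemma sol_agree j y z : (forall i, j <= i -> y i = z i) -> sol j y = sol j z.
Proof.
elim: j y z => [|j IH] y z yz; first by apply: funext => i; apply: yz.
have ag x : sol j (upd y j x) = sol j (upd z j x).
  by apply: IH => i ji; rewrite /upd; case: eqP => // /eqP ne; apply: yz; rewrite ltn_neqAle eq_sym ne.
rewrite !solS (_ : lev j y = lev j z) //.
by apply: funext => x; rewrite /lev ag.
Qed.

Lemma lev_agree j y z : (forall i, j < i -> y i = z i) -> lev j y = lev j z.
Proof.
move=> yz; apply: funext => x; rewrite /lev; congr F.
apply: sol_agree => i ji; rewrite /upd; case: eqP => // /eqP ne.
by apply: yz; rewrite ltn_neqAle eq_sym ne.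
Qed.

Lemma fxp_mono b (f g : B -> B) (s t : B) :
  (forall t : B, haslfp (fun x => f x ⊓ t)) -> haslfp (fdual f) ->
  (forall t : B, haslfp (fun x => g x ⊓ t)) -> haslfp (fdual g) ->
  (forall x, f x <<= g x) -> s <<= t -> fxp b f s <<= fxp b g t.
Proof.
move=> f1 f2 g1 g2 fg st; case: b => /=; last exact: gfp_mono.
by apply: lfp_mono => // x; apply: meet_mono.
Qed.

Lemma sol_mono j y z : (forall i, j <= i -> y i <<= z i) ->
  forall i, sol j y i <<= sol j z i.
Proof.
elim: j y z => [|j IH] y z yz i; first exact: yz.
rewrite !solS; apply: (IH) => {}i ji; rewrite /upd; case: eqP => [_|/eqP ne]; last first.
  by apply: yz; rewrite ltn_neqAle eq_sym ne.
apply: fxp_mono => //; try by move=> *; apply: hgood_lfp.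
- exact: hgood_gfp.
- exact: hgood_gfp.
move=> x; apply: hgood_mono => // i'; apply: IH => k jk.
rewrite /upd; case: eqP => // /eqP ne.
by apply: yz; rewrite ltn_neqAle eq_sym ne.
Qed.

Lemma lev_mono j y z x x' : (forall i, j < i -> y i <<= z i) -> x <<= x' ->
  lev j y x <<= lev j z x'.
Proof.
move=> yz xx'; apply: hgood_mono => // i; apply: sol_mono => {}i ji.
rewrite /upd; case: eqP => // /eqP ne.
by apply: yz; rewrite ltn_neqAle eq_sym ne.
Qed.

Lemma levmonof j y : monof (lev j y).
Proof. by move=> x x'; apply: lev_mono. Qed.

Lemma levtmonof j y (t : B) : monof (fun x => lev j y x ⊓ t).
Proof. by move=> x x' xx'; apply: meet_mono => //; apply: levmonof. Qed.

Lemma fxp_fix j y : fxp (mu j) (lev j y) btop = lev j y (fxp (mu j) (lev j y) btop).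
Proof.
rewrite /fxp; case: (mu j); last by rewrite gfpE //; [exact: levmonof|exact: hgood_gfp].
rewrite -[RHS]meet_top (lfpE (@levtmonof j y btop)) //; exact: hgood_lfp.
Qed.

Lemma sol_idem i j y : i <= j -> sol i (sol j y) = sol j y.
Proof.
elim: j y => [|j IH] y; first by rewrite leqn0 => /eqP->.
rewrite leq_eqVlt => /predU1P[->|ij]; last by rewrite solS IH.
by apply: sol_agree => i' ji'; rewrite sol_ge.
Qed.

Lemma sol_lt i j y : i < j -> sol j y i = F i (sol j y).
Proof.
elim: j y => // j IH y; rewrite ltnS leq_eqVlt solS => /predU1P[->|/IH//].
by rewrite {1}sol_ge // upd_same {1}fxp_fix.
Qed.

Lemma sol_fxp i j y : i < j ->
  sol j y i = fxp (mu i) (lev i (sol j y)) btop.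
Proof.
elim: j y => // j IH y; rewrite ltnS leq_eqVlt solS => /predU1P[->|/IH//].
rewrite {1}sol_ge // upd_same; congr fxp; apply: lev_agree => i' ji'.
by rewrite sol_ge ?(ltnW ji') // upd_ne // neq_ltn ji' orbT.
Qed.

(* Restrictors: every least fixpoint [j] is taken below [t j], where the inner
   equations are solved without restriction. *)
Variable M : nat.

Fixpoint env_rec n t : nat -> B :=
  if n is n'.+1 then
    let j := M - n'.+1 in
    upd (env_rec n' t) j (fxp (mu j) (lev j (env_rec n' t)) (t j))
  else fun=> hbase h.
Definition env t := env_rec M t.

Lemma env_rec_stable n d t j : M - n <= j -> n + d <= M ->
  env_rec (n + d) t j = env_rec n t j.
Proof.
move=> nj; elim: d => [|d IH]; rewrite ?addn0 // addnS => nd /=.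
rewrite upd_ne ?IH ?(ltnW nd) // neq_ltn; apply/orP; right.
apply: leq_trans nj; rewrite -addnS; apply: ltn_sub2l; last by rewrite addnS ltnS leq_addr.
by apply: leq_trans nd; rewrite ltnS leq_addr.
Qed.

Lemma env_ge t j : M <= j -> env t j = hbase h.
Proof. by move=> Mj; rewrite /env -[X in env_rec X]add0n env_rec_stable ?subn0 ?add0n. Qed.

Lemma env_lt t j : j < M -> env t j = fxp (mu j) (lev j (env t)) (t j).
Proof.
move=> jM; set n := M - j.+1.
have nM : n < M by rewrite /n -subn_gt0 subKn.
have En : M - n.+1 = j by rewrite /n subnSK // subKn // ltnW.
have E : env t j = env_rec n.+1 t j.
  have := @env_rec_stable n.+1 (M - n.+1) t j.
  by rewrite subnKC // En /env => ->.
rewrite E /= En upd_same; congr fxp; apply: lev_agree => i ji.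
have := @env_rec_stable n (M - n) t i.
by rewrite subnKC ?(ltnW nM) // /n subKn // /env => ->.
Qed.

Lemma env_ind (P : nat -> Prop) :
  (forall j, j < M -> (forall i, j < i -> i < M -> P i) -> P j) ->
  forall j, j < M -> P j.
Proof.
move=> IH j; move: {2}(M - j) (leqnn (M - j)) => n; elim: n j => [|n IHn] j.
  by rewrite leqn0 subn_eq0 leqNgt => /negP + /[dup] jM => /(_ jM).
move=> jn jM; apply: IH => // i ji iM; apply: IHn => //.
rewrite -ltnS; apply: leq_trans jn; exact: ltn_sub2l.
Qed.

Lemma env_agree s t i : (forall j, i <= j -> s j = t j) ->
  forall j, i <= j -> env s j = env t j.
Proof.
move=> st j ij; case: (ltnP j M) => [jM|Mj]; last by rewrite !env_ge.
elim/env_ind: j / jM ij => j jM IH ij; rewrite !env_lt // st //; congr fxp.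
apply: lev_agree => i' ji'; case: (ltnP i' M) => [iM|Mi]; last by rewrite !env_ge.
by apply: IH => //; apply: leq_trans ij (ltnW ji').
Qed.

Lemma env_ext s t : (forall j, j < M -> s j = t j) -> env s = env t.
Proof.
move=> st; apply: funext => j; case: (ltnP j M) => [jM|Mj]; last by rewrite !env_ge.
elim/env_ind: j / jM => j jM IH; rewrite !env_lt // st //; congr fxp.
apply: lev_agree => i' ji'; case: (ltnP i' M) => [iM|Mi]; last by rewrite !env_ge.
exact: IH.
Qed.

Lemma env_mono s t : (forall j, s j <<= t j) -> forall j, env s j <<= env t j.
Proof.
move=> st j; case: (ltnP j M) => [jM|Mj]; last by rewrite !env_ge.
elim/env_ind: j / jM => j jM IH; rewrite !env_lt //.
apply: fxp_mono => //; try by move=> *; apply: hgood_lfp.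
- exact: hgood_gfp.
- exact: hgood_gfp.
move=> x; apply: lev_mono => // i ji.
case: (ltnP i M) => [iM|Mi]; last by rewrite !env_ge.
exact: IH.
Qed.

Lemma env_top_below t i : (forall j, j < i -> t j = btop) -> i <= M ->
  sol i (env t) = env t.
Proof.
move=> ti iM; apply: funext => j; case: (leqP i j) => [ij|ji]; first by rewrite sol_ge.
have jM := leq_trans ji iM.
elim/env_ind: j / jM ji => j jM IH ji.
rewrite sol_fxp // env_lt // ti //; congr fxp; apply: lev_agree => i' ji'.
case: (leqP i i') => [ii'|i'i]; first by rewrite sol_ge.
by apply: IH => //; apply: leq_trans i'i iM.
Qed.

Definition below_top i t : nat -> B := fun j => if j < i then btop else t j.

Lemma env_below i t : i <= M -> env (below_top i t) = sol i (env t).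
Proof.
move=> iM; rewrite -(@env_top_below (below_top i t) i) //; last first.
  by move=> j ji; rewrite /below_top ji.
apply: sol_agree; apply: env_agree => j ij.
by rewrite /below_top ltnNge ij.
Qed.

Definition hval := env (fun=> btop).

Lemma hval_sol y : (forall j, M <= j -> y j = hbase h) -> hval = sol M y.
Proof.
move=> yt; rewrite /hval -(@env_top_below _ M) //; apply: sol_agree => i Mi.
by rewrite env_ge // yt.
Qed.

Lemma hvalE j : j < M -> hval j = F j hval.
Proof. by move=> jM; rewrite (@hval_sol (fun=> hbase h)) // sol_lt. Qed.

Lemma env_le_hval t j : env t j <<= hval j.
Proof. by apply: env_mono => i; exact: le_top. Qed.

(** Unfolding [i] enters the inner equations afresh, and these are solved without restriction. So
    the restrictors below [i] return to [btop], while those at [i] and further out survive. *)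
Lemma env_unfold t i : i < M -> env t i <<= F i (env (below_top i t)).
Proof.
move=> iM; rewrite env_below ?(ltnW iM) //.
have E : lev i (env t) (env t i) = F i (sol i (env t)).
  rewrite /lev; congr F; apply: sol_agree => j ij; rewrite /upd.
  by case: eqP => // ->.
rewrite -E; move: (env_lt t iM); rewrite /fxp; case: (mu i) => Ei.
  have H := lfpE (@levtmonof i (env t) (t i)) (hgood_lfp good _ _ _).
  rewrite -Ei in H; have {}H : lev i (env t) (env t i) ⊓ t i = env t i := H.
  by move: (meetl (lev i (env t) (env t i)) (t i)); rewrite H.
have H := gfpE (@levmonof i (env t)) (hgood_gfp good _ _).
by rewrite -Ei in H; rewrite H.
Qed.

Lemma env_restr t i : i < M -> mu i -> env t i <<= t i.
Proof.
move=> iM mi; rewrite env_lt // /fxp mi.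
rewrite -(lfpE (@levtmonof i (env t) (t i))); last exact: hgood_lfp.
exact: meetr.
Qed.

(* Kozen's strengthening: if [c] meets a least fixpoint, it meets its unfolding
   in which the recursive calls avoid [c]. *)
Lemma env_strengthen t i c : i < M -> mu i -> bnz (c ⊓ env t i) ->
  bnz (c ⊓ F i (env (below_top i (upd t i (t i ⊓ bneg c))))).
Proof.
move=> iM mi nz; set t' := upd t i _ => zero; apply: nz.
have agr j : i < j -> env t' j = env t j.
  move=> ij; apply: (@env_agree _ _ i.+1) => // j' ij'; rewrite /t' upd_ne //.
  by rewrite neq_ltn ij' orbT.
have levE : lev i (env t') = lev i (env t) by exact: lev_agree.
set f := fun x => lev i (env t) x ⊓ t i.
have t'i : t' i = t i ⊓ bneg c by rewrite /t' upd_same.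
have E' : env t' i = lfpB (fun x => lev i (env t) x ⊓ t' i).
  by rewrite env_lt // /fxp mi levE.
have Fx : F i (env (below_top i t')) = lev i (env t) (env t' i).
  rewrite env_below ?(ltnW iM) // -levE /lev; congr F; apply: sol_agree => j ij.
  by rewrite /upd; case: eqP => // ->.
(* If the unfolding missed [c], the more restricted fixpoint would be prefixed for the less
   restricted map; hence [env t i] would itself lie below [bneg c]. *)
have fle : env t i <<= env t' i.
  rewrite env_lt // /fxp mi; apply: lfp_le; first exact: hgood_lfp.
  rewrite {2}E' -(lfpE (@levtmonof i (env t) (t' i))); last exact: hgood_lfp.
  rewrite -E' t'i; apply: le_meet; first exact: meetl.
  apply: le_meet; first exact: meetr.
  apply: ble_trans (meetl _ _) _; apply/bneg_adj; rewrite meetC -Fx; exact: zero.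
apply: ble_trans (meet_mono (ble_refl c) fle) _.
rewrite meetC; apply/bneg_adj; apply: ble_trans (env_restr _ _ _) _ => //.
rewrite t'i; exact: meetr.
Qed.

End Hes.

(** The negation of a solution is again the solution of a system, so the negated right side of an
    inequality can be run as one more thread. *)
Definition hdual (B : balg) (h : hes B) : hes B :=
  Hes (fun j y => bneg (hfun h j (fun i => bneg (y i)))) (fun j => ~~ hmu h j)
    (bneg (hbase h)).

Section HesDual.
Variables (B : balg) (h : hes B).
Hypothesis good : hes_good h.

Lemma sol_dual j y : sol (hdual h) j y = fun i => bneg (sol h j (fun i => bneg (y i)) i).
Proof.
elim: j y => [|j IH] y; first by apply: funext => i; rewrite /= bnegK.
have levE : lev (hdual h) j y = fdual (lev h j (fun i => bneg (y i))).
  apply: funext => x; rewrite /lev /fdual /= IH; congr (bneg (hfun h j _)).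
  apply: funext => i; rewrite bnegK; congr (sol h j _ i).
  by apply: funext => i'; rewrite /upd; case: eqP.
rewrite !solS IH levE; apply: funext => i; congr (bneg (sol h j _ i)).
apply: funext => i'; rewrite /upd; case: eqP => // _.
rewrite /fxp /=; case: (hmu h j) => /=.
  rewrite gfp_dual bnegK; congr lfpB; apply: funext => x; exact/esym/meet_top.
rewrite /gfpB; congr (bneg (lfpB _)).
by apply: funext => x; rewrite meet_top.
Qed.

Lemma hval_dual M j : hval (hdual h) M j = bneg (hval h M j).
Proof.
rewrite (@hval_sol _ (hdual h) M (fun=> bneg (hbase h))) // sol_dual.
by rewrite (@hval_sol _ h M (fun=> hbase h)) // bnegK.
Qed.

End HesDual.

(** * Infinite sequences *)

Definition inf_often (P : nat -> Prop) := forall N, exists2 n, N <= n & P n.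
Definition eventually (P : nat -> Prop) := exists N, forall n, N <= n -> P n.

Lemma not_inf_often P : ~ inf_often P -> eventually (fun n => ~ P n).
Proof.
move=> h; apply: contrapT => no; apply: h => N; apply: contrapT => h.
by apply: no; exists N => n Nn Pn; apply: h; exists n.
Qed.

Lemma not_eventually P : ~ eventually P -> inf_often (fun n => ~ P n).
Proof.
move=> h N; apply: contrapT => no; apply: h; exists N => n Nn.
by apply: contrapT => Pn; apply: no; exists n.
Qed.

Lemma eventually_and P Q : eventually P -> eventually Q ->
  eventually (fun n => P n /\ Q n).
Proof.
move=> [N hN] [N' hN']; exists (maxn N N') => n; rewrite geq_max => /andP[a b].
by split; [apply: hN | apply: hN'].
Qed.

Lemma eventually_fin (T : finType) (Q : T -> nat -> Prop) :
  (forall x, eventually (Q x)) -> eventually (fun n => forall x, Q x n).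
Proof.
move=> h.
suff [N hN] : eventually (fun n => forall x, x \in index_enum T -> Q x n).
  by exists N => n Nn x; apply: hN; rewrite ?mem_index_enum.
elim: (index_enum T) => [|x s IH]; first by exists 0.
have [N hN] := eventually_and (h x) IH; exists N => n /hN[Qx Qs] y.
by rewrite inE => /orP[/eqP->//|/Qs].
Qed.

Lemma inf_often_fin (T : finType) (f : nat -> T) P : inf_often P ->
  exists x, inf_often (fun n => P n /\ f n = x).
Proof.
move=> h; apply: contrapT => no.
have [N hN] : eventually (fun n => forall x, ~ (P n /\ f n = x)).
  apply: eventually_fin => x; apply: not_inf_often => hx; apply: no.
  by exists x.
by have [n /hN hn Pn] := h N; apply: (hn (f n)).
Qed.

Lemma inf_often_sub (P Q : nat -> Prop) : (forall n, P n -> Q n) -> inf_often P -> inf_often Q.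
Proof. by move=> PQ h N; have [n Nn /PQ Qn] := h N; exists n. Qed.

Lemma inf_often_ev (P Q : nat -> Prop) : inf_often P -> eventually Q ->
  inf_often (fun n => P n /\ Q n).
Proof.
move=> hP [N hN] K; have [n] := hP (maxn N K).
by rewrite geq_max => /andP[a b] Pn; exists n => //; split => //; apply: hN.
Qed.

(** Applied to indices this is the parity condition: [x] is the outermost variable regenerated
    infinitely often. *)
Definition limsup_is (f : nat -> nat) (x : nat) :=
  eventually (fun n => f n <= x) /\ inf_often (fun n => f n = x).

Lemma limsup_exists (f : nat -> nat) M : eventually (fun n => f n < M) ->
  exists2 x, x < M & limsup_is f x.
Proof.
elim: M => [|M IH] h; first by case: h => N /(_ N (leqnn N)).
have [hM|/not_inf_often hM] := pselect (inf_often (fun n => f n = M)).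
  by exists M.
have [|x xM hx] := IH; last by exists x => //; exact: ltnW.
have [N hN] := eventually_and h hM; exists N => n /hN[].
by rewrite ltnS leq_eqVlt => /predU1P[].
Qed.

Lemma limsup_uniq f x y : limsup_is f x -> limsup_is f y -> x = y.
Proof.
move=> [[N hN] hx] [[N' hN'] hy]; apply/eqP; rewrite eqn_leq.
have [n N'n fn] := hx N'; have [k Nk fk] := hy N.
by rewrite -{1}fn hN' // -fk hN.
Qed.

Lemma limsup_ext f g x : eventually (fun n => f n = g n) -> limsup_is f x -> limsup_is g x.
Proof.
move=> fg [hx ix]; split.
  by have [N hN] := eventually_and hx fg; exists N => n /hN[a <-].
by apply: inf_often_sub (inf_often_ev ix fg) => n [<- ->].
Qed.

Lemma limsup_shift f x d : limsup_is f x <-> limsup_is (fun n => f (d + n)) x.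
Proof.
split=> [[[N hN] ix]|[[N hN] ix]]; split.
- by exists N => n Nn; apply: hN; apply: leq_trans Nn (leq_addl _ _).
- move=> K; have [n Kn fn] := ix (d + K); exists (n - d).
    by rewrite leq_subRL //; apply: leq_trans Kn; exact: leq_addr.
  by rewrite subnKC //; apply: leq_trans Kn; exact: leq_addr.
- exists (d + N) => n Nn; rewrite -(subnKC (leq_trans (leq_addr _ _) Nn)); apply: hN.
  by rewrite leq_subRL //; apply: leq_trans Nn; exact: leq_addr.
by move=> K; have [n Kn fn] := ix K; exists (d + n) => //; apply: leq_trans Kn (leq_addl _ _).
Qed.

Lemma nonincr_stable (k : nat -> nat) : (forall n, k n.+1 <= k n) ->
  exists v, eventually (fun n => k n = v).
Proof.
move=> hk; have mono n d : k (n + d) <= k n.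
  by elim: d => [|d IH]; rewrite ?addn0 // addnS; apply: leq_trans (hk _) IH.
have [] := @limsup_exists k (k 0).+1.
  by exists 0 => n _; rewrite ltnS -[n]add0n; exact: mono.
move=> v _ [[N hN] iv]; exists v, N => n Nn; apply/eqP; rewrite eqn_leq hN //=.
by have [i ni <-] := iv n; rewrite -(subnKC ni); exact: mono.
Qed.

(** * Decorated threads *)

Section Threads.
Variables (B : balg) (H : finType) (M m : nat) (hh : H -> hes B).
Hypothesis good : forall h, hes_good (hh h).

Notation state := {ffun 'I_m -> option (H * 'I_M)}.
Notation item := ('I_m * 'I_M)%type.

(** Stamps and clock have no influence on the value [cval]; they settle which restrictor is
    strengthened next and which ones are forgotten. *)
Record conf := Conf {
  cu : state;
  ct : 'I_m -> nat -> B;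
  cstamp : 'I_m -> nat -> nat;
  cclock : nat }.

Definition meet_at (u : state) (v : H -> nat -> 'I_m -> B) : B :=
  bmeets (fun s => if u s is Some (h, i) then v h i s else btop).

Definition cval (c : conf) : B :=
  meet_at (cu c) (fun h i s => env (hh h) M (ct c s) i).

Implicit Types (c : conf) (x y z : item).

Definition passes (u : state) x : bool :=
  if u x.1 is Some (h, i) then hmu (hh h) i && (i == x.2) else false.

(* Items are ordered by the time of their last reset. *)
Definition ckey c (s : 'I_m) (j : nat) : nat := cstamp c s j * (M * m).+1 + (j * m + s).

Definition ikey c x := ckey c x.1 x.2.

Definition active c : option item :=
  [pick x | passes (cu c) x && [forall y, passes (cu c) y ==> (ikey c x <= ikey c y)]].

Definition t_old c (k : nat) (s : 'I_m) (j : nat) : B :=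
  if k < ckey c s j then btop else ct c s j.

(** The context which the recursive calls of [x] are told to avoid. It ignores the restrictors
    younger than [x], which keep changing; the older ones eventually freeze, so the same context can
    recur. *)
Definition ctx c x : B :=
  bmeets (fun s => if s == x.1 then btop else
    if cu c s is Some (h, i) then env (hh h) M (t_old c (ikey c x) s) i else btop).

Definition t_str c (s : 'I_m) (j : nat) : B :=
  if active c is Some x then
    if (s == x.1) && (j == x.2) then ct c s j ⊓ bneg (ctx c x)
    else t_old c (ikey c x) s j
  else ct c s j.

Definition t_next c (s : 'I_m) : nat -> B :=
  if cu c s is Some (h, i) then below_top i (t_str c s) else t_str c s.

Definition fval c : B :=
  meet_at (cu c) (fun h i s => hfun (hh h) i (env (hh h) M (t_next c s))).

Lemma meet_at_mono (u : state) (v w : H -> nat -> 'I_m -> B) :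
  (forall s h i, u s = Some (h, i) -> v h i s <<= w h i s) ->
  meet_at u v <<= meet_at u w.
Proof.
by move=> vw; apply: meets_mono => s; case E: (u s) => [[h i]|] //; exact: vw.
Qed.

(** Dropping the younger restrictors only enlarges the meet and turns the part outside the active
    slot into [ctx c x]. Kozen's strengthening applies to this element and the active slot; all
    other slots are simply unfolded. *)
Lemma fval_nz c : bnz (cval c) -> bnz (fval c).
Proof.
rewrite /fval => nz; case Ea : (active c) => [x|]; last first.
  apply: nz_le nz _; apply: meet_at_mono => s h i us.
  rewrite /t_next us; apply: ble_trans (env_unfold (good h) (ct c s) (ltn_ord i)) _.
  by rewrite (_ : t_str c s = ct c s) // /t_str Ea.
have px : passes (cu c) x.
  by move: Ea; rewrite /active; case: pickP => // ? /andP[p _] [<-].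
move: px; rewrite /passes; case E: (cu c x.1) => [[h i]|] // /andP[mi /eqP ix].
have to_le s' j : ct c s' j <<= t_old c (ikey c x) s' j.
  by rewrite /t_old; case: ifP => // _; exact: le_top.
have old_x : t_old c (ikey c x) x.1 i = ct c x.1 i.
  by rewrite /t_old ix ltnn.
have : bnz (ctx c x ⊓ env (hh h) M (t_old c (ikey c x) x.1) i).
  apply: nz_le nz _; apply: le_meet.
    apply: meets_mono => s; case: ifP => [_|_]; first exact: le_top.
    by case: (cu c s) => [[h' i']|] //; apply: (env_mono (good h')).
  apply: ble_trans (meets_le _ x.1) _; rewrite E; exact: (env_mono (good h)).
move/(env_strengthen (good h) (ltn_ord i) mi) => nz'.
apply: nz_le nz' _; apply/le_meets => s.
case Es: (cu c s) => [[h' i']|]; last exact: le_top.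
rewrite /t_next Es.
have [sx|sx] := eqVneq s x.1.
  move: Es; rewrite sx E => -[<- <-]; apply: ble_trans (meetr _ _) _.
  apply: (hgood_mono (good h)) => j; apply: (env_mono (good h)) => {}j.
  rewrite /below_top; case: ifP => // _; rewrite /t_str Ea eqxx /= /upd ix.
  by case: eqP => // ->; rewrite -ix old_x.
apply: ble_trans (meetl _ _) _; apply: ble_trans (meets_le _ s) _.
rewrite (negbTE sx) Es.
apply: ble_trans (env_unfold (good h') _ (ltn_ord i')) _.
apply: (hgood_mono (good h')) => j; apply: (env_mono (good h')) => {}j.
by rewrite /below_top; case: ifP => // _; rewrite /t_str Ea (negbTE sx).
Qed.

Definition creset c (fr : pred 'I_m) (s : 'I_m) (j : nat) : bool :=
  fr s || (if cu c s is Some (h, i) then j < i else false).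

Definition cnext c (u' : state) (fr : pred 'I_m) : conf :=
  Conf u' (fun s => if fr s then fun=> btop else t_next c s)
    (fun s j => if creset c fr s j then (cclock c).+1 else cstamp c s j)
    (cclock c).+1.

Definition cinit (u : state) : conf := Conf u (fun _ _ => btop) (fun _ _ => 0) 0.

Definition conf_ok c := forall s j, cstamp c s j <= cclock c.

Lemma cinit_ok u : conf_ok (cinit u). Proof. by []. Qed.

Lemma cnext_ok c u' fr : conf_ok c -> conf_ok (cnext c u' fr).
Proof. by move=> ok s j /=; case: ifP => // _; apply: leq_trans (ok s j) _. Qed.

Definition keeps (u u' : state) (fr : pred 'I_m) :=
  forall s, ~~ fr s -> exists h i i', u s = Some (h, i) /\ u' s = Some (h, i').

Lemma cval_next c u' fr : keeps (cu c) u' fr ->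
  cval (cnext c u' fr) = bmeets (fun s =>
    if u' s is Some (h, i) then
      if fr s then hval (hh h) M i else env (hh h) M (t_next c s) i
    else btop).
Proof.
move=> kp; rewrite /cval /meet_at /=; congr bmeets; apply: funext => s.
by case: (u' s) => // -[h i]; case: (fr s).
Qed.

Section Sequence.
Variables (cs : nat -> conf) (frs : nat -> pred 'I_m).
Hypothesis cs0 : conf_ok (cs 0).
Hypothesis csS : forall n, cs n.+1 = cnext (cs n) (cu (cs n.+1)) (frs n).
Hypothesis nz : forall n, bnz (cval (cs n)).

Let rst n x := creset (cs n) (frs n) x.1 x.2.

Lemma seq_ok n : conf_ok (cs n).
Proof. by elim: n => // n IH; rewrite csS; exact: cnext_ok. Qed.

Lemma seq_clock n : cclock (cs n) = cclock (cs 0) + n.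
Proof. by elim: n => [|n IH]; rewrite ?addn0 // csS /= IH addnS. Qed.

Lemma seq_stamp n x : cstamp (cs n.+1) x.1 x.2 =
  if rst n x then (cclock (cs n)).+1 else cstamp (cs n) x.1 x.2.
Proof. by rewrite csS. Qed.

Lemma seq_stamp_mono n x : cstamp (cs n) x.1 x.2 <= cstamp (cs n.+1) x.1 x.2.
Proof.
rewrite seq_stamp; case: ifP => // _; apply: leq_trans (seq_ok n _ _) _ => //.
Qed.

Lemma code_lt x : x.2 * m + x.1 < M * m.
Proof.
case: x => [[s sm] [j jM]] /=.
have : j.+1 * m <= M * m by rewrite leq_mul2r jM orbT.
by rewrite mulSn; lia.
Qed.

Lemma ikey_inj n : injective (ikey (cs n)).
Proof.
move=> x y; rewrite /ikey /ckey => e.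
have := congr1 (fun k => k %% (M * m).+1) e.
rewrite !modnMDl !modn_small ?ltnS ?(ltnW (code_lt _)) // => e'.
have m0 : 0 < m by case: (x.1) => [? /=]; lia.
have e1 := congr1 (fun k => k %% m) e'; have e2 := congr1 (fun k => k %/ m) e'.
rewrite /= !modnMDl !modn_small // in e1.
rewrite /= !divnMDl // !divn_small // !addn0 in e2.
by case: x y e1 e2 {e e'} => [x1 x2] [y1 y2] /= /val_inj-> /val_inj->.
Qed.

Lemma stamp_key n x y : cstamp (cs n) x.1 x.2 < cstamp (cs n) y.1 y.2 ->
  ikey (cs n) x < ikey (cs n) y.
Proof.
move=> h; rewrite /ikey /ckey; apply: leq_trans (_ : cstamp (cs n) y.1 y.2 * (M * m).+1 <= _); last exact: leq_addr.
apply: leq_trans (_ : (cstamp (cs n) x.1 x.2).+1 * (M * m).+1 <= _).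
  by rewrite mulSn; have := code_lt x; lia.
by rewrite leq_mul2r h orbT.
Qed.

Let P x := eventually (fun n => ~~ rst n x) /\ inf_often (fun n => passes (cu (cs n)) x).

Lemma active_passes n x : active (cs n) = Some x -> passes (cu (cs n)) x.
Proof. by rewrite /active; case: pickP => // ? /andP[p _] [<-]. Qed.

(** Take an offending item [y] with the smallest key. From some time on it is active whenever it is
    passed, the older restrictors are frozen, and its own restrictor only decreases. Two passings in
    the same state then have the same context. The first one puts the negation of that context into
    the restrictor, and the second configuration lies below the context as well, so it is zero. *)
Lemma no_persistent_pass x : ~ P x.
Proof.
move=> Px.
have [N1 hN1] : eventually (fun n => forall x, eventually (fun n => ~~ rst n x) -> ~~ rst n x).
  apply: eventually_fin => z.
  have [[N hN]|no] := pselect (eventually (fun n => ~~ rst n z)).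
    by exists N => n /hN.
  by exists 0.
pose O z := eventually (fun n => ~~ rst n z).
have Ost n z : N1 <= n -> O z -> cstamp (cs n) z.1 z.2 = cstamp (cs N1) z.1 z.2.
  move=> N1n Oz; rewrite -(subnKC N1n); elim: (n - N1) => [|d IH]; first by rewrite addn0.
  by rewrite addnS seq_stamp (negbTE (hN1 _ _ _ _)) //; exact: leq_addr.
have Okey n z : N1 <= n -> O z -> ikey (cs n) z = ikey (cs N1) z.
  by move=> N1n Oz; rewrite /ikey /ckey Ost.
have [y Py miny] : exists2 y, P y & forall z, P z -> ikey (cs N1) y <= ikey (cs N1) z.
  move: {2}(ikey _ x) (leqnn (ikey (cs N1) x)) => k; elim: k x Px => [|k IH] x Px kx.
    by exists x => // z _; apply: leq_trans kx _.
  have [[z Pz zk]|no] := pselect (exists2 z, P z & ikey (cs N1) z <= k).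
    exact: IH z Pz zk.
  exists x => // z Pz; apply: leq_trans kx _; rewrite ltnNge; apply/negP => zk.
  by apply: no; exists z.
have Oy : O y := Py.1.
have notO z : ~ O z -> eventually (fun n => ikey (cs n) y < ikey (cs n) z).
  move=> /not_eventually nO.
  have [n] := nO (maxn N1 (cstamp (cs N1) y.1 y.2)); rewrite geq_max => /andP[N1n sn] /negP.
  rewrite negbK => rz; exists n.+1 => k nk; apply: stamp_key.
  rewrite (Ost k) //; last by apply: leq_trans nk; apply: leq_trans N1n _.
  apply: leq_trans (_ : cstamp (cs n.+1) z.1 z.2 <= _).
    by rewrite seq_stamp rz ltnS seq_clock; apply: leq_trans sn (leq_addl _ _).
  rewrite -(subnKC nk); elim: (k - n.+1) => [|d IH]; first by rewrite addn0.
  by rewrite addnS; apply: leq_trans IH (seq_stamp_mono _ _).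
have [N2 hN2] : eventually (fun n => forall z, ~ O z -> ikey (cs n) y < ikey (cs n) z).
  apply: eventually_fin => z; have [Oz|nO] := pselect (O z); first by exists 0 => n _ /(_ Oz).
  by have [N hN] := notO z nO; exists N => n /hN.
have [N3 hN3] : eventually (fun n => forall z, O z -> ikey (cs N1) z < ikey (cs N1) y ->
    ~ passes (cu (cs n)) z).
  apply: eventually_fin => z; have [Pz|nP] := pselect (P z).
    by exists 0 => n _ _; rewrite ltnNge miny.
  have [Oz|nO] := pselect (O z); last by exists 0.
  have [N hN] : eventually (fun n => ~ passes (cu (cs n)) z).
    by apply: not_inf_often => h; apply: nP; split.
  by exists N => n /hN.
pose N := maxn N1 (maxn N2 N3).
have NN n : N <= n -> [/\ N1 <= n, N2 <= n & N3 <= n].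
  by rewrite /N !geq_max => /and3P[].
have older n z : N <= n -> ikey (cs n) z < ikey (cs n) y -> O z.
  by move=> /NN[_ n2 _] zy; apply: contrapT => /(hN2 n n2) /(ltn_trans zy); rewrite ltnn.
have pass_ge n z : N <= n -> passes (cu (cs n)) z -> ikey (cs n) y <= ikey (cs n) z.
  move=> Nn pz; rewrite leqNgt; apply/negP => zy; have Oz := older n z Nn zy.
  have [n1 n2 n3] := NN n Nn; apply: hN3 pz => //.
  by rewrite -(Okey n) // -(Okey n y).
have act n : N <= n -> passes (cu (cs n)) y -> active (cs n) = Some y.
  move=> Nn py; rewrite /active; case: pickP => [z /andP[pz /forallP/(_ y)]|/(_ y)].
    rewrite py /= => zy; congr Some; apply: (@ikey_inj n); apply/eqP; rewrite eqn_leq zy.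
    exact: pass_ge.
  rewrite py /= => /negbT /negP[]; apply/forallP => z; apply/implyP; exact: pass_ge.
have act_ge n z : N <= n -> active (cs n) = Some z -> ikey (cs n) y <= ikey (cs n) z.
  by move=> Nn /active_passes; exact: pass_ge.
have ctS n z : N <= n -> O z -> ct (cs n.+1) z.1 z.2 = t_str (cs n) z.1 z.2.
  move=> Nn Oz; have [n1 _ _] := NN n Nn; have := hN1 n n1 z Oz.
  rewrite csS /= /rst /creset negb_or => /andP[/negbTE-> h]; rewrite /t_next.
  by case: (cu (cs n) z.1) h => // -[h i]; rewrite /below_top => /negbTE->.
(* The active item is never older than [y]; hence an item older than [y] is neither strengthened nor
   forgotten. *)
have frozen n z : N <= n -> ikey (cs N) z < ikey (cs N) y ->
    ct (cs n) z.1 z.2 = ct (cs N) z.1 z.2.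
  move=> Nn zy; have Oz := older N z (leqnn _) zy.
  rewrite -(subnKC Nn); elim: (n - N) => [|d IH]; first by rewrite addn0.
  rewrite addnS ctS ?leq_addr // -IH /t_str.
  have Nd : N <= N + d := leq_addr _ _.
  case E: (active (cs (N + d))) => [w|] //.
  have zw : ikey (cs (N + d)) z < ikey (cs (N + d)) w.
    apply: leq_trans (act_ge _ _ Nd E); have [a _ _] := NN _ Nd; have [b _ _] := NN _ (leqnn N).
    by rewrite !(Okey (N + d)) // -!(Okey N) // in zy *.
  case: ifP => [/andP[/eqP e1 /eqP e2]|_].
    by move: zw; rewrite (_ : z = w) ?ltnn //; case: z w e1 e2 {zy Oz IH E} => ? ? [? ?] /= -> /val_inj->.
  by rewrite /t_old ltnNge (ltnW zw).
have desc n : N <= n -> ct (cs n.+1) y.1 y.2 <<= ct (cs n) y.1 y.2.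
  move=> Nn; rewrite ctS // /t_str; case E: (active (cs n)) => [w|] //.
  case: ifP => _; first exact: meetl.
  by rewrite /t_old ltnNge (act_ge n).
have desc2 n d : N <= n -> ct (cs (n + d)) y.1 y.2 <<= ct (cs n) y.1 y.2.
  move=> Nn; elim: d => [|d IH]; first by rewrite addn0.
  by rewrite addnS; apply: ble_trans IH; apply: desc; apply: leq_trans Nn (leq_addr _ _).
have [u hu] := inf_often_fin (fun n => cu (cs n)) Py.2.
have [n1 Nn1 [p1 u1]] := hu N.
have [n2 n12 [p2 u2]] := hu n1.+1.
have Nn2 : N <= n2 by apply: leq_trans Nn1 (ltnW n12).
have ctxE : ctx (cs n1) y = ctx (cs n2) y.
  rewrite /ctx u1 u2; congr bmeets; apply: funext => s; case: eqP => // /eqP sy.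
  case: (u s) => // -[h i].
  suff -> : env (hh h) M (t_old (cs n1) (ikey (cs n1) y) s) =
      env (hh h) M (t_old (cs n2) (ikey (cs n2) y) s) by [].
  apply: env_ext => j jM.
  pose z : item := (s, Ordinal jM).
  have kz n : N <= n -> (ikey (cs n) y < ikey (cs n) z) = ~~ (ikey (cs N) z < ikey (cs N) y).
    move=> Nn; have [a _ _] := NN n Nn; have [b _ _] := NN _ (leqnn N).
    have [Oz|nO] := pselect (O z).
      rewrite !(Okey n) // !(Okey N) // -leqNgt ltn_neqAle (inj_eq (@ikey_inj N1)).
      by have -> : y != z by apply: contraNneq sy => ->.
    have [_ a2 _] := NN n Nn; have [_ b2 _] := NN _ (leqnn N).
    rewrite (hN2 n a2 _ nO); apply/esym; rewrite -leqNgt ltnW //; exact: hN2.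
  rewrite /t_old -[ckey _ s j]/(ikey _ z) -[ckey (cs n2) s j]/(ikey _ z) !kz //.
  case: ifP => // /negbFE zy.
  by have := frozen n1 z Nn1 zy; have := frozen n2 z Nn2 zy => /= -> ->.
have t1 : ct (cs n1.+1) y.1 y.2 <<= bneg (ctx (cs n1) y).
  by rewrite ctS // /t_str act // !eqxx; exact: meetr.
have t2 : ct (cs n2) y.1 y.2 <<= bneg (ctx (cs n1) y).
  apply: ble_trans t1; rewrite -(subnKC n12); apply: desc2; exact: leqW.
apply: (nz (n := n2)); apply: ble_trans (meet_neg (ctx (cs n2) y)).
apply: le_meet.
  apply: meets_mono => s; case: ifP => [_|_]; first exact: le_top.
  case: (cu (cs n2) s) => // -[h i]; apply: env_mono => // j.
  by rewrite /t_old; case: ifP => // _; exact: le_top.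
rewrite -ctxE; apply: ble_trans t2; apply: ble_trans (meets_le _ y.1) _.
move: p2; rewrite /passes; case: (cu (cs n2) y.1) => // -[h i] /andP[mi /eqP <-].
by apply: env_restr.
Qed.

(** If [i] were a least fixpoint, its item in slot [s] would be passed infinitely often, and never
    reset once no larger index occurs in the slot. *)
Lemma thread_limsup s h (idx : nat -> nat) i n0 :
  (forall n, n0 <= n -> ~~ frs n s /\
     exists2 k : 'I_M, cu (cs n) s = Some (h, k) & idx n = k) ->
  limsup_is idx i -> ~~ hmu (hh h) i.
Proof.
move=> hs [[N hN] io]; apply/negP => mi.
have [n n0n ein] := io n0; have [_ [k _ ek]] := hs n n0n.
have iM : i < M by rewrite -ein ek.
apply: (@no_persistent_pass (s, Ordinal iM)); split.
  exists (maxn n0 N) => n'; rewrite geq_max => /andP[a b].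
  have [fr [k' uk ek']] := hs n' a; rewrite /rst /creset (negbTE fr) /= uk -leqNgt -ek'.
  exact: hN.
move=> N'; have [n' ge e] := io (maxn N' n0); move: ge; rewrite geq_max => /andP[a b].
exists n' => //; have [_ [k' uk ek']] := hs n' b; rewrite /passes /= uk.
have -> : k' = Ordinal iM by apply: val_inj; rewrite /= -ek'.
by rewrite /= mi eqxx.
Qed.

End Sequence.
End Threads.

Lemma dependent_choice (T : Type) (P : T -> Prop) (R : T -> T -> Prop) x0 :
  P x0 -> (forall x, P x -> exists2 y, P y & R x y) ->
  exists f : nat -> T, [/\ f 0 = x0, forall n, P (f n) & forall n, R (f n) (f n.+1)].
Proof.
move=> P0 h; have nx (x : {x | P x}) : {y : {y | P y} | R (sval x) (sval y)}.
  by apply: cid; case: x => x Px; have [y Py Rxy] := h x Px; exists (exist _ y Py).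
pose f := fix f n : {x | P x} := if n is n'.+1 then sval (nx (f n')) else exist _ x0 P0.
exists (fun n => sval (f n)); split=> // n; first exact: (svalP (f n)).
exact: (svalP (nx (f n))).
Qed.

(** * Determinization of trace conditions *)

Section Determinization.
Variables (Q : finType) (r : nat) (mu : nat -> bool).

(* A letter lists, for every pair of states, the labels of the available trace
   segments between them. *)
Definition letter := {ffun Q * Q -> {set 'I_r}}.
Implicit Types (a : nat -> letter).

Definition bad_trace a (g : nat -> Q) (l : nat -> 'I_r) x :=
  [/\ eventually (fun n => l n \in a n (g n, g n.+1)), limsup_is (fun n => l n) x & mu x].

Definition bad_word a := exists g l x, bad_trace a g l x.

Lemma bad_word_shift a d : bad_word (fun n => a (d + n)) <-> bad_word a.
Proof.
split=> [[g [l [x [[N hN] hl hx]]]]|[g [l [x [[N hN] hl hx]]]]].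
  exists (fun n => g (n - d)), (fun n => l (n - d)), x; split => //.
    exists (d + N) => n Nn; have dn : d <= n := leq_trans (leq_addr _ _) Nn.
    by have := hN (n - d); rewrite subnKC // subSn //; apply; rewrite leq_subRL.
  apply/(limsup_shift _ _ d); apply: limsup_ext hl; exists 0 => n _.
  by rewrite addKn.
exists (fun n => g (d + n)), (fun n => l (d + n)), x; split => //.
  by exists N => n Nn; rewrite addnS; apply: hN; apply: leq_trans Nn (leq_addl _ _).
by apply/(limsup_shift (fun n => l n)).
Qed.

(* [None] is the empty word. *)
Definition lmul (v : option letter) (b : letter) : letter :=
  if v is Some c then
    [ffun p => [set m : 'I_r | `[< exists (g : Q) (i j : 'I_r), [/\ i \in c (p.1, g), j \in b (g, p.2) &
        m = maxn i j :> nat] >]]]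
  else b.

Fixpoint wprod a i d : option letter :=
  if d is d'.+1 then Some (lmul (wprod a i d') (a (i + d'))) else None.

Lemma wprodS a i d : wprod a i d.+1 = Some (lmul (wprod a i d) (a (i + d))).
Proof. by []. Qed.

Definition wval a i n := wprod a i (n - i).

Lemma wval_self a n : wval a n n = None.
Proof. by rewrite /wval subnn. Qed.

Lemma wvalS a i n : i <= n -> wval a i n.+1 = Some (lmul (wval a i n) (a n)).
Proof. by move=> le; rewrite /wval subSn //= subnKC. Qed.

Lemma wval_merge a i j n n' : i <= n -> j <= n -> n <= n' ->
  wval a i n = wval a j n -> wval a i n' = wval a j n'.
Proof.
move=> i_n jn nn' e; rewrite -(subnKC nn'); elim: (n' - n) => [|d IH]; first by rewrite addn0.
by rewrite addnS !wvalS ?IH //; lia.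
Qed.

(** A product retains exactly the largest label of each path through the block, which is all that
    the parity condition needs. *)
Lemma mem_wprod a i d b g g' (m : 'I_r) : wprod a i d.+1 = Some b ->
  (m \in b (g, g')) <->
  exists p l, [/\ p i = g, p (i + d.+1) = g',
    forall k, i <= k < i + d.+1 -> l k \in a k (p k, p k.+1) /\ l k <= m &
    exists2 k, i <= k < i + d.+1 & l k = m].
Proof.
elim: d b g g' m => [|d IH] b g g' m.
  rewrite /= addn0 => -[<-]; split.
    move=> h; exists (fun k => if k == i then g else g'), (fun=> m).
    rewrite !eqxx addn1; split => //; first by rewrite gtn_eqF.
      move=> k; rewrite ltnS -eqn_leq => /eqP <-.
      by rewrite eqxx (gtn_eqF (ltnSn _)).
    by exists i; rewrite // leqnn /=.
  case=> p [l [<- <- h [k ki <-]]]; have [] := h k ki.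
  by move: ki; rewrite addn1 ltnS -eqn_leq => /eqP <-.
move: (IH); rewrite (wprodS a i d.+1).
case E: (wprod a i d.+1) => [c|]; last by move: E => /=.
move=> {}IH [<-] /=; rewrite ffunE inE; split.
  move/asboolP => [g1 [i1 [j1 [hi hj em]]]].
  have /(IH c g g1 i1 erefl)[p [l [p0 p1 hl [k0 k0i lk0]]]] := hi.
  exists (fun k => if k <= i + d.+1 then p k else g'),
         (fun k => if k < i + d.+1 then l k else j1); split.
  - by rewrite leq_addr.
  - by rewrite leqNgt ltn_add2l ltnSn.
  - move=> k /andP[ik kd]; case: (ltnP k (i + d.+1)) => kd'.
      rewrite (ltnW kd'); have [] := hl k; first by rewrite ik.
      by move=> -> le; split=> //; rewrite em; apply: leq_trans le (leq_maxl _ _).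
    have -> : k = i + d.+1 by lia.
    by rewrite leqnn p1 em leq_maxr.
  have [le|lt] := leqP i1 j1.
    exists (i + d.+1); rewrite ?ltnn; first lia.
    by apply: val_inj; rewrite /= em; apply/esym/maxn_idPr.
  exists k0; first lia.
  have -> : k0 < i + d.+1 by lia.
  by rewrite lk0; apply: val_inj; rewrite /= em; apply/esym/maxn_idPl/ltnW.
case=> p [l [p0 p1 hl [k0 k0i lk0]]]; apply/asboolP.
have [ms hms] : exists2 ms : 'I_r, (forall k, i <= k < i + d.+1 -> l k <= ms) &
    exists2 k, i <= k < i + d.+1 & l k = ms.
  elim: d {IH E k0i hl p1} => [|d [ms h1 [k h2 h3]]].
    by exists (l i); [move=> k ki; have -> : k = i by lia | exists i => //; lia].
  have [le|lt] := leqP (l (i + d.+1)) ms.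
    exists ms; last by exists k => //; lia.
    move=> k' k'i; have [->//|ne] := eqVneq k' (i + d.+1).
    by apply: h1; lia.
  exists (l (i + d.+1)); last by exists (i + d.+1) => //; lia.
  move=> k' k'i; have [->//|ne] := eqVneq k' (i + d.+1).
  by apply: leq_trans (ltnW lt); apply: h1; lia.
move=> [k1 k1i lk1].
exists (p (i + d.+1)), ms, (l (i + d.+1)); split.
- apply/(IH c g _ ms erefl); exists p, l; split => //; last by exists k1.
  by move=> k ki; split; [have [] := hl k; first lia | exact: hms].
- have [] := hl (i + d.+1); first lia.
  by rewrite -p1 -addnS.
apply/eqP; rewrite eqn_leq; apply/andP; split.
  rewrite -lk0 leq_max; have [->|ne] := eqVneq k0 (i + d.+1); first by rewrite leqnn orbT.
  by rewrite hms //; lia.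
by rewrite geq_max -lk1 !(hl _ _).2 //; lia.
Qed.

Definition bad_loop (v : option letter) : bool :=
  if v is Some c then [exists g, [exists m, (m \in c (g, g)) && mu m]] else false.

(* The Ramsey-type factorization criterion. *)
Lemma bad_word_loop a (ys : nat -> nat) (e : option letter) :
  (forall k, ys k < ys k.+1) -> (forall k l, k < l -> wval a (ys k) (ys l) = e) ->
  bad_word a <-> bad_loop e.
Proof.
move=> inc he.
have mono k l : k <= l -> ys k <= ys l.
  by move=> kl; rewrite -(subnKC kl); elim: (l - k) => [|d IH]; rewrite ?addn0 // addnS; apply: leq_trans IH (ltnW (inc _)).
have monol k l : k < l -> ys k < ys l by move=> kl; apply: leq_trans (inc k) (mono _ _ kl).
have unb k : k <= ys k by elim: k => // k IH; apply: leq_ltn_trans IH (inc k).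
have memP k l c g g' m : k < l -> e = Some c -> (m \in c (g, g')) <->
    exists p lb, [/\ p (ys k) = g, p (ys l) = g',
    forall n, ys k <= n < ys l -> lb n \in a n (p n, p n.+1) /\ lb n <= m &
    exists2 n, ys k <= n < ys l & lb n = m].
  move=> kl ec; have := he k l kl; rewrite ec /wval.
  have h := monol _ _ kl; have -> : ys l - ys k = (ys l - ys k).-1.+1 by lia.
  move/(@mem_wprod a (ys k) _ c g g' m).
  by have -> : ys k + (ys l - ys k).-1.+1 = ys l by lia.
case Ee: e => [c|] /=; last first.
  by have := he 0 1 erefl; rewrite Ee /wval; have := inc 0; case E: (ys 1 - ys 0) => //; lia.
split.
  case=> g [l [x [[N hN] [[N' hN'] io] mx]]].
  (* A bad trace is in the same state at infinitely many cut points. Between two of them that are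
     late enough and enclose a label [x], it is a loop with maximum [x]. *)
  have [q hq] := @inf_often_fin Q (fun k => g (ys k)) (fun=> True) (fun N => ex_intro2 _ _ N (leqnn N) I).
  have [k1 k1N [_ g1]] := hq (maxn N N').
  have [n n1 ln] := io (ys k1).
  have [k2 k2n [_ g2]] := hq n.+1.
  have n2 : n < ys k2 := leq_trans k2n (unb _).
  have k12 : k1 < k2.
    by rewrite ltnNge; apply/negP => /mono h; move: n2; rewrite ltnNge (leq_trans h n1).
  apply/existsP; exists q; apply/existsP; exists (l n); rewrite ln mx andbT.
  apply/(memP k1 k2 c q q (l n) k12 Ee); exists g, l; split => //; last first.
    by exists n => //; rewrite n1.
  move=> i /andP[i1 i2].
  have : maxn N N' <= i by apply: leq_trans k1N (leq_trans (unb _) i1).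
  by rewrite geq_max => /andP[iN iN']; rewrite hN // ln hN'.
move=> /existsP[q /existsP[m /andP[qm mm]]].
have blk k : {pl : (nat -> Q) * (nat -> 'I_r) | [/\ pl.1 (ys k) = q, pl.1 (ys k.+1) = q,
    forall n, ys k <= n < ys k.+1 -> pl.2 n \in a n (pl.1 n, pl.1 n.+1) /\ pl.2 n <= m &
    exists2 n, ys k <= n < ys k.+1 & pl.2 n = m]}.
  by apply: cid; have /(memP k k.+1 c q q m (ltnSn k) Ee)[p [l h]] := qm; exists (p, l).
pose pl k := projT1 (blk k); have plP k := projT2 (blk k).
(* Conversely the loop is realized in every block and the realizations are concatenated; [kk n] is
   the block containing position [n]. *)
pose kk := fix kk n := if n is n'.+1 then
  if ys (kk n').+1 <= n then (kk n').+1 else kk n' else 0.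
have kk_lt n : n < ys (kk n).+1.
  elim: n => [|n IH] /=; first by apply: leq_ltn_trans (inc 0).
  case: ifP => [h|/negbT]; last by rewrite -ltnNge.
  by apply: leq_ltn_trans (inc _).
have kk_ge n : ys 0 <= n -> ys (kk n) <= n.
  elim: n => [|n IH] //= h; case: ifP => // /negbT; rewrite -ltnNge => h2.
  case: (ltnP n (ys 0)) => [lt|/IH]; last by move/leqW.
  suff -> : kk n = 0 by [].
  elim: n lt {IH h h2} => //= n IH lt; rewrite IH; last exact: ltnW.
  by rewrite ifN // -ltnNge; apply: ltn_trans lt (inc 0).
have kk_y k n : ys k <= n < ys k.+1 -> kk n = k.
  move=> /andP[h1 h2]; have h0 : ys 0 <= n by apply: leq_trans h1; exact: mono.
  apply/eqP; rewrite eqn_leq; apply/andP; split; rewrite leqNgt; apply/negP => /mono h.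
    by have := leq_trans h (kk_ge n h0); rewrite leqNgt h2.
  by have := leq_trans h h1; rewrite leqNgt kk_lt.
exists (fun n => (pl (kk n)).1 n), (fun n => (pl (kk n)).2 n), m; split => //.
  exists (ys 0) => n n0; have h1 := kk_ge n n0; have h2 := kk_lt n.
  have [pq1 pq2 hp _] := plP (kk n); have [] := hp n; first by rewrite h1.
  rewrite -/(pl _) => h _; move: h; congr (_ \in a n (_, _)).
  have [e1|ne] := eqVneq n.+1 (ys (kk n).+1); last first.
    by rewrite (@kk_y (kk n) n.+1) //; apply/andP; split; lia.
  rewrite (@kk_y (kk n).+1 n.+1); last by rewrite e1 leqnn inc.
  by have [] := plP (kk n).+1; rewrite e1 -/(pl _) => ->.
split.
  exists (ys 0) => n n0; have [_ _ hp _] := plP (kk n).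
  by have [] := hp n; first by rewrite kk_ge ?kk_lt.
move=> N; have [_ _ _ [n hn e1]] := plP N.
exists n; first by case/andP: hn => h _; apply: leq_trans (unb N) h.
by rewrite (kk_y _ _ hn) /pl e1.
Qed.

(* Threads are started at every position and carry the product read since.
   There are more slots than products, so two threads always agree and the
   younger one can be dropped. *)
Variable k : nat.
Hypothesis letter_card : #|{: option letter}| = k.
Local Notation K := k.+1.

(** For slots [p < q] the second component holds the product read between the births of their
    threads. It becomes the candidate loop when the two threads merge. *)
Definition dstate := ({ffun 'I_K -> option letter} * {ffun 'I_K * 'I_K -> option letter})%type.

Definition dinit : dstate := ([ffun=> None], [ffun=> None]).

Definition dmult (c : dstate) (b : letter) (i : 'I_K) : option letter := Some (lmul (c.1 i) b).

Definition is_dup (c : dstate) b (p : 'I_K * 'I_K) : bool :=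
  (p.1 < p.2) && (dmult c b p.1 == dmult c b p.2).

Definition ddup (c : dstate) b : 'I_K * 'I_K :=
  odflt (ord0, ord0)
    [pick p | is_dup c b p && [forall q, is_dup c b q ==> (p.1 <= q.1)]].

Definition dold (j p : 'I_K) : option 'I_K := omap (lift j) (unlift ord_max p).

Definition dstep (c : dstate) b : dstate :=
  let j := (ddup c b).2 in
  ([ffun p => if dold j p is Some q then dmult c b q else None],
   [ffun pq => match dold j pq.1, dold j pq.2 with
               | Some p, Some q => c.2 (p, q)
               | Some p, None => dmult c b p
               | _, _ => None end]).

(** The smaller the surviving slot of a merge, the higher the priority; the parity bit says whether
    the product between the two births has a bad loop. *)
Definition dpri (c : dstate) b : nat :=
  (K - (ddup c b).1).*2 + bad_loop (c.2 (ddup c b)).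

Definition dbound := K.*2.+2.

Lemma dpri_bound c b : dpri c b < dbound.
Proof.
clear letter_card; rewrite /dpri /dbound -!addnn; have := leq_subr (ddup c b).1 K.
by case: bad_loop; lia.
Qed.

Lemma ddupP c b : is_dup c b (ddup c b) /\ forall q, is_dup c b q -> (ddup c b).1 <= q.1.
Proof.
rewrite /ddup; case: pickP => [p /andP[h /forallP hp]|no] /=.
  by split => // q /(implyP (hp q)).
suff [p hp] : exists p, is_dup c b p.
  exfalso; move: {2}(p.1 : nat) (leqnn p.1) => n; elim: n p hp => [|n IH] p hp pn.
    by have := no p; rewrite hp => /negbT/negP[]; apply/forallP => q; apply/implyP => _; apply: leq_trans pn _.
  have := no p; rewrite hp => /negbT; rewrite negb_forall => /existsP[q].
  by rewrite negb_imply -ltnNge => /andP[hq qp]; apply: (IH q) => //; rewrite -ltnS; apply: leq_trans qp pn.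
apply: contrapT => nodup.
suff /leq_card : injective (dmult c b) by rewrite card_ord letter_card ltnn.
move=> i j e; apply: val_inj; apply/eqP; apply: contrapT => /negP; rewrite neq_ltn => h.
by apply: nodup; case/orP: h => h; [exists (i, j) | exists (j, i)]; rewrite /is_dup /= h e eqxx.
Qed.

Fixpoint drun (c : dstate) a n : dstate :=
  if n is n'.+1 then dstep (drun c a n') (a n') else c.

Definition dreach (c : dstate) := exists a n, c = drun dinit a n.

Lemma dreach_init : dreach dinit.
Proof. by exists (fun=> [ffun=> set0]), 0. Qed.

Lemma drun_agree c a a' n : (forall i, i < n -> a i = a' i) -> drun c a n = drun c a' n.
Proof.
elim: n => //= n IH h; rewrite IH ?h // => i ni; apply: h; exact: ltnW.
Qed.

Lemma drun_add c a n n' : drun c a (n + n') = drun (drun c a n) (fun i => a (n + i)) n'.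
Proof. by elim: n' => [|n' IH]; rewrite ?addn0 // addnS /= IH. Qed.

Lemma dreach_step c b : dreach c -> dreach (dstep c b).
Proof.
case=> a [n ->]; exists (fun i => if i == n then b else a i), n.+1 => /=.
by rewrite eqxx; congr (dstep _ b); apply: drun_agree => i ni; rewrite ltn_eqF.
Qed.

Section Run.
Variable a : nat -> letter.
Let c n := drun dinit a n.
Let dd n := ddup (c n) (a n).

(** Birth times are ghost data. They grow without bound and are not part of the state, which has to
    stay finite. *)
Fixpoint births n (p : 'I_K) : nat :=
  if n is n'.+1 then if dold (dd n').2 p is Some q then births n' q else n
  else 0.

Lemma dold_lt (j p q : 'I_K) : dold j p = Some q -> (p < j -> q = p) /\ (j <= p -> q = p.+1 :> nat).
Proof.
rewrite /dold; case: unliftP => [p' ->|//] [<-]; split; rewrite lift_max.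
  by move=> pj; apply: ord_inj; rewrite lift_max /= /bump leqNgt pj.
by rewrite /= /bump => ->.
Qed.

Lemma dold_none (j p : 'I_K) : dold j p = None -> p = ord_max.
Proof. by rewrite /dold; case: unliftP. Qed.

Lemma dold_stable (j p : 'I_K) : p < j -> dold j p = Some p.
Proof.
move=> pj; case E: (dold j p) => [q|]; first by have [->] := dold_lt E.
by move: pj; rewrite (dold_none E) ltnNge leq_ord.
Qed.

Lemma dold_mono (j p p' q q' : 'I_K) : dold j p = Some q -> dold j p' = Some q' ->
  p < p' -> q < q'.
Proof.
move=> /dold_lt[h1 h2] /dold_lt[h1' h2'] pp'.
have [pj|jp] := ltnP p j; have [p'j|jp'] := ltnP p' j.
- by rewrite h1 ?h1'.
- by rewrite h1 ?h2' // (leq_trans pp').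
- by move: jp; rewrite leqNgt (ltn_trans pp').
- by rewrite h2 ?h2'.
Qed.

Lemma births_le n p : births n p <= n.
Proof.
elim: n p => //= n IH p; case: dold => // q; exact: leqW.
Qed.

Lemma run_inv n :
  (forall p, (c n).1 p = wval a (births n p) n) /\
  (forall p q : 'I_K, p < q -> (c n).2 (p, q) = wval a (births n p) (births n q)).
Proof.
elim: n => [|n [IH1 IH2]]; first by split=> [p|p q _]; rewrite /= ffunE.
have M q : dmult (c n) (a n) q = wval a (births n q) n.+1.
  by rewrite /dmult wvalS ?births_le // IH1.
split=> [p|p q pq]; rewrite /= ffunE -/(c n) -/(dd n) /=.
  case: (dold _ p) => [q|]; last by rewrite wval_self.
  exact: M.
case E: (dold _ p) => [p'|]; last by move: pq; rewrite (dold_none E) ltnNge leq_ord.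
case E': (dold _ q) => [q'|]; last exact: M.
apply: IH2; exact: dold_mono E E' pq.
Qed.

(** Let [i] be the smallest slot that survives merges infinitely often. Its thread is eventually
    never dropped, whereas the threads merged into it are born later and later. Consider the merges
    whose stored product is [e]. Their births cut the word into blocks with product [e], because
    after a merge both births yield the same product. The loop criterion then applies to [e]. *)
Lemma drun_correct : exists2 x,
  limsup_is (fun n => dpri (c n) (a n)) x & odd x <-> bad_word a.
Proof.
have [x _ [[N hN] io]] : exists2 x, x < K.+1 & limsup_is (fun n => K - (dd n).1) x.
  by apply: limsup_exists; exists 0 => n _; rewrite ltnS leq_subr.
have x0 : 0 < x.
  by have [n _ <-] := io 0; rewrite subn_gt0 ltn_ord.
have xK : x <= K by have [n _ <-] := io 0; rewrite leq_subr.
have iK : K - x < K by lia.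
pose i : 'I_K := Ordinal iK.
have dge n : N <= n -> i <= (dd n).1 by move=> /hN /=; have := ltn_ord (dd n).1; lia.
have iP n : K - (dd n).1 = x <-> (dd n).1 = i.
  have h := ltn_ord (dd n).1; split=> [e|->] /=; last lia.
  by apply: val_inj => /=; lia.
have dup n := ddupP (c n) (a n).
have dlt n : (dd n).1 < (dd n).2 by have [/andP[]] := dup n.
have stab n : N <= n -> births n i = births N i.
  move=> Nn; rewrite -(subnKC Nn); elim: (n - N) => [|d IH]; first by rewrite addn0.
  rewrite addnS /= dold_stable ?IH //.
  by apply: leq_ltn_trans (dlt _); apply: dge; rewrite leq_addr.
(* The number of threads born up to time [T] never grows, and it decreases whenever one of them is
   dropped. *)
have unb T : eventually (fun n => T < births n (dd n).2).
  have [v [N1 hv]] : exists v, eventually (fun d => #|[set p | births (T + d) p <= T]| = v).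
    apply: nonincr_stable => d; rewrite addnS.
    rewrite -(card_in_imset (f := fun p => odflt ord0 (dold (dd (T + d)).2 p))).
      apply: subset_leq_card; apply/subsetP => _ /imsetP[p + ->]; rewrite !inE /=.
      by case: dold => //= ; rewrite leqNgt ltnS leq_addr.
    move=> p p'; rewrite !inE /=.
    case E: (dold _ p) => [q|]; last by rewrite leqNgt ltnS leq_addr.
    case E': (dold _ p') => [q'|]; last by move=> _; rewrite leqNgt ltnS leq_addr.
    move=> _ _ /= qq; move: E E'; rewrite /dold.
    case: unliftP => // u -> [e1]; case: unliftP => // u' -> [e2].
    by congr (lift _ _); move: qq; rewrite -e1 -e2 => /lift_inj.
  exists (T + N1) => n nT; rewrite ltnNge; apply/negP => le.
  pose d := n - T; have en : n = T + d by rewrite /d subnKC // (leq_trans (leq_addr _ _) nT).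
  have d1 : N1 <= d by rewrite /d leq_subRL // (leq_trans (leq_addr _ _) nT).
  have := hv d.+1 (leqW d1); rewrite -(hv d d1) => e.
  suff : #|[set p | births (T + d.+1) p <= T]| < #|[set p | births (T + d) p <= T]| by rewrite e ltnn.
  rewrite addnS -en.
  rewrite (cardsD1 (dd n).2 [set p | births n p <= T]) inE le add1n ltnS.
  rewrite -(card_in_imset (f := fun p => odflt ord0 (dold (dd n).2 p))).
    apply: subset_leq_card; apply/subsetP => _ /imsetP[p + ->]; rewrite !inE /=.
    case E: dold => [q|] /=; last by rewrite leqNgt ltnS en leq_addr.
    move=> ->; rewrite andbT; move: E; rewrite /dold; case: unliftP => // u _ [<-].
    by rewrite eq_sym neq_lift.
  move=> p p'; rewrite !inE /=.
  case E: (dold _ p) => [q|]; last by rewrite leqNgt ltnS en leq_addr.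
  case E': (dold _ p') => [q'|]; last by move=> _; rewrite leqNgt ltnS en leq_addr.
  move=> _ _ /= qq; move: E E'; rewrite /dold.
  case: unliftP => // u -> [e1]; case: unliftP => // u' -> [e2].
  by congr (lift _ _); move: qq; rewrite -e1 -e2 => /lift_inj.
pose ev n := (c n).2 (dd n).
have evE n : N <= n -> (dd n).1 = i -> ev n = wval a (births N i) (births n (dd n).2).
  move=> Nn di; rewrite /ev -(stab n Nn) -di; have [_ <-] := run_inv n; last exact: dlt.
  by case: (dd n).
have loop e : inf_often (fun n => (dd n).1 = i /\ ev n = e) -> bad_word a <-> bad_loop e.
  move=> ie.
  have nxt T : {n | [/\ N <= n, T < n, T < births n (dd n).2 & (dd n).1 = i /\ ev n = e]}.
    apply: cid; have [N1 h1] := unb T.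
    have [n] := ie (maxn N (maxn T.+1 N1)); rewrite !geq_max => /and3P[? ? ?] ?.
    by exists n; split => //; apply: h1.
  pose tm := fix tm k1 := if k1 is k'.+1 then projT1 (nxt (tm k')) else projT1 (nxt 0).
  have tmP k1 : [/\ N <= tm k1, (dd (tm k1)).1 = i & ev (tm k1) = e].
    by case: k1 => [|k1] /=; [case: (projT2 (nxt 0)) | case: (projT2 (nxt (tm k1)))] => ? _ _ [].
  have tmS k1 : tm k1 < tm k1.+1 by case: (projT2 (nxt (tm k1))).
  have tmB k1 : tm k1 < births (tm k1.+1) (dd (tm k1.+1)).2 by case: (projT2 (nxt (tm k1))).
  have tml k1 l : k1 < l -> tm k1 < births (tm l) (dd (tm l)).2.
    elim: l => // l IH; rewrite ltnS leq_eqVlt => /predU1P[->|/IH h]; first exact: tmB.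
    apply: ltn_trans (tmB l); apply: leq_trans h _; exact: births_le.
  apply: (@bad_word_loop a (fun k1 => births (tm k1) (dd (tm k1)).2)).
    by move=> k'; apply: leq_ltn_trans (tmB k'); exact: births_le.
  move=> k' l kl; have [N1 d1 e1] := tmP k'; have [N2 d2 e2] := tmP l.
  rewrite -e2 evE //; apply/esym.
  apply: (@wval_merge a _ _ (tm k').+1); rewrite ?(leqW (births_le _ _)) //.
  - by apply: leqW; rewrite -(stab _ N1); exact: births_le.
  - exact: tml.
  have [/andP[_ /eqP]] := dup (tm k'); rewrite -/(dd _) /dmult d1 !(run_inv _).1 => h.
  by rewrite !wvalS ?births_le // -?(stab _ N1) ?births_le //= h.
(* Each product that recurs at [i] gives the correct bit, and the remaining ones, finitely many,
   disappear eventually. *)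
have [N2 hN2] : eventually (fun n => (dd n).1 = i -> bad_loop (ev n) = `[< bad_word a >]).
  have [N2 hN2] : eventually (fun n => forall e,
      (dd n).1 = i -> ev n = e -> bad_loop e = `[< bad_word a >]).
    apply: eventually_fin => e.
    have [ie|/not_inf_often[N2 h]] := pselect (inf_often (fun n => (dd n).1 = i /\ ev n = e)).
      by exists 0 => n _ _ _; apply/idP/asboolP; have := loop e ie; tauto.
    by exists N2 => n /h no di ee; case: no.
  by exists N2 => n /hN2 h di; apply: h.
exists (x.*2 + `[< bad_word a >]); last first.
  by rewrite oddD odd_double /=; split; case: asboolP.
have ioi : inf_often (fun n => (dd n).1 = i) by apply: inf_often_sub io => n /iP.
split.
  exists (maxn N N2) => n; rewrite geq_max => /andP[n1 n2]; rewrite /dpri.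
  have [di|ne] := pselect ((dd n).1 = i).
    by rewrite -/(dd n) -/(ev n) hN2 // leq_add2r leq_double; apply: hN.
  have lt : K - (dd n).1 < x.
    by rewrite ltn_neqAle hN // andbT; apply/eqP => /iP.
  rewrite -/(dd n) -!addnn; case: bad_loop; case: asbool; lia.
apply: inf_often_sub (inf_often_ev ioi (ex_intro _ N2 hN2)) => n [di h].
by rewrite /dpri -/(dd n) -/(ev n) h // (iP n).2.
Qed.

End Run.

Theorem determinization (c : dstate) a : dreach c -> exists2 x,
  limsup_is (fun n => dpri (drun c a n) (a n)) x & odd x <-> bad_word a.
Proof.
case=> b [d ->]; pose w n := if n < d then b n else a (n - d).
have wa : (fun n => w (d + n)) = a.
  by apply: funext => n; rewrite /w ltnNge leq_addr /= addKn.
have [x /(limsup_shift _ _ d) hx hb] := drun_correct w; exists x.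
  apply: limsup_ext hx; exists 0 => n _.
  have -> : w (d + n) = a n by rewrite -wa.
  have wb : drun dinit b d = drun dinit w d.
    by apply: drun_agree => i i_d; rewrite /w i_d.
  by rewrite drun_add wa wb.
by rewrite hb -(bad_word_shift w d) wa.
Qed.

End Determinization.

(** * Kozen algebras *)

(** [kdef] takes the place of completeness: fixpoints are assumed for definable maps only. Since
    definable maps are monotone, negation enters as dualization. *)
Record kozen (Act : Type) := Kozen {
  kb :> balg;
  kdia : Act -> kb -> kb;
  kdef : ((nat -> kb) -> kb) -> Prop;
  kdia_mono : forall a, monof (kdia a);
  kdef_mono : forall f, kdef f -> forall y z, (forall i, y i <<= z i) -> f y <<= f z;
  kdef_var : forall i, kdef (fun y => y i);
  kdef_const : forall b, kdef (fun=> b);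
  kdef_meet : forall f g, kdef f -> kdef g -> kdef (fun y => f y ⊓ g y);
  kdef_dia : forall a f, kdef f -> kdef (fun y => kdia a (f y));
  kdef_neg : forall f, kdef f -> kdef (fun y => bneg (f (fun i => bneg (y i))));
  kdef_sub : forall f g j, kdef f -> kdef g -> kdef (fun y => f (upd y j (g y)));
  kdef_haslfp : forall f j y, kdef f -> haslfp (fun x => f (upd y j x));
  kdef_lfp : forall f j, kdef f -> kdef (fun y => lfpB (fun x => f (upd y j x))) }.

Definition kbox {Act} {K : kozen Act} (a : Act) (x : K) : K := bneg (kdia a (bneg x)).

(* The global existential modality. *)
Definition bE {B : balg} (x : B) : B := if pselect (bnz x) then btop else bbot.

Definition kglobal {Act} (K : kozen Act) :=
  forall f, @kdef Act K f -> kdef (fun y => bE (f y)).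

Definition knormal {Act} (K : kozen Act) :=
  (forall a (x y : K), kdia a x ⊓ kbox a y <<= kdia a (x ⊓ y)) /\
  (forall a, kdia a bbot <<= (bbot : K)).

Section KozenTheory.
Variables (Act : Type) (K : kozen Act).

Lemma bE_nz (x : K) : bnz x -> bE x = btop.
Proof. by rewrite /bE; case: pselect. Qed.

Lemma bE_mono : monof (@bE K).
Proof.
move=> x y xy; have [nx|nx] := pselect (bnz x).
  by rewrite (bE_nz (nz_le nx xy)); exact: le_top.
by rewrite {1}/bE; case: pselect.
Qed.

Lemma nz_bE (x c : K) : bnz (c ⊓ bE x) -> bnz x.
Proof.
move=> h; apply: contrapT => nx; apply: h; apply: ble_trans (meetr _ _) _.
by rewrite /bE; case: pselect.
Qed.

Lemma kbox_mono a : monof (@kbox Act K a).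
Proof. by move=> x y xy; apply: le_neg; apply: kdia_mono; exact: le_neg. Qed.

Lemma kdef_ext (f g : (nat -> K) -> K) : (forall y, f y = g y) -> kdef f -> kdef g.
Proof. by move/funext => ->. Qed.

Lemma kdef_join (f g : (nat -> K) -> K) : kdef f -> kdef g -> kdef (fun y => f y ⊔ g y).
Proof.
move=> /kdef_neg df /kdef_neg dg; have := kdef_neg (kdef_meet df dg).
apply: kdef_ext => y; rewrite /bjoin.
by have -> : (fun i => bneg (bneg (y i))) = y by apply: funext => i; rewrite bnegK.
Qed.

Lemma kdef_box a (f : (nat -> K) -> K) : kdef f -> kdef (fun y => kbox a (f y)).
Proof.
move=> /kdef_neg df; have := kdef_neg (kdef_dia a df).
apply: kdef_ext => y; rewrite /kbox.
by have -> : (fun i => bneg (bneg (y i))) = y by apply: funext => i; rewrite bnegK.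
Qed.

Lemma kdef_meets (T : finType) (f : T -> (nat -> K) -> K) :
  (forall x, kdef (f x)) -> kdef (fun y => bmeets (fun x => f x y)).
Proof.
move=> df; rewrite /bmeets; elim: (index_enum T) => [|x s IH].
  by apply: (kdef_ext (f := fun=> btop)) (kdef_const _) => y; rewrite big_nil.
by apply: kdef_ext (kdef_meet (df x) IH) => y; rewrite big_cons.
Qed.

Lemma kdef_joins (T : finType) (f : T -> (nat -> K) -> K) :
  (forall x, kdef (f x)) -> kdef (fun y => bjoins (fun x => f x y)).
Proof.
move=> df; have dn x := kdef_neg (df x).
have := kdef_neg (kdef_meets dn).
apply: kdef_ext => y; rewrite /bjoins; congr (bneg (bmeets _)); apply: funext => x.
by have -> : (fun i => bneg (bneg (y i))) = y by apply: funext => i; rewrite bnegK.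
Qed.

(** A right-hand side takes a whole sequence as argument, while [kdef_sub] replaces a single
    variable; hence closure under simultaneous substitution is asked for separately. *)
Record hes_def (h : hes K) : Prop := HesDef {
  hdef_mono : forall j y z, (forall i, y i <<= z i) -> hfun h j y <<= hfun h j z;
  hdef_def : forall j g, (forall i, kdef (g i)) ->
    kdef (fun y => hfun h j (fun i => g i y)) }.

Lemma hes_def_dual h : hes_def h -> hes_def (hdual h).
Proof.
case=> mono def; split=> [j y z yz|j g dg] /=.
  by apply: le_neg; apply: mono => i; apply: le_neg.
have dn i := kdef_neg (dg i).
apply: kdef_ext (kdef_neg (def j _ dn)) => y.
congr (bneg (hfun h j _)); apply: funext => i; congr (bneg (g i _)).
by apply: funext => i'; rewrite bnegK.
Qed.

Lemma sol_def h : hes_def h -> forall j i, kdef (fun y => sol h j y i).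
Proof.
move=> dh; elim=> [|j IH] i; first exact: kdef_var.
have dl : kdef (fun y => hfun h j (sol h j y)).
  by apply: kdef_ext (hdef_def dh j IH).
apply: (@kdef_sub _ K (fun y => sol h j y i)); first exact: IH.
rewrite /fxp; case: (hmu h j).
  exact: (kdef_lfp j (kdef_meet dl (kdef_const _))).
apply: kdef_ext (kdef_neg (kdef_lfp j (kdef_neg dl))) => y.
rewrite /gfpB /fdual; congr (bneg (lfpB _)); apply: funext => x.
congr (bneg (hfun h j (sol h j _))); apply: funext => i'.
by rewrite /upd; case: eqP => // _; rewrite bnegK.
Qed.

Lemma hes_def_good h : hes_def h -> hes_good h.
Proof.
move=> dh; have dl j : kdef (fun y => hfun h j (sol h j y)).
  by apply: kdef_ext (hdef_def dh j (sol_def dh j)).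
split=> [j y z|j y t|j y]; first exact: hdef_mono.
  exact: (kdef_haslfp j y (kdef_meet (dl j) (kdef_const t))).
have := kdef_haslfp j (fun i => bneg (y i)) (kdef_neg (dl j)).
rewrite /fdual /lev; congr haslfp; apply: funext => x.
congr (bneg (hfun h j (sol h j _))); apply: funext => i'.
by rewrite /upd; case: eqP => // _; rewrite bnegK.
Qed.

End KozenTheory.

(** * Alternating automata and their tableaux *)

Inductive vnode (Lt Act : Type) (r : nat) :=
| NLit of Lt
| NAnd of 'I_r & 'I_r
| NOr of 'I_r & 'I_r
| NDia of Act & 'I_r
| NBox of Act & 'I_r
| NCopy of 'I_r.

Arguments NLit {Lt Act r} _.
Arguments NAnd {Lt Act r} _ _.
Arguments NOr {Lt Act r} _ _.
Arguments NDia {Lt Act r} _ _.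
Arguments NBox {Lt Act r} _ _.
Arguments NCopy {Lt Act r} _.

(* State [q] is the fixpoint variable of index [q]; greatest fixpoints only
   occur at copy nodes. *)
Record vaut (Lt Act : Type) := Vaut {
  vsize : nat;
  vnd : 'I_vsize -> vnode Lt Act vsize;
  vmu : nat -> bool;
  vmuP : forall q : 'I_vsize, ~~ vmu q -> exists a, vnd q = NCopy a }.

Definition nfun Lt Act (K : kozen Act) (lit : Lt -> K) r (nd : vnode Lt Act r)
    (y : nat -> K) : K :=
  match nd with
  | NLit l => lit l
  | NAnd a b => y a ⊓ y b
  | NOr a b => y a ⊔ y b
  | NDia a q => kdia a (y q)
  | NBox a q => kbox a (y q)
  | NCopy q => y q
  end.

Definition vhes Lt Act (K : kozen Act) (lit : Lt -> K) (V : vaut Lt Act) : hes K :=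
  Hes (fun n y => if insub n is Some q then nfun lit (vnd (q : 'I_(vsize V))) y else btop)
      (@vmu _ _ V) btop.

Section VHes.
Variables (Lt Act : Type) (K : kozen Act) (lit : Lt -> K) (V : vaut Lt Act).

Lemma nfun_mono r (nd : vnode Lt Act r) y z : (forall i, y i <<= z i) ->
  nfun lit nd y <<= nfun lit nd z.
Proof.
move=> yz; case: nd => //= *.
- exact: meet_mono.
- exact: join_mono.
- exact: kdia_mono.
- exact: kbox_mono.
Qed.

Lemma vhes_def : hes_def (vhes lit V).
Proof.
split=> [j y z yz|j g dg] /=; first by case: insubP => // *; exact: nfun_mono.
case: insubP => [q _ _|_]; last exact: kdef_const.
case: (vnd q) => /= *.
- exact: kdef_const.
- exact: kdef_meet.
- exact: kdef_join.
- exact: kdef_dia.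
- exact: kdef_box.
- exact: dg.
Qed.

Lemma vhesE (q : 'I_(vsize V)) y : hfun (vhes lit V) q y = nfun lit (vnd q) y.
Proof. by rewrite /= valK. Qed.

End VHes.

(** * Consistency of one modal step *)

Section OneStep.
Variables (Act : Type) (K : kozen Act).

Lemma dia_boxes a (x : K) n (y : 'I_n -> K) (sel : pred 'I_n) : knormal K ->
  kdia a x ⊓ bmeets (fun i => if sel i then kbox a (y i) else btop) <<=
  kdia a (x ⊓ bmeets (fun i => if sel i then y i else btop)).
Proof.
case=> nrm _; rewrite /bmeets; elim: (index_enum _) x => [|i s IH] x.
  by rewrite !big_nil !meet_top.
rewrite !big_cons; case: (sel i).
  by rewrite !meetA; apply: ble_trans _ (IH _); apply: meet_mono.
by rewrite ![btop ⊓ _]meetC !meet_top.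
Qed.

Lemma nz_dia_boxes a (x c : K) n (y : 'I_n -> K) (sel : pred 'I_n) : knormal K ->
  bnz (c ⊓ (kdia a x ⊓ bmeets (fun i => if sel i then kbox a (y i) else btop))) ->
  bnz (x ⊓ bmeets (fun i => if sel i then y i else btop)).
Proof.
move=> nK nz le; apply: nz; apply: ble_trans (meetr _ _) _.
apply: ble_trans (dia_boxes _ _ _ _ nK) _.
by apply: ble_trans (@kdia_mono _ K a _ _ le) _; case: nK.
Qed.

(** What monotonicity gives: if [x] were below [bneg y], then [kdia a x] would be below the negation
    of [kbox a y]. Only one box can be treated in this way, which is the origin of the paired
    targets. *)
Lemma nz_dia_box a (x y c : K) : bnz (c ⊓ (kdia a x ⊓ kbox a y)) -> bnz (x ⊓ y).
Proof.
move=> nz le; apply: nz; apply: ble_trans (meetr _ _) _; apply/bneg_adj.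
by rewrite /kbox bnegK; apply: kdia_mono; apply/bneg_adj.
Qed.

End OneStep.

(** * Tableaux as nondeterministic parity automata *)

Section Tableau.
Variables (Lt Act : Type) (V : vaut Lt Act) (kr : bool).
Notation r := (vsize V).
Notation Q := 'I_r.
Notation nd := (@vnd _ _ V).
Notation mu := (@vmu _ _ V).

(* A resolution of a set of states at a world: the states visited there and the
   disjuncts chosen. States of index at least [k] are not unfolded. *)
Definition rho := ({set Q} * {ffun Q -> bool})%type.
Implicit Types (q : Q) (R : rho) (k : nat).

Definition ledge k R q q' : bool :=
  [&& q \in R.1, q < k & match nd q with
    | NAnd a b => (q' == a) || (q' == b)
    | NOr a b => q' == (if R.2 q then a else b)
    | NCopy a => q' == a
    | _ => false end].

Inductive lpath k R : Q -> Q -> nat -> Prop :=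
| lpath_refl q : lpath k R q q q
| lpath_step q q1 q2 m : ledge k R q q1 -> lpath k R q1 q2 m ->
    lpath k R q q2 (maxn q m).

Definition lclosed k R := forall q q', ledge k R q q' -> q' \in R.1.

Definition lvalid k R := ~ exists (f : nat -> Q) x,
  [/\ forall n, ledge k R (f n) (f n.+1), limsup_is (fun n => f n) x & mu x].

Definition resol k (G : {set Q}) R := [/\ G \subset R.1, lclosed k R & lvalid k R].

Definition mdia k R q : option (Act * Q) :=
  if (q \in R.1) && (q < k) then if nd q is NDia a c then Some (a, c) else None else None.
Definition mbox k R q : option (Act * Q) :=
  if (q \in R.1) && (q < k) then if nd q is NBox a c then Some (a, c) else None else None.
Definition mchild q : option Q :=
  match nd q with NDia _ c | NBox _ c => Some c | _ => None end.

(* Targets of a modal step: a diamond, a box, or a diamond matched with a box. *)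
Definition tgt := (Q + Q + Q * Q)%type.
Definition TD q : tgt := inl (inl q).
Definition TB q : tgt := inl (inr q).
Definition TP q q' : tgt := inr (q, q').

Definition tvalid k R (t : tgt) : Prop :=
  match t with
  | inl (inl q) => exists a c, mdia k R q = Some (a, c)
  | inl (inr q) => exists a c, mbox k R q = Some (a, c)
  | inr (q, q') => ~~ kr /\
      exists a c c', mdia k R q = Some (a, c) /\ mbox k R q' = Some (a, c')
  end.

(* The modal states that contribute to a target; in the normal case these are
   all the boxes for the action at hand. *)
Definition trel k R (t : tgt) (p : Q) : Prop :=
  match t with
  | inl (inl q) => p = q \/ kr /\
      exists a c c', mdia k R q = Some (a, c) /\ mbox k R p = Some (a, c')
  | inl (inr q) => p = q \/ kr /\
      exists a c c', mbox k R q = Some (a, c) /\ mbox k R p = Some (a, c')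
  | inr (q, q') => p = q \/ p = q'
  end.

Definition tset k R t : {set Q} :=
  [set c | `[< exists p, trel k R t p /\ mchild p = Some c >]].

(** A trace segment runs inside one world from a state of [G] to a modal state contributing to [t],
    and then through the modality. The state reached behind the modality is not counted in the
    label; it opens the next segment. *)
Definition tlet k R (G : {set Q}) t : letter Q r :=
  [ffun gc => [set m : Q | `[< gc.1 \in G /\
     exists p, [/\ trel k R t p, mchild p = Some gc.2 & lpath k R gc.1 p m] >]]].

Lemma lpath_lt k R q q2 m : lpath k R q q2 m -> q2 < k -> m < k.
Proof.
elim=> // {q q2 m}q q1 q2 m /and3P[_ qk _] _ IH /IH mk.
by rewrite gtn_max qk.
Qed.

Lemma mdiaP k R q a c : mdia k R q = Some (a, c) ->
  [/\ q \in R.1, q < k & nd q = NDia a c].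
Proof. by rewrite /mdia; case: ifP => // /andP[? ?]; case: (nd q) => // ? ? [-> ->]. Qed.

Lemma mboxP k R q a c : mbox k R q = Some (a, c) ->
  [/\ q \in R.1, q < k & nd q = NBox a c].
Proof. by rewrite /mbox; case: ifP => // /andP[? ?]; case: (nd q) => // ? ? [-> ->]. Qed.

Lemma mdiaI k R q a c : q \in R.1 -> q < k -> nd q = NDia a c -> mdia k R q = Some (a, c).
Proof. by rewrite /mdia => -> -> ->. Qed.

Lemma mboxI k R q a c : q \in R.1 -> q < k -> nd q = NBox a c -> mbox k R q = Some (a, c).
Proof. by rewrite /mbox => -> -> ->. Qed.

Lemma trel_modal k R t p : tvalid k R t -> trel k R t p ->
  exists a c, mdia k R p = Some (a, c) \/ mbox k R p = Some (a, c).
Proof.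
case: t => [[q|q]|[q q']] /=.
- move=> [a [c h]] [->|[_ [a' [c0 [c' [_ h']]]]]]; first by exists a, c; left.
  by exists a', c'; right.
- move=> [a [c h]] [->|[_ [a' [c0 [c' [_ h']]]]]]; first by exists a, c; right.
  by exists a', c'; right.
- by move=> [_ [a [c [c' [h h']]]]] [->|->]; [exists a, c; left | exists a, c'; right].
Qed.

Lemma trel_dom k R t p : tvalid k R t -> trel k R t p -> p \in R.1 /\ p < k.
Proof. by move=> vt rp; have [a [c [/mdiaP[]|/mboxP[]]]] := trel_modal vt rp. Qed.

Variable kt : nat.
Hypothesis kt_card : #|{: option (letter Q r)}| = kt.

Notation dmem := (dstate Q r kt).
Notation macro := ({set Q} * dmem)%type.

Variable M : nat.
Variables (enc : 'I_(dbound kt) * macro -> 'I_M) (dec : 'I_M -> 'I_(dbound kt) * macro).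
Hypothesis encK : cancel enc dec.
Hypothesis enc_mono : forall (p p' : 'I_(dbound kt)) (x x' : macro), p < p' -> enc (p, x) < enc (p', x').

Definition nmem k R (x : macro) t : dmem := dstep x.2 (tlet k R x.1 t).

(** The index of a macrostate includes the priority of the step leading into it. As [enc_mono] lets
    higher priorities bind further out, the nesting of the fixpoints expresses the parity
    condition. *)
Definition nxt k R (x : macro) t : 'I_M :=
  enc (Ordinal (dpri_bound mu x.2 (tlet k R x.1 t)), (tset k R t, nmem k R x t)).

Variables (K : kozen Act) (lit : Lt -> K).

Definition rlit k (Z : nat -> K) R : K :=
  bmeets (fun q => if q \in R.1 then
    if q < k then if nd q is NLit l then lit l else btop else Z q else btop).

Definition top k R (t : tgt) : K -> K :=
  match t with
  | inl (inl q) => if mdia k R q is Some (a, _) then kdia a else id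
  | inl (inr q) => if mbox k R q is Some (a, _) then kbox a else id
  | inr _ => bE
  end.

Definition nmod k R (x : macro) (y : nat -> K) : K :=
  bmeets (fun t => if `[< tvalid k R t >] then top k R t (y (nxt k R x t)) else btop).

Definition nbody k Z (x : macro) (y : nat -> K) : K :=
  bjoins (fun R => if `[< resol k x.1 R >] then rlit k Z R ⊓ nmod k R x y else bbot).

Definition nhes k Z : hes K :=
  Hes (fun n y => if insub n is Some i then nbody k Z (dec i).2 y else btop)
      (fun n => if insub n is Some i then odd (dec i).1 else true) btop.

Lemma nhesE k Z (i : 'I_M) y : hfun (nhes k Z) i y = nbody k Z (dec i).2 y.
Proof. by rewrite /= valK. Qed.

Lemma nhes_mu k Z (i : 'I_M) : hmu (nhes k Z) i = odd (dec i).1.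
Proof. by rewrite /= valK. Qed.

Lemma top_mono k R t : monof (top k R t).
Proof.
case: t => [[q|q]|qq] /=.
- by case: mdia => [[a c]|] //; exact: kdia_mono.
- by case: mbox => [[a c]|] //; exact: kbox_mono.
- exact: bE_mono.
Qed.

Lemma nmod_mono k R x y z : (forall i, y i <<= z i) -> nmod k R x y <<= nmod k R x z.
Proof.
by move=> yz; apply: meets_mono => t; case: asboolP => // _; exact: top_mono.
Qed.

Lemma nbody_mono k Z x y z : (forall i, y i <<= z i) -> nbody k Z x y <<= nbody k Z x z.
Proof.
move=> yz; apply: joins_mono => R; case: asboolP => // _; apply: meet_mono => //.
exact: nmod_mono.
Qed.

Lemma nhes_def k Z : kglobal K -> hes_def (nhes k Z).
Proof.
move=> gK; split=> [j y z yz|j g dg] /=.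
  by case: insubP => // i _ _; exact: nbody_mono.
case: insubP => [i _ _|_]; last exact: kdef_const.
apply: kdef_joins => R; case: asboolP => _; last exact: kdef_const.
apply: kdef_meet; first exact: kdef_const.
apply: kdef_meets => t; case: asboolP => _; last exact: kdef_const.
case: t => [[q|q]|qq] /=.
- by case: mdia => [[a c]|]; [exact: kdef_dia | exact: dg].
- by case: mbox => [[a c]|]; [exact: kdef_box | exact: dg].
- exact: gK.
Qed.

(** * Joining the resolutions of several threads *)

Section JointStep.
Hypothesis krK : kr -> knormal K.
Variables (kq : Q) (Z : nat -> K) (X0 : K).
Notation k := (nat_of_ord kq).

(** Threads of two levels coexist: with [true] the state [k] is unfolded, with [false] it is a leaf
    of value [X0]. *)
Definition klev (b : bool) := if b then k.+1 else k.
Definition kenv (b : bool) := if b then Z else upd Z k X0.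

Lemma klev_false : klev false = k. Proof. by []. Qed.
Lemma kenv_false : kenv false = upd Z k X0. Proof. by []. Qed.

Variables (n L : nat) (nL : n <= L).
Variables (kd : 'I_n -> bool) (xs : 'I_n -> macro) (Rs : 'I_n -> rho).
Notation lv i := (klev (kd i)).
Hypothesis rs : forall i, resol (lv i) (xs i).1 (Rs i).
Hypothesis spawned : forall i, ~~ kd i -> kq \in (Rs i).1 ->
  (exists j, kd j /\ kq \in (Rs j).1) \/
  (~~ mu k /\ exists a, nd kq = NCopy a /\ exists j, a \in (Rs j).1).

(* The seniority of threads, the smallest key first. *)
Definition tkey (i : 'I_n) : nat := if kd i then nat_of_ord i else L + i.

Definition holds (i : 'I_n) q := q \in (Rs i).1 /\ forall j, q \in (Rs j).1 -> tkey i <= tkey j.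

(** Threads may disagree on the disjunct at a common state; the most senior visitor decides. *)
Definition Rjoin : rho :=
  ([set q | [exists i, q \in (Rs i).1]], [ffun q => `[< exists i, holds i q /\ (Rs i).2 q >]]).

Lemma tkey_inj : injective tkey.
Proof.
clear kt_card krK; move=> i j; rewrite /tkey; have := leq_trans (ltn_ord i) nL; have := leq_trans (ltn_ord j) nL.
by case: (kd i); case: (kd j) => ? ? e; apply: ord_inj; lia.
Qed.

Lemma tkey_kd i j : kd i -> ~~ kd j -> tkey i < tkey j.
Proof. by clear kt_card krK; rewrite /tkey => -> /negbTE->; have := leq_trans (ltn_ord i) nL; lia. Qed.

Lemma holds_ex q i : q \in (Rs i).1 -> exists2 j, holds j q & tkey j <= tkey i.
Proof.
move=> qi; have [j qj min] := @arg_minnP _ i (fun j => q \in (Rs j).1) tkey qi.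
by exists j; [split | exact: min].
Qed.

Lemma holds_uniq i j q : holds i q -> holds j q -> i = j.
Proof. by move=> [qi mi] [qj mj]; apply: tkey_inj; apply/eqP; rewrite eqn_leq mi ?mj. Qed.

Lemma RjoinP q : reflect (exists i, q \in (Rs i).1) (q \in Rjoin.1).
Proof. by rewrite inE; exact: existsP. Qed.

Lemma Rjoin_ch i q : holds i q -> Rjoin.2 q = (Rs i).2 q.
Proof.
move=> hi; rewrite ffunE; apply/asboolP/idP => [[j [hj]]|]; last by exists i.
by rewrite (holds_uniq hi hj).
Qed.

(** Threads of level [k.+1] are senior to those of level [k], so the holder of [kq] stops there only
    if no thread unfolds it. By [spawned], [kq] is then a greatest fixpoint whose body is
    visited. *)
Lemma holds_active i q : holds i q -> q < k.+1 ->
  q < lv i \/ [/\ q = kq, ~~ mu k & exists a, nd kq = NCopy a /\ exists j, a \in (Rs j).1].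
Proof.
clear kt_card krK; move=> [qi mi] qk; rewrite /klev; case E: (kd i); first by left.
case: (ltnP q k) => [|kq']; first by left.
have eq : q = kq by apply: ord_inj; lia.
have := spawned (negbT E); rewrite -eq => /(_ qi) [[j [kj qj]]|[nm ex]]; last by right.
by have := mi j qj; rewrite leqNgt tkey_kd ?E.
Qed.

Lemma holds_modal i q : holds i q -> q < k.+1 -> (forall a, nd q <> NCopy a) -> q < lv i.
Proof. by move=> hi /(holds_active hi)[|[-> _ [a [e _]]] /(_ a)]. Qed.

Lemma ledge_join q q' : ledge k.+1 Rjoin q q' ->
  (forall i, holds i q -> ledge (lv i) (Rs i) q q') \/
  [/\ q = kq, ~~ mu k & exists j, q' \in (Rs j).1].
Proof.
move=> /and3P[/RjoinP[i0 qi0] qk e]; have [i hi _] := holds_ex qi0.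
have [qi|[eq nm [a [ea ej]]]] := holds_active hi qk; last first.
  by right; split => //; move: e; rewrite eq ea => /eqP ->.
left=> j hj; rewrite -(holds_uniq hi hj); apply/and3P; split => //; first by case: hi.
by move: e; rewrite (Rjoin_ch hi).
Qed.

Lemma ledge_join_key q q' i : ledge k.+1 Rjoin q q' -> holds i q ->
  [/\ q = kq & ~~ mu k] \/ exists2 j, holds j q' & tkey j <= tkey i.
Proof.
move=> /ledge_join[h hi|[]]; last by left.
have [_ cl _] := rs i; right; apply: holds_ex; exact: cl (h i hi).
Qed.

Lemma lclosed_join : lclosed k.+1 Rjoin.
Proof.
move=> q q' h; apply/RjoinP; have [e|[_ _ //]] := ledge_join h.
have /and3P[/RjoinP[i0 qi0] _ _] := h; have [i hi _] := holds_ex qi0.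
by have [_ cl _] := rs i; exists i; exact: cl (e i hi).
Qed.

(** The holder of the source of an edge also visits its target, so holders only become more senior,
    and a path with a constant holder belongs to that thread. The exception is the greatest fixpoint
    [kq], where any thread may take over; the label is then [k], the largest possible one. *)
Lemma lpath_join q q2 m : lpath k.+1 Rjoin q q2 m -> q2 < k.+1 ->
  (m = k /\ ~~ mu k) \/
  forall i, holds i q -> exists2 j, holds j q2 & tkey j <= tkey i /\
    (j = i -> lpath (lv i) (Rs i) q q2 m).
Proof.
elim=> {q q2 m} [q|q q1 q2 m e p IH] q2k.
  by right=> i hi; exists i => //; split => // _; exact: lpath_refl.
have mk := lpath_lt p q2k.
have [eq|[eq nm _]] := ledge_join e; last first.
  by left; split => //; rewrite eq; apply/maxn_idPl.
have [[mk' nm]|{}IH] := IH q2k.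
  left; split => //; rewrite mk'; apply/maxn_idPr.
  by case/and3P: e => _ + _.
right=> i hi; have [_ cl _] := rs i.
have [i1 h1 k1] := holds_ex (cl _ _ (eq i hi)).
have [j hj [kj pj]] := IH i1 h1; exists j => //; split; first exact: leq_trans kj k1.
move=> ji; have e1 : i1 = i.
  by apply: tkey_inj; apply/eqP; rewrite eqn_leq k1 -{1}ji.
apply: lpath_step; first exact: eq.
by rewrite -e1; apply: pj; rewrite e1.
Qed.

(** A path through the greatest fixpoint [kq] infinitely often has limsup [k]. On any other path the
    seniority of the holder stabilizes, and the tail lies in one valid resolution. *)
Lemma lvalid_join : lvalid k.+1 Rjoin.
Proof.
move=> [f [x [fe lx mx]]].
have fD m : f m \in Rjoin.1 by case/and3P: (fe m).
have hP m : {i | holds i (f m)}.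
  by apply: cid; have /RjoinP[i hi] := fD m; have [j hj _] := holds_ex hi; exists j.
pose h m := projT1 (hP m); have hhP m : holds (h m) (f m) := projT2 (hP m).
have [io|/not_inf_often[N hN]] := pselect (inf_often (fun m => f m = kq /\ ~~ mu k)).
  have lk : limsup_is (fun m => f m) k.
    split; last by apply: inf_often_sub io => m [->].
    by exists 0 => m _; case/and3P: (fe m) => _.
  by move: mx; rewrite (limsup_uniq lx lk); have [m _ [_ /negbTE->]] := io 0.
have key m : tkey (h (N + m).+1) <= tkey (h (N + m)).
  have [[e nm]|[j hj jk]] := ledge_join_key (fe (N + m)) (hhP _).
    by case: (hN (N + m) (leq_addr _ _)).
  by rewrite -(holds_uniq hj (hhP _)).
have [v [N1 hv]] : exists v, eventually (fun m => tkey (h (N + m)) = v).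
  by apply: nonincr_stable => m; rewrite addnS.
pose i := h (N + N1).
have hi m : N1 <= m -> h (N + m) = i.
  by move=> m1; apply: tkey_inj; rewrite !hv.
have [_ _ []] := rs i; exists (fun m => f (N + N1 + m)), x; split => //; last first.
  by apply/(limsup_shift (fun m => f m)).
move=> m; rewrite addnS; have [|[e nm _]] := ledge_join (fe (N + N1 + m)).
  by apply; rewrite -(hi (N1 + m)) ?leq_addr // addnA.
by case: (hN (N + N1 + m)) => //; rewrite -addnA leq_addr.
Qed.

Lemma resol_join (G : {set Q}) : (forall q, q \in G -> exists i, q \in (xs i).1) ->
  resol k.+1 G Rjoin.
Proof.
move=> hG; split; [|exact: lclosed_join|exact: lvalid_join].
apply/subsetP => q /hG[i qi]; apply/RjoinP; exists i.
by have [/subsetP/(_ q qi)] := rs i.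
Qed.

Lemma rlit_join : bmeets (fun i => rlit (lv i) (kenv (kd i)) (Rs i)) <<= rlit k.+1 Z Rjoin.
Proof.
clear kt_card krK; apply/le_meets => q; case: ifP => [/RjoinP[i0 qi0]|_]; last exact: le_top.
have [i hi _] := holds_ex qi0; have [qi _] := hi.
apply: ble_trans (meets_le _ i) _; apply: ble_trans (meets_le _ q) _; rewrite qi.
case: (ltnP q k.+1) => qk.
  have [->//|[eq _ [a [ea _]]]] := holds_active hi qk.
  by rewrite eq ea; exact: le_top.
rewrite ltnNge (_ : lv i <= q) /=; last by rewrite /klev; case: (kd i); lia.
by rewrite /kenv; case: (kd i) => //; rewrite upd_ne // neq_ltn qk orbT.
Qed.

Lemma mdia_join q a c : mdia k.+1 Rjoin q = Some (a, c) ->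
  exists2 i, holds i q & mdia (lv i) (Rs i) q = Some (a, c).
Proof.
move=> /mdiaP[/RjoinP[i0 qi0] qk e]; have [i hi _] := holds_ex qi0.
exists i => //; apply: mdiaI => //; first by case: hi.
by apply: holds_modal => // a'; rewrite e.
Qed.

Lemma mbox_join q a c : mbox k.+1 Rjoin q = Some (a, c) ->
  exists2 i, holds i q & mbox (lv i) (Rs i) q = Some (a, c).
Proof.
move=> /mboxP[/RjoinP[i0 qi0] qk e]; have [i hi _] := holds_ex qi0.
exists i => //; apply: mboxI => //; first by case: hi.
by apply: holds_modal => // a'; rewrite e.
Qed.

(** The right side is refuted at the joined resolution, hence at some target [t] of it. The modal
    states of [t] are held by various threads, and each of these moves along a target of its own.
    The one-step lemmas keep the moves consistent with the refutation. *)
Lemma joint_step (Y : 'I_n -> nat -> K) (x : macro) (y : nat -> K) :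
  (forall q, q \in x.1 -> exists i, q \in (xs i).1) ->
  bnz (bmeets (fun i => rlit (lv i) (kenv (kd i)) (Rs i) ⊓ nmod (lv i) (Rs i) (xs i) (Y i)) ⊓
       bneg (nbody k.+1 Z x (fun j => bneg (y j)))) ->
  exists t (tau : 'I_n -> option tgt),
    [/\ tvalid k.+1 Rjoin t,
        forall i t', tau i = Some t' -> tvalid (lv i) (Rs i) t',
        bnz (bmeets (fun i => if tau i is Some t' then Y i (nxt (lv i) (Rs i) (xs i) t')
                              else btop) ⊓ y (nxt k.+1 Rjoin x t)) &
        forall q j, trel k.+1 Rjoin t q -> holds j q ->
          exists2 t', tau j = Some t' & trel (lv j) (Rs j) t' q].
Proof.
move=> hx; set b := bmeets _ => nz.
have {nz} nz : bnz (b ⊓ bneg (nmod k.+1 Rjoin x (fun j => bneg (y j)))).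
  apply: nz_le nz _; apply: le_meet; first exact: meetl.
  apply: ble_trans (_ : _ <<= rlit k.+1 Z Rjoin ⊓ bneg (nbody k.+1 Z x (fun j => bneg (y j)))) _.
    apply: meet_mono => //; apply: ble_trans rlit_join.
    by apply: meets_mono => i; exact: meetl.
  apply/bneg_adj; rewrite -meetA [bneg _ ⊓ _]meetC meetA; apply/bneg_adj; rewrite bnegK.
  have := le_joins (fun R => if `[< resol k.+1 x.1 R >] then
    rlit k.+1 Z R ⊓ nmod k.+1 R x (fun j => bneg (y j)) else bbot) Rjoin.
  by rewrite asboolT //; exact: resol_join.
have [t] := nz_negmeets nz; case: asboolP => [vt|_]; last first.
  by rewrite neg_top => []; case; exact: meetr.
move=> {}nz; exists t.
have bE' i t' : tvalid (lv i) (Rs i) t' ->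
    b <<= top (lv i) (Rs i) t' (Y i (nxt (lv i) (Rs i) (xs i) t')).
  move=> v; apply: ble_trans (meets_le _ i) _; apply: ble_trans (meetr _ _) _.
  by apply: ble_trans (meets_le _ t') _; rewrite asboolT.
pose YN i t' := Y i (nxt (lv i) (Rs i) (xs i) t').
(* For normal modalities every thread with a box for [a] has to move along. One representative is
   enough, since its target collects all boxes for [a] of the thread. *)
pose bx i a := [pick q | `[< exists c, mbox (lv i) (Rs i) q = Some (a, c) >]].
have bxP i a q : bx i a = Some q -> exists c, mbox (lv i) (Rs i) q = Some (a, c).
  by rewrite /bx; case: pickP => // q' /asboolP h [<-].
have bxN i a q c : mbox (lv i) (Rs i) q = Some (a, c) -> exists q', bx i a = Some q'.
  move=> h; rewrite /bx; case: pickP => [q' _|/(_ q)]; first by exists q'.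
  by rewrite asboolT //; exists c.
have use (tau : 'I_n -> option tgt) (z : K) : bnz z -> z <<= y (nxt k.+1 Rjoin x t) ->
    (forall i t', tau i = Some t' -> z <<= YN i t') ->
    bnz (bmeets (fun i => if tau i is Some t' then Y i (nxt (lv i) (Rs i) (xs i) t')
                          else btop) ⊓ y (nxt k.+1 Rjoin x t)).
  move=> nz' zy zt; apply: nz_le nz' _; apply: le_meet => //; apply/le_meets => i.
  by case E: (tau i) => [t'|]; [exact: zt | exact: le_top].
case: t vt nz use => [[q|q]|[q q']] vt nz use; set yv := y (nxt _ _ _ _) in nz use *.
- have [a [c e]] := vt; have [i hi ei] := mdia_join e.
  have vi : tvalid (lv i) (Rs i) (TD q) by exists a, c.
  rewrite /= e -/(kbox a yv) in nz.
  have bi : b <<= kdia a (YN i (TD q)) by have := bE' i _ vi; rewrite /= ei.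
  case Ekr: kr.
    have nK := krK Ekr.
    pose tau j := if j == i then Some (TD q) else omap TB (bx j a).
    pose sel j := (j != i) && bx j a.
    pose yy j := if bx j a is Some q' then YN j (TB q') else btop.
    exists tau; split => //.
    + move=> j t'; rewrite /tau; case: eqP => [-> [<-]//|_]; case E: (bx j a) => [q'|] //= [<-].
      by have [c' h] := bxP _ _ _ E; exists a, c'.
    + have /(nz_dia_boxes nK) nz' : bnz (b ⊓ (kdia a (YN i (TD q) ⊓ yv) ⊓
          bmeets (fun j => if sel j then kbox a (yy j) else btop))).
        apply: nz_le nz _; apply: le_meet; first exact: meetl.
        apply: le_meet.
          apply: ble_trans (proj1 nK a _ _); exact: meet_mono.
        apply: ble_trans (meetl _ _) _; apply/le_meets => j; rewrite /sel /yy.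
        case: (j != i) => /=; last exact: le_top.
        case E: (bx j a) => [q'|] /=; last exact: le_top.
        have [c' h] := bxP _ _ _ E; have := bE' j (TB q'); rewrite /= h; apply.
        by exists a, c'.
      apply: use nz' _ _; first by apply: ble_trans (meetl _ _) _; exact: meetr.
      move=> j t'; rewrite /tau; case: eqVneq => [-> [<-]|ji].
        by apply: ble_trans (meetl _ _) _; exact: meetl.
      case E: (bx j a) => [q'|] //= [<-]; apply: ble_trans (meetr _ _) _.
      by apply: ble_trans (meets_le _ j) _; rewrite /sel ji /yy E.
    + move=> p j /= [->|[_ [a' [c1 [c2 [e1 e2]]]]]] hj.
        by exists (TD q); rewrite /tau ?(holds_uniq hj hi) ?eqxx //=; left.
      move: e1; rewrite e => -[ea _]; subst a'.
      have [j' hj' ej] := mbox_join e2; rewrite (holds_uniq hj' hj) in ej.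
      rewrite /tau; case: eqP => [ji|_].
        by exists (TD q) => //=; right; split => //; exists a, c, c2; split => //; rewrite ji.
      have [q' eq'] := bxN _ _ _ _ ej; rewrite eq'; exists (TB q') => //=; right; split => //.
      by have [c' h] := bxP _ _ _ eq'; exists a, c', c2.
  pose tau j := if j == i then Some (TD q) else None.
  exists tau; split => //.
  + by move=> j t'; rewrite /tau; case: eqP => [-> [<-]|].
  + have nz0 : bnz (b ⊓ (kdia a (YN i (TD q)) ⊓ kbox a yv)).
      apply: nz_le nz _; apply: le_meet; [exact: meetl | exact: meet_mono].
    have nz' := nz_dia_box nz0.
    apply: use nz' _ _; first exact: meetr.
    by move=> j t'; rewrite /tau; case: eqP => // -> [<-]; exact: meetl.
  + move=> p j /= [->|[]]; last by rewrite Ekr.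
    by move=> hj; exists (TD q); rewrite /tau ?(holds_uniq hj hi) ?eqxx //=; left.
- have [a [c e]] := vt; have [i hi ei] := mbox_join e.
  have vi : tvalid (lv i) (Rs i) (TB q) by exists a, c.
  rewrite /= e /kbox !bnegK in nz.
  have bi : b <<= kbox a (YN i (TB q)) by have := bE' i _ vi; rewrite /= ei.
  case Ekr: kr.
    have nK := krK Ekr.
    pose tau j := omap TB (bx j a).
    pose yy j := if bx j a is Some q' then YN j (TB q') else btop.
    exists tau; split => //.
    + move=> j t'; rewrite /tau; case E: (bx j a) => [q'|] //= [<-].
      by have [c' h] := bxP _ _ _ E; exists a, c'.
    + have /(nz_dia_boxes nK) nz' : bnz (b ⊓ (kdia a yv ⊓
          bmeets (fun j => if (fun j => isSome (bx j a)) j then kbox a (yy j) else btop))).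
        apply: nz_le nz _; apply: le_meet; first exact: meetl.
        apply: le_meet; first exact: meetr.
        apply: ble_trans (meetl _ _) _; apply/le_meets => j; rewrite /yy.
        case E: (bx j a) => [q'|] /=; last exact: le_top.
        have [c' h] := bxP _ _ _ E; have := bE' j (TB q'); rewrite /= h; apply.
        by exists a, c'.
      apply: use nz' _ _; first exact: meetl.
      move=> j t'; rewrite /tau.
      case E: (bx j a) => [q'|] //= [<-]; apply: ble_trans (meetr _ _) _.
      by apply: ble_trans (meets_le _ j) _; rewrite /yy E.
    + move=> p j h hj.
      have {h} [c2 e2] : exists c2, mbox k.+1 Rjoin p = Some (a, c2).
        case: h => [->|[_ [a' [c1 [c2 [e1 e2]]]]]]; first by exists c.
        by move: e1; rewrite e => -[ea _]; subst a'; exists c2.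
      have [j' hj' ej] := mbox_join e2; rewrite (holds_uniq hj' hj) in ej.
      have [q' eq'] := bxN _ _ _ _ ej; rewrite /tau eq'; exists (TB q') => //=; right.
      by split => //; have [c' h] := bxP _ _ _ eq'; exists a, c', c2.
  pose tau j := if j == i then Some (TB q) else None.
  exists tau; split => //.
  + by move=> j t'; rewrite /tau; case: eqP => [-> [<-]|].
  + have nz0 : bnz (b ⊓ (kdia a yv ⊓ kbox a (YN i (TB q)))).
      apply: nz_le nz _; apply: le_meet; first exact: meetl.
      by rewrite meetC; exact: meet_mono.
    have nz' := nz_dia_box nz0.
    apply: use nz' _ _; first exact: meetl.
    by move=> j t'; rewrite /tau; case: eqP => // -> [<-]; exact: meetr.
  + move=> p j /= [->|[]]; last by rewrite Ekr.
    by move=> hj; exists (TB q); rewrite /tau ?(holds_uniq hj hi) ?eqxx //=; left.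
have [nkr [a [c [c' [e e']]]]] := vt.
have [i hi ei] := mdia_join e; have [j hj ej] := mbox_join e'.
rewrite /= in nz.
(* A failing global modality leaves no condition on the right successor, so only the consistency of
   the left threads remains to be shown. *)
have ytop : btop <<= yv.
  apply: contrapT => ny; apply: nz; rewrite bE_nz ?neg_top; first exact: meetr.
  by move=> h; apply: ny; rewrite -[yv]bnegK; apply: le_neg.
have nb : bnz b by apply: nz_le nz (meetl _ _).
(* If one thread holds both states it moves along the pair; otherwise one thread takes the diamond
   and another the box. *)
have [eij|nij] := eqVneq j i.
  subst j; pose tau j := if j == i then Some (TP q q') else None.
  have vi : tvalid (lv i) (Rs i) (TP q q') by split => //; exists a, c, c'.
  have nY : bnz (YN i (TP q q')).
    have /= bi := bE' i _ vi; apply: (@nz_bE _ _ _ b); apply: nz_le nb _; exact: le_meet.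
  exists tau; split => //.
  - by move=> j t'; rewrite /tau; case: eqP => [-> [<-]|].
  - apply: use nY _ _; first exact: ble_trans (le_top _) ytop.
    by move=> j t'; rewrite /tau; case: eqP => // -> [<-].
  - move=> p j /= [->|->] h; exists (TP q q'); rewrite /tau ?(holds_uniq h hi) ?(holds_uniq h hj) ?eqxx //=.
      by left.
    by right.
pose tau j0 := if j0 == i then Some (TD q) else if j0 == j then Some (TB q') else None.
have vi : tvalid (lv i) (Rs i) (TD q) by exists a, c.
have vj : tvalid (lv j) (Rs j) (TB q') by exists a, c'.
exists tau; split => //.
- move=> j0 t'; rewrite /tau; case: eqP => [-> [<-]//|_]; by case: eqP => [-> [<-]|].
- have nz0 : bnz (b ⊓ (kdia a (YN i (TD q)) ⊓ kbox a (YN j (TB q')))).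
    apply: nz_le nb _; apply: le_meet => //; apply: le_meet.
      by have := bE' i _ vi; rewrite /= ei.
    by have := bE' j _ vj; rewrite /= ej.
  have nz' := nz_dia_box nz0.
    apply: use nz' _ _; first exact: ble_trans (le_top _) ytop.
  move=> j0 t'; rewrite /tau; case: eqP => [-> [<-]|_]; first exact: meetl.
  by case: eqP => // -> [<-]; exact: meetr.
- move=> p j0 /= [->|->] h.
    by exists (TD q); rewrite /tau ?(holds_uniq h hi) ?eqxx //=; left.
  exists (TB q'); last by left.
  by rewrite /tau (holds_uniq h hj) (negbTE nij) eqxx.
Qed.

Lemma joint_trace (x : macro) t (tau : 'I_n -> option tgt) g c (m : Q) :
  tvalid k.+1 Rjoin t ->
  (forall q j, trel k.+1 Rjoin t q -> holds j q ->
     exists2 t', tau j = Some t' & trel (lv j) (Rs j) t' q) ->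
  m \in tlet k.+1 Rjoin x.1 t (g, c) ->
  (m = kq /\ ~~ mu k) \/
  forall i, holds i g -> exists j t', [/\ tau j = Some t', c \in tset (lv j) (Rs j) t',
    tkey j <= tkey i &
    j = i -> g \in (xs j).1 -> m \in tlet (lv j) (Rs j) (xs j).1 t' (g, c)].
Proof.
move=> vt ht; rewrite ffunE inE => /asboolP[gx [p [rp ec lp]]].
have pk : p < k.+1.
  by case: (trel_dom vt rp).
have [[mk nm]|h] := lpath_join lp pk.
  by left; split => //; apply: ord_inj.
right=> i /h[j hj [jk jl]]; have [t' tj rj] := ht p j rp hj.
exists j, t'; split => //.
  by rewrite inE; apply/asboolP; exists p.
move=> ji gj; rewrite ffunE inE; apply/asboolP; split => //.
by exists p; split => //; have := jl ji; rewrite -ji.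
Qed.

End JointStep.
End Tableau.

Section Nub.
Variable T : eqType.
Implicit Types (s : seq T).

(** First occurrences are kept, whereas [undup] keeps the last ones: removing repetitions must not
    make a thread more junior. *)
Fixpoint nub s : seq T := if s is x :: s' then x :: [seq y <- nub s' | y != x] else [::].

Lemma mem_nub s : nub s =i s.
Proof.
elim: s => //= x s IH y; rewrite !inE mem_filter IH.
by case: eqVneq.
Qed.

Lemma nub_uniq s : uniq (nub s).
Proof. by elim: s => //= x s IH; rewrite mem_filter eqxx filter_uniq. Qed.

Lemma index_filter_le (P : pred T) y s : P y -> index y (filter P s) <= index y s.
Proof.
move=> Py; elim: s => //= x s IH; case: ifP => Px /=.
  by case: (x == y).
by case: eqVneq Px => [->|_ _]; [rewrite Py | exact: leqW].
Qed.

Lemma index_nub y s : index y (nub s) <= index y s.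
Proof.
elim: s => //= x s IH; case: eqVneq => // xy; rewrite ltnS.
by apply: leq_trans (index_filter_le _ _) IH; rewrite eq_sym.
Qed.

Lemma index_pmap (S : eqType) (f : S -> option T) x y (s : seq S) : f x = Some y -> x \in s ->
  index y (pmap f s) <= index x s.
Proof.
move=> fx; elim: s => //= z s IH; rewrite inE; case: (eqVneq z x) => [->|zx] /=.
  by rewrite fx /= eqxx.
move=> /IH h; case: (f z) => [w|] /=; last exact: leqW.
by case: eqP => // _; rewrite ltnS.
Qed.

End Nub.

(** * Infinite joint runs against the tableau *)

Section Joint.
Variables (Lt Act : Type) (V : vaut Lt Act) (kr : bool).
Notation r := (vsize V).
Notation Q := 'I_r.
Notation nd := (@vnd _ _ V).
Notation mu := (@vmu _ _ V).
Variable kt : nat.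
Hypothesis kt_card : #|{: option (letter Q r)}| = kt.
Notation dmem := (dstate Q r kt).
Notation macro := ({set Q} * dmem)%type.
Variable M : nat.
Variables (enc : 'I_(dbound kt) * macro -> 'I_M) (dec : 'I_M -> 'I_(dbound kt) * macro).
Hypothesis encK : cancel enc dec.
Hypothesis decK : cancel dec enc.
Hypothesis enc_mono : forall (p p' : 'I_(dbound kt)) (x x' : macro),
  p < p' -> enc (p, x) < enc (p', x').
Variables (K : kozen Act) (lit : Lt -> K).
Hypothesis gK : kglobal K.
Hypothesis krK : kr -> knormal K.

Definition gam (i : 'I_M) : {set Q} := (dec i).2.1.
Definition dm (i : 'I_M) : dmem := (dec i).2.2.

Lemma dec_limsup (v : nat -> 'I_M) (i : 'I_M) : limsup_is (fun n => v n) i ->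
  limsup_is (fun n => (dec (v n)).1) (dec i).1.
Proof.
move=> [[N hN] io]; split.
  exists N => n /hN; apply: contraTT; rewrite -!ltnNge => lt.
  rewrite -[i]decK -[v n]decK; case: (dec i) lt => p x /=; case: (dec (v n)) => p' x'.
  exact: enc_mono.
by apply: inf_often_sub io => n /ord_inj ->.
Qed.

Lemma thread_word (v : nat -> 'I_M) (w : nat -> letter Q r) : dreach (dm (v 0)) ->
  (forall n, (dec (v n.+1)).1 = dpri mu (dm (v n)) (w n) :> nat /\
     dm (v n.+1) = dstep (dm (v n)) (w n)) ->
  exists2 i : 'I_M, limsup_is (fun n => v n) i & odd (dec i).1 <-> bad_word mu w.
Proof.
move=> r0 hv; have [i iM hi] : exists2 i, i < M & limsup_is (fun n => v n : nat) i.
  by apply: limsup_exists; exists 0.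
exists (Ordinal iM) => //.
have dmE n : dm (v n) = drun (dm (v 0)) w n.
  by elim: n => //= n <-; case: (hv n).
have [x hx <-] := determinization mu kt_card w r0.
suff -> : x = (dec (Ordinal iM)).1 by [].
apply: limsup_uniq hx _.
have /(limsup_shift _ _ 1) h := @dec_limsup v (Ordinal iM) hi.
apply: limsup_ext h; exists 0 => n _; rewrite add1n -dmE; by case: (hv n).
Qed.

Variables (kq : Q) (Z : nat -> K) (X0 : K).
Notation k := (nat_of_ord kq).
Notation klev := (klev kq).
Notation kenv := (kenv kq Z X0).

(** [Some b] stands for the left tableaux of the two levels. [None] is the dual of the right one, so
    that a counterexample to the inequality is a nonzero configuration. *)
Definition jhes (h : option bool) : hes K :=
  if h is Some b then nhes kr enc dec lit (klev b) (kenv b)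
  else hdual (nhes kr enc dec lit k.+1 Z).

Lemma jhes_good h : hes_good (jhes h).
Proof.
case: h => [b|] /=; apply: hes_def_good; first exact: nhes_def.
by apply: hes_def_dual; exact: nhes_def.
Qed.

Notation entry := (bool * 'I_M)%type.

Definition eval_entry (e : entry) : K := hval (jhes (Some e.1)) M e.2.

(* The thread spawned when a thread of level [k] reaches the state [k]. *)
Variable es : entry.
Hypothesis X0_le : X0 <<= eval_entry es.
Hypothesis es_reach : dreach (dm es.2).
Hypothesis es_spawn : (es.1 /\ kq \in gam es.2) \/
  (~~ es.1 /\ ~~ mu k /\ exists a, nd kq = NCopy a /\ a \in gam es.2).

(** A bound on the number of threads, as lists of threads are kept free of repetitions. *)
Definition nL : nat := #|{: entry}|.

Definition state_of (l : seq entry) (v : 'I_M) : {ffun 'I_nL.+1 -> option (option bool * 'I_M)} :=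
  [ffun s : 'I_nL.+1 => if nat_of_ord s is p.+1
     then nth None [seq Some (Some e.1, e.2) | e <- l] p else Some (None, v)].

Lemma state_of0 l v : state_of l v ord0 = Some (None, v).
Proof. by rewrite ffunE. Qed.

Lemma state_ofS l v (s : 'I_nL.+1) p : s = p.+1 :> nat -> p < size l ->
  state_of l v s = Some (Some (nth es l p).1, (nth es l p).2).
Proof. by move=> sp pl; rewrite ffunE sp (nth_map es). Qed.

Lemma state_ofN l v (s : 'I_nL.+1) p : s = p.+1 :> nat -> size l <= p ->
  state_of l v s = None.
Proof. by move=> sp pl; rewrite ffunE sp nth_default // size_map. Qed.

Lemma size_uniq (l : seq entry) : uniq l -> size l <= nL.
Proof. by move=> /card_uniqP <-; exact: max_card. Qed.

Notation jconf := (conf K (option bool) M nL.+1).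

Record jstate := JState { jc : jconf; jl : seq entry; jv : 'I_M }.

Record jinv (x : jstate) : Prop := JInv {
  inv_cu : cu (jc x) = state_of (jl x) (jv x);
  inv_uniq : uniq (jl x);
  inv_reach : forall e, e \in jl x -> dreach (dm e.2);
  inv_reachv : dreach (dm (jv x));
  inv_cover : forall q, q \in gam (jv x) -> exists2 e, e \in jl x & q \in gam e.2;
  inv_nz : bnz (cval jhes (jc x)) }.

Definition keyp (b : bool) (p : nat) := if b then p else nL.+1 + p.

Lemma keyp_mono b p p' : (keyp b p <= keyp b p') = (p <= p').
Proof. by case: b; rewrite //= leq_add2l. Qed.

(** One step as seen by a trace of the right word; [hk g] is the seniority of the holder of [g]. A
    segment leads to a thread at least as senior. At unchanged seniority an existing thread has kept
    its slot, and the segment occurs in its own letter [Ll p]. The only other segments are those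
    labelled by the greatest fixpoint [k]. *)
Record jrel (x y : jstate) (fr : pred 'I_nL.+1) (Lr : letter Q r)
    (Ll : nat -> letter Q r) (hk : Q -> nat) : Prop := JRel {
  rel_next : jc y = cnext jhes (jc x) (cu (jc y)) fr;
  rel_fr0 : ~~ fr ord0;
  rel_right : (dec (jv y)).1 = dpri mu (dm (jv x)) Lr :> nat /\
    dm (jv y) = dstep (dm (jv x)) Lr;
  rel_left : forall p (s : 'I_nL.+1), s = p.+1 :> nat -> ~~ fr s ->
    [/\ p < size (jl x), p < size (jl y), (nth es (jl y) p).1 = (nth es (jl x) p).1,
      (dec (nth es (jl y) p).2).1 = dpri mu (dm (nth es (jl x) p).2) (Ll p) :> nat &
      dm (nth es (jl y) p).2 = dstep (dm (nth es (jl x) p).2) (Ll p)];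
  rel_key : forall p, p < size (jl x) -> forall q, q \in gam (nth es (jl x) p).2 ->
    hk q <= keyp (nth es (jl x) p).1 p;
  rel_dom : forall g c (m : Q), m \in Lr (g, c) -> g \in gam (jv x) /\ m <= k;
  rel_trace : forall g c (m : Q), m \in Lr (g, c) -> (m = kq /\ ~~ mu k) \/
    exists p, [/\ p < size (jl y), c \in gam (nth es (jl y) p).2,
      keyp (nth es (jl y) p).1 p <= hk g &
      keyp (nth es (jl y) p).1 p = hk g -> p < size (jl x) ->
        (forall s : 'I_nL.+1, s = p.+1 :> nat -> ~~ fr s) /\
        (g \in gam (nth es (jl x) p).2 -> m \in Ll p (g, c))] }.

Section Unfold.
Variable x : jstate.
Hypothesis ix : jinv x.
Notation l := (jl x).
Notation v := (jv x).

Definition slot (p : nat) : 'I_nL.+1 := inord p.+1.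

Definition yl (p : nat) : nat -> K :=
  env (jhes (Some (nth es l p).1)) M (t_next jhes (jc x) (slot p)).
Definition yr : nat -> K := env (jhes None) M (t_next jhes (jc x) ord0).

(** A thread spawned in the course of the step has no history and starts with the unrestricted
    value. *)
Definition ext_env (lx : seq entry) (i : 'I_(size lx)) : nat -> K :=
  if i < size l then yl i else hval (jhes (Some (nth es lx i).1)) M.

Definition kdx (lx : seq entry) (i : 'I_(size lx)) := (nth es lx i).1.
Definition xsx (lx : seq entry) (i : 'I_(size lx)) : macro := (dec (nth es lx i).2).2.

Lemma slotE p : p < size l -> slot p = p.+1 :> nat.
Proof. by move=> pl; rewrite inordK // ltnS; apply: leq_trans pl _; exact: size_uniq (inv_uniq ix). Qed.

Definition body (lx : seq entry) (R : 'I_(size lx) -> rho V) : K :=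
  bmeets (fun i => rlit lit (klev (kdx i)) (kenv (kdx i)) (R i) ⊓
                   nmod kr enc (klev (kdx i)) (R i) (xsx i) (ext_env i)).

Definition right : K := bneg (nbody kr enc lit k.+1 Z (dec v).2 (fun j => bneg (yr j))).

Lemma unfold_old : exists2 R : 'I_(size l) -> rho V,
  forall i, resol (klev (kdx i)) (xsx i).1 (R i) & bnz (body R ⊓ right).
Proof.
have := fval_nz jhes_good (inv_nz ix); rewrite /fval => nz.
have : bnz (right ⊓ bmeets (fun i : 'I_(size l) =>
    nbody kr enc lit (klev (kdx i)) (kenv (kdx i)) (xsx i) (yl i))).
  apply: nz_le nz _; apply: le_meet.
    apply: ble_trans (meets_le _ ord0) _; rewrite (inv_cu ix) state_of0 /right /yr /=.
    by rewrite valK.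
  apply/le_meets => i; apply: ble_trans (meets_le _ (slot i)) _.
  rewrite (inv_cu ix) (state_ofS _ (slotE (ltn_ord i))) // /xsx -nhesE //.
move/nz_choose => [R nzR]; exists R.
  move=> i; apply: contrapT => nr; apply: nzR; apply: ble_trans (meetr _ _) _.
  by apply: ble_trans (meets_le _ i) _; rewrite asboolF.
apply: nz_le nzR _; rewrite meetC; apply: meet_mono => //; apply: meets_mono => i.
by case: ifP => // _; rewrite /ext_env ltn_ord.
Qed.

(** The body of a thread of level [k] that visits [kq] lies below [X0], hence below the value of
    [es]. So [es] can be added and unfolded in the same step without making the meet zero. *)
Lemma unfold_ext : exists (lx : seq entry) (R : 'I_(size lx) -> rho V),
  [/\ lx = l \/ lx = rcons l es,
      forall i, resol (klev (kdx i)) (xsx i).1 (R i),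
      forall i, ~~ kdx i -> kq \in (R i).1 -> (exists j, kdx j /\ kq \in (R j).1) \/
        (~~ mu k /\ exists a, nd kq = NCopy a /\ exists j, a \in (R j).1) &
      bnz (body R ⊓ right)].
Proof.
have [R hR nz] := unfold_old.
have [[i0 [ki0 qi0]]|no] := pselect (exists i, ~~ kdx i /\ kq \in (R i).1); last first.
  exists l, R; split=> //; first by left.
  by move=> i ki qi; case: no; exists i.
have : bnz (body R ⊓ right ⊓ nbody kr enc lit (klev es.1) (kenv es.1) (dec es.2).2
    (hval (jhes (Some es.1)) M)).
  apply: nz_le nz _; apply: le_meet => //; apply: ble_trans (meetl _ _) _.
  rewrite -(nhesE kr enc dec lit (klev es.1) (kenv es.1)) -[nhes _ _ _ _ _ _]/(jhes (Some es.1)).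
  rewrite -hvalE ?ltn_ord //; last exact: jhes_good.
  apply: ble_trans X0_le; apply: ble_trans (meets_le _ i0) _.
  apply: ble_trans (meetl _ _) _; apply: ble_trans (meets_le _ kq) _.
  by rewrite qi0 (negbTE ki0) klev_false kenv_false ltnn upd_same.
move/nz_joins => [Rs]; case: asboolP => [rs|_ []]; last exact: meetr.
move=> nz'.
have sz : size (rcons l es) = (size l).+1 by rewrite size_rcons.
pose R' (i : 'I_(size (rcons l es))) : rho V :=
  if insub (nat_of_ord i) is Some i' then R i' else Rs.
have R'old (i : 'I_(size (rcons l es))) (i' : 'I_(size l)) : i = i' :> nat ->
    [/\ R' i = R i', kdx i = kdx i', xsx i = xsx i' & ext_env i = ext_env i'].
  move=> ii'; rewrite /R' /ext_env /kdx /xsx nth_rcons ii' valK ltn_ord; split => //.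
have R'new (i : 'I_(size (rcons l es))) : i = size l :> nat ->
    [/\ R' i = Rs, kdx i = es.1, xsx i = (dec es.2).2 &
        ext_env i = hval (jhes (Some es.1)) M].
  move=> ii'; rewrite /R' /ext_env /kdx /xsx nth_rcons ii' ltnn eqxx insubN ?ltnn //.
have oldnew (i : 'I_(size (rcons l es))) : (exists i' : 'I_(size l), i = i' :> nat) \/ i = size l :> nat.
  have := ltn_ord i; rewrite {2}sz ltnS leq_eqVlt => /predU1P[->|h]; first by right.
  by left; exists (Ordinal h).
have lst : size l < size (rcons l es) by rewrite sz.
pose ilast : 'I_(size (rcons l es)) := Ordinal lst.
have [rl kl xl yl'] := R'new ilast erefl.
exists (rcons l es), R'; split.
- by right.
- move=> i; have [[i' /R'old[-> -> -> _]]|/R'new[-> -> -> _]] := oldnew i; first exact: hR.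
  exact: rs.
- move=> i _ _; case: es_spawn => [[ke qe]|[ke [nm [a [ea qa]]]]].
    left; exists ilast; rewrite kl rl; split => //.
    by case: rs => /subsetP/(_ kq qe).
  right; split => //; exists a; split => //; exists ilast; rewrite rl.
  by case: rs => /subsetP/(_ a qa).
apply: nz_le nz' _; apply: le_meet; last first.
  by apply: ble_trans (meetl _ _) _; exact: meetr.
apply/le_meets => i; have [[i' /R'old[-> -> -> ->]]|/R'new[-> -> -> ->]] := oldnew i.
  by apply: ble_trans (meetl _ _) _; apply: ble_trans (meetl _ _) _; exact: meets_le.
exact: meetr.
Qed.

Lemma jstep : exists2 y, jinv y & exists fr Lr Ll hk, jrel x y fr Lr Ll hk.
Proof.
have [lx [R [lxE rs sp nz]]] := unfold_ext.
have szl : size l <= size lx by case: lxE => ->; rewrite ?size_rcons.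
have ul := size_uniq (inv_uniq ix).
have szL : size lx <= nL.+1.
  by case: lxE => ->; rewrite ?size_rcons ?ltnS //; exact: leqW.
have lxl p : p < size l -> nth es lx p = nth es l p.
  by case: lxE => -> // pl; rewrite nth_rcons pl.
have lxin e : e \in lx -> e \in l \/ e = es.
  by case: lxE => ->; [left | rewrite mem_rcons inE => /predU1P[]; auto].
pose kd := @kdx lx; pose xs := @xsx lx.
have cov q : q \in (dec v).2.1 -> exists i, q \in (xs i).1.
  move=> /(inv_cover ix)[e el qe].
  have ie : index e lx < size lx.
    by rewrite index_mem; case: lxE => ->; rewrite ?mem_rcons ?inE ?el ?orbT.
  by exists (Ordinal ie); rewrite /xs /xsx /= nth_index // -index_mem.
have [t [tau [vt vtau nzt relt]]] :=
  joint_step krK szL rs sp (x := (dec v).2) cov nz.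
set RR := Rjoin nL.+1 kd R in vt relt nzt.
pose lv i := klev (kd i).
pose ent (i : 'I_(size lx)) : option entry :=
  omap (fun t' => (kd i, nxt kr enc (lv i) (R i) (xs i) t')) (tau i).
pose l' := nub (pmap ent (enum 'I_(size lx))).
pose v' := nxt kr enc k.+1 RR (dec v).2 t.
have entl i e : ent i = Some e -> e \in l' /\ index e l' <= i.
  move=> h; have ei : e \in pmap ent (enum 'I_(size lx)).
    by rewrite mem_pmap; apply/mapP; exists i; rewrite ?mem_enum.
  split; first by rewrite mem_nub.
  apply: leq_trans (index_nub _ _) _; apply: leq_trans (index_pmap h (mem_enum _ _)) _.
  by rewrite index_enum_ord.
have l'P e : e \in l' -> exists i, ent i = Some e.
  by rewrite mem_nub mem_pmap => /mapP[i _ h]; exists i.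
have entP i e : ent i = Some e -> exists t', [/\ tau i = Some t', kd i = e.1,
    gam e.2 = tset kr (lv i) (R i) t', dm e.2 = nmem kr (lv i) (R i) (xs i) t' &
    (dec e.2).1 = dpri mu (xs i).2 (tlet kr (lv i) (R i) (xs i).1 t') :> nat].
  rewrite /ent; case: (tau i) => [t'|] //= [<-]; exists t' => /=.
  by rewrite /gam /dm /nxt encK.
(* A thread retains its restrictors only as long as it stays in its slot; one that moves to another
   slot starts afresh. *)
pose keep p := `[< exists i : 'I_(size lx), [/\ i = p :> nat, p < size l, p < size l' &
  ent i = Some (nth es l' p)] >].
pose fr : pred 'I_nL.+1 := fun s => if nat_of_ord s is p.+1 then ~~ keep p else false.
pose y := JState (cnext jhes (jc x) (state_of l' v') fr) l' v'.
have covt q : q \in tset kr k.+1 RR t -> exists i e, ent i = Some e /\ q \in gam e.2.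
  rewrite inE => /asboolP[p [rp ep]].
  have [pR _] := trel_dom vt rp.
  have [i0 pi0] : exists i, p \in (R i).1 by apply/existsP; move: pR; rewrite inE.
  have [j hj _] := holds_ex nL.+1 kd pi0.
  have [t' tj rj] := relt p j rp hj.
  exists j; rewrite /ent tj /=; eexists; split; first by [].
  by rewrite /gam /nxt encK /= inE; apply/asboolP; exists p.
have reach_lx i : dreach (xs i).2.
  have : nth es lx i \in lx by rewrite mem_nth.
  by case/lxin => [/(inv_reach ix)|e]; rewrite /xs /xsx ?e.
have kp : keeps (cu (jc x)) (state_of l' v') fr.
  move=> s; rewrite /fr; case E: (nat_of_ord s) => [|p].
    move=> _; have -> : s = ord0 by apply: ord_inj.
    by rewrite (inv_cu ix) !state_of0; do 3 eexists.
  rewrite negbK => /asboolP[i [ip pl pl' ei]].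
  have [t' [_ kdi _ _ _]] := entP _ _ ei.
  rewrite (inv_cu ix) (state_ofS _ E pl) (state_ofS _ E pl') -kdi /kd /kdx ip lxl //.
  by do 3 eexists.
exists y.
  split=> //=.
  - exact: nub_uniq.
  - move=> e /l'P[i /entP[t' [_ _ _ -> _]]]; apply: dreach_step => //; exact: reach_lx.
  - by rewrite /dm /v' /nxt encK; apply: dreach_step => //; exact: inv_reachv ix.
  - move=> q; rewrite /gam /v' /nxt encK => /covt[i [e [ei qe]]].
    by exists e => //; case: (entl _ _ ei).
  rewrite cval_next //; apply: nz_le nzt _; apply/le_meets => s.
  case E: (nat_of_ord s) => [|p].
    have -> : s = ord0 by apply: ord_inj.
    by rewrite state_of0 /fr /=; exact: meetr.
  case: (ltnP p (size l')) => pl'; last by rewrite (state_ofN _ E pl'); exact: le_top.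
  rewrite (state_ofS _ E pl'); set e := nth es l' p.
  apply: ble_trans (meetl _ _) _; rewrite /fr E; case Ek: (keep p) => /=.
    have /asboolP[i [ip pl _ ei]] := Ek; apply: ble_trans (meets_le _ i) _.
    move: ei; rewrite -/e /ent; case: (tau i) => [t'|] //= [<-] /=.
    rewrite /ext_env ip pl /yl /lv /kd /kdx ip lxl //.
    by have -> : slot p = s by apply: ord_inj; rewrite slotE.
  have [i ei] := l'P e (mem_nth _ pl').
  apply: ble_trans (meets_le _ i) _.
  move: ei; rewrite /ent; case: (tau i) => [t'|] //= [<-] /=.
  rewrite /ext_env; case: ifP => // il; rewrite /lv /kd /kdx lxl // /yl.
  by apply: env_le_hval; exact: jhes_good.
pose Ll p : letter Q r := if insub p is Some i then
  if tau i is Some t' then tlet kr (lv i) (R i) (xs i).1 t' else [ffun=> set0]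
  else [ffun=> set0].
pose hk q := if [pick i | `[< holds nL.+1 kd R i q >]] is Some i then tkey nL.+1 kd i else 0.
have hkP i q : holds nL.+1 kd R i q -> hk q = tkey nL.+1 kd i.
  rewrite /hk => hi; case: pickP => [j /asboolP hj|/(_ i)]; last by rewrite asboolT.
  by rewrite (holds_uniq szL hi hj).
have LlP (i : 'I_(size lx)) t' : tau i = Some t' -> Ll i = tlet kr (lv i) (R i) (xs i).1 t'.
  by rewrite /Ll valK => ->.
exists fr, (tlet kr k.+1 RR (gam v) t), Ll, hk; split=> //.
- by rewrite /= /v' /dm /nxt encK.
- move=> p s sp'; rewrite /fr sp' negbK => /asboolP[i [ip pl pl' ei]].
  have [t' [ti kdi ge de pe]] := entP _ _ ei.
  have xi : (xs i).2 = dm (nth es l p).2 by rewrite /xs /xsx ip lxl.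
  split => //=; first by rewrite -kdi /kd /kdx ip lxl.
    by rewrite pe -ip -(LlP i t') // ip xi.
  by rewrite de /nmem xi -(LlP i t') // ip.
- move=> p pl q qp; have pl2 : p < size lx := leq_trans pl szl.
  pose i := Ordinal pl2; have qi : q \in (R i).1.
    by have [/subsetP + _ _] := rs i; apply; rewrite /xsx /= lxl.
  have [j hj ji] := holds_ex nL.+1 kd qi.
  by rewrite (hkP _ _ hj); apply: leq_trans ji _; rewrite /tkey /keyp /kd /kdx /= lxl.
- move=> g c m; rewrite ffunE inE => /asboolP[gv [p [rp ep lp]]]; split => //.
  have [_ pk] := trel_dom vt rp.
  by have := lpath_lt lp pk.
move=> g c m hm; have gv : g \in gam v by move: hm; rewrite ffunE inE => /asboolP[].
have [] := joint_trace szL rs sp (x := (dec v).2) vt relt hm; first by left.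
move=> tr; right.
have [i0 gi0] := cov g gv.
have gR : g \in (R i0).1 by have [/subsetP + _ _] := rs i0; apply.
have [i hi _] := holds_ex nL.+1 kd gR.
have [j [t' [tj cj kj lj]]] := tr i hi.
pose e := (kd j, nxt kr enc (lv j) (R j) (xs j) t').
have ej : ent j = Some e by rewrite /ent tj.
have [el' ie] := entl _ _ ej.
have ie' : index e l' < size l' by rewrite index_mem.
exists (index e l'); rewrite /= nth_index //; split => //.
- by rewrite /gam /e /nxt encK.
- rewrite (hkP _ _ hi); apply: leq_trans kj; rewrite -[tkey _ _ _]/(keyp (kd j) j).
  by rewrite keyp_mono.
rewrite (hkP _ _ hi) => keq pl.
have ij : index e l' = j.
  apply/eqP; rewrite eqn_leq ie /= -(keyp_mono (kd j)).
  by apply: leq_trans kj _; rewrite -keq.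
have ji : j = i.
  apply: (tkey_inj szL (kd := kd)); apply/eqP; rewrite eqn_leq kj -keq ij /=.
  exact: leqnn.
split.
  move=> s sp'; rewrite /fr sp' negbK; apply/asboolP; exists j; split => //.
  by rewrite nth_index.
move=> gp; rewrite ij (LlP _ _ tj); apply: lj => //.
by move: gp; rewrite ij /xs /xsx lxl // -ij.
Qed.

End Unfold.

(** A counterexample starts an infinite run of nonzero configurations. The right thread belongs to
    the dual system, so its word is bad. A bad trace eventually avoids the greatest fixpoint [k],
    the seniority of its holder stabilizes, and from then on it is a trace of a single left thread.
    The word of that thread is bad too, so a least fixpoint would be its limsup. *)
Theorem joint (l0 : seq entry) (v0 : 'I_M) (z : K) :
  uniq l0 -> (forall e, e \in l0 -> dreach (dm e.2)) -> dreach (dm v0) ->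
  (forall q, q \in gam v0 -> exists2 e, e \in l0 & q \in gam e.2) ->
  (forall e, e \in l0 -> z <<= eval_entry e) ->
  z <<= hval (nhes kr enc dec lit k.+1 Z) M v0.
Proof.
move=> ul rl rv cov zl; apply/le_nz => nz0.
pose x0 := JState (cinit K (state_of l0 v0)) l0 v0.
have i0 : jinv x0.
  split=> //; apply: nz_le nz0 _; apply/le_meets => s; rewrite /=.
  case E: (nat_of_ord s) => [|p].
    have -> : s = ord0 by apply: ord_inj.
    rewrite state_of0; apply: ble_trans (meetr _ _) _.
    by rewrite -/(hval _ M) hval_dual.
  case: (ltnP p (size l0)) => pl; last by rewrite (state_ofN _ E pl); exact: le_top.
  rewrite (state_ofS _ E pl); apply: ble_trans (meetl _ _) _.
  by apply: zl; exact: mem_nth.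
have [f [f0 fi fR]] := dependent_choice i0 (fun x ix => jstep ix).
have dat n : {d : pred 'I_nL.+1 * letter Q r * (nat -> letter Q r) * (Q -> nat) |
    jrel (f n) (f n.+1) d.1.1.1 d.1.1.2 d.1.2 d.2}.
  by apply: cid; have [fr [Lr [Ll [hk h]]]] := fR n; exists (fr, Lr, Ll, hk).
pose fr n := (projT1 (dat n)).1.1.1; pose Lr n := (projT1 (dat n)).1.1.2.
pose Ll n := (projT1 (dat n)).1.2; pose hk n := (projT1 (dat n)).2.
have rel n : jrel (f n) (f n.+1) (fr n) (Lr n) (Ll n) (hk n) := projT2 (dat n).
have cs0 : conf_ok (jc (f 0)) by rewrite f0.
have csS n : jc (f n.+1) = cnext jhes (jc (f n)) (cu (jc (f n.+1))) (fr n) := rel_next (rel n).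
have nz n : bnz (cval jhes (jc (f n))) := inv_nz (fi n).
have [i hi [bad _]] := @thread_word (fun n => jv (f n)) Lr (inv_reachv (fi 0)) (fun n => rel_right (rel n)).
have hbad : bad_word mu Lr.
  apply: bad; have := @thread_limsup _ _ _ _ jhes jhes_good (fun n => jc (f n)) fr cs0 csS nz
    ord0 None (fun n => jv (f n)) i 0.
  rewrite -[hmu (jhes None) _]/(~~ hmu (nhes kr enc dec lit k.+1 Z) i) nhes_mu negbK.
  apply => // n _; split; first exact: rel_fr0 (rel n).
  by exists (jv (f n)); rewrite // (inv_cu (fi n)) state_of0.
have [g [lb [m [[N0 h0] lim mm]]]] := hbad.
(* The bad trace of the right word eventually avoids the greatest fixpoint [k]. *)
have [N1 h1] : eventually (fun n => ~ (lb n = kq /\ ~~ mu k)).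
  apply: not_inf_often => io.
  have lk : limsup_is (fun n => lb n) k.
    split; last by apply: inf_often_sub io => n [->].
    by exists N0 => n /h0 /(rel_dom (rel n))[].
  by move: mm; rewrite (limsup_uniq lim lk); have [n _ [_ /negbTE->]] := io 0.
have tr n : maxn N0 N1 <= n -> exists p, [/\ p < size (jl (f n.+1)),
    g n.+1 \in gam (nth es (jl (f n.+1)) p).2,
    keyp (nth es (jl (f n.+1)) p).1 p <= hk n (g n) &
    keyp (nth es (jl (f n.+1)) p).1 p = hk n (g n) -> p < size (jl (f n)) ->
        (forall s : 'I_nL.+1, s = p.+1 :> nat -> ~~ fr n s) /\
        (g n \in gam (nth es (jl (f n)) p).2 -> lb n \in Ll n p (g n, g n.+1))].
  rewrite geq_max => /andP[n0 n1].
  by have [/(h1 n n1)|] := rel_trace (rel n) (h0 n n0).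
have [kap [N2 h2]] : exists kap, eventually (fun n => hk (maxn N0 N1 + n) (g (maxn N0 N1 + n)) = kap).
  apply: nonincr_stable => n; have [|p [pl gp kp _]] := tr (maxn N0 N1 + n); first exact: leq_addr.
  by rewrite addnS; apply: leq_trans kp; exact: (rel_key (rel _)).
pose N := maxn N0 N1 + N2.
have hN n : N <= n -> hk n (g n) = kap.
  move=> Nn; have e : n = maxn N0 N1 + (n - maxn N0 N1).
    by rewrite subnKC //; apply: leq_trans Nn; exact: leq_addr.
  by rewrite e; apply: h2; rewrite leq_subRL //; apply: leq_trans Nn; exact: leq_addr.
(* This inverts [keyp]: the stable seniority determines the slot, whichever the level of the
   thread. *)
pose ps := if kap < nL.+1 then kap else kap - nL.+1.
have trN n : N <= n -> [/\ ps < size (jl (f n.+1)), g n.+1 \in gam (nth es (jl (f n.+1)) ps).2 &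
    ps < size (jl (f n)) -> (forall s : 'I_nL.+1, s = ps.+1 :> nat -> ~~ fr n s) /\
        (g n \in gam (nth es (jl (f n)) ps).2 -> lb n \in Ll n ps (g n, g n.+1))].
  move=> Nn; have [|p [pl gp kp hp]] := tr n; first by apply: leq_trans Nn; exact: leq_addr.
  have ke : keyp (nth es (jl (f n.+1)) p).1 p = kap.
    apply/eqP; rewrite eqn_leq -{1}(hN n Nn) kp /=.
    by rewrite -(hN n.+1 (leqW Nn)); exact: (rel_key (rel _)).
  have -> : ps = p.
    have pL : p <= nL := leq_trans (ltnW pl) (size_uniq (inv_uniq (fi n.+1))).
    by rewrite /ps -ke /keyp; case: (nth es _ _).1; rewrite ?ltnS ?pL // ltnNge leq_addr /= addKn.
  by split => //; apply: hp; rewrite ke hN.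
have in_l n : N < n -> ps < size (jl (f n)) /\ g n \in gam (nth es (jl (f n)) ps).2.
  by case: n => // n; rewrite ltnS => /trN[].
have sz : ps.+1 < nL.+1.
  by rewrite ltnS; have [pl _] := in_l N.+1 (ltnSn _); apply: leq_trans pl (size_uniq (inv_uniq (fi _))).
pose s : 'I_nL.+1 := Ordinal sz.
have fresh n : N < n -> ~~ fr n s /\ lb n \in Ll n ps (g n, g n.+1).
  by move=> Nn; have [pl gp] := in_l n Nn; have [_ _ /(_ pl)[/(_ s erefl) ? /(_ gp)]] := trN n (ltnW Nn).
pose w n := nth es (jl (f (N.+1 + n))) ps.
have kd0 n : (w n).1 = (w 0).1.
  elim: n => // n <-; rewrite /w addnS.
  by have [fn _] := fresh (N.+1 + n) (leq_addr _ _); have [_ _ -> _ _] := rel_left (rel _) (erefl ps.+1 : s = ps.+1 :> nat) fn.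
have [] := @thread_word (fun n => (w n).2) (fun n => Ll (N.+1 + n) ps).
- by apply: (inv_reach (fi (N.+1 + 0))); apply: mem_nth; rewrite addn0; case: (in_l N.+1).
- move=> n; rewrite /w addnS; have [fn _] := fresh (N.+1 + n) (leq_addr _ _).
  by have [_ _ _ -> ->] := rel_left (rel _) (erefl ps.+1 : s = ps.+1 :> nat) fn.
move=> i' hi' [_ odd'].
have : odd (dec i').1.
  apply: odd'; apply/(bad_word_shift mu (fun n => Ll n ps) N.+1).
  exists g, lb, m; split => //; by exists N.+1 => n /fresh[].
apply/negP; rewrite -(nhes_mu kr enc dec lit (klev (w 0).1) (kenv (w 0).1)).
have := @thread_limsup _ _ _ _ jhes jhes_good (fun n => jc (f n)) fr cs0 csS nz
    s (Some (w 0).1) (fun n => (nth es (jl (f n)) ps).2) i' N.+1.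
apply; last by apply/(limsup_shift (fun n => (nth es (jl (f n)) ps).2 : nat) i' N.+1).
move=> n Nn; have [fn _] := fresh n Nn; split => //.
exists (nth es (jl (f n)) ps).2 => //.
have [pl _] := in_l n Nn; rewrite (inv_cu (fi n)) (state_ofS _ (erefl _ : s = ps.+1 :> nat) pl).
by congr (Some (Some _, _)); have := kd0 (n - N.+1); rewrite /w subnKC.
Qed.

End Joint.

(** * From the automaton to its tableau, level by level *)

Section Levels.
Variables (Lt Act : Type) (V : vaut Lt Act) (kr : bool).
Notation r := (vsize V).
Notation Q := 'I_r.
Notation nd := (@vnd _ _ V).
Notation mu := (@vmu _ _ V).
Notation mdiaP := (@mdiaP Lt Act V).
Notation mboxP := (@mboxP Lt Act V).
Variable kt : nat.
Hypothesis kt_card : #|{: option (letter Q r)}| = kt.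
Notation dmem := (dstate Q r kt).
Notation macro := ({set Q} * dmem)%type.
Variable M : nat.
Variables (enc : 'I_(dbound kt) * macro -> 'I_M) (dec : 'I_M -> 'I_(dbound kt) * macro).
Hypothesis encK : cancel enc dec.
Hypothesis decK : cancel dec enc.
Hypothesis enc_mono : forall (p p' : 'I_(dbound kt)) (x x' : macro),
  p < p' -> enc (p, x) < enc (p', x').
Variables (K : kozen Act) (lit : Lt -> K).
Hypothesis gK : kglobal K.
Hypothesis krK : kr -> knormal K.

Notation nh k Z := (nhes kr enc dec lit k Z).

Definition nval k Z (i : 'I_M) : K := hval (nh k Z) M i.

Definition idx (x : macro) : 'I_M := enc (ord0, x).

Lemma nval_body k Z i : nval k Z i = nbody kr enc lit k Z (dec i).2 (hval (nh k Z) M).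
Proof. by rewrite /nval hvalE ?ltn_ord ?nhesE //; apply: hes_def_good; exact: nhes_def. Qed.

Notation reach x := (dreach (x : dmem)).

Section OneLevel.
Variables (kq : Q) (Z : nat -> K).
Notation k := (nat_of_ord kq).

Lemma nval_join (l : seq 'I_M) (v : 'I_M) z : (forall i, i \in l -> reach (dec i).2.2) ->
  reach (dec v).2.2 -> (forall q, q \in (dec v).2.1 -> exists2 i, i \in l & q \in (dec i).2.1) ->
  (forall i, i \in l -> z <<= nval k.+1 Z i) -> z <<= nval k.+1 Z v.
Proof.
move=> rl rv cov zl.
(* All threads have level [k.+1], so none stops at [kq]; the constant [bbot] makes the bound on [X0]
   trivial. *)
pose es := (true, idx ([set kq], @dinit Q r kt)).
pose l0 := undup [seq (true, i) | i <- l].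
have l0P e : e \in l0 -> e.1 = true /\ e.2 \in l.
  by rewrite mem_undup => /mapP[i il ->].
apply: (@joint _ _ V kr kt kt_card M enc dec encK decK enc_mono K lit gK krK
  kq Z bbot es _ _ _ l0 v z) => //.
- by rewrite /dm /es encK; exact: dreach_init.
- by left; split => //; rewrite /gam /es encK inE.
- exact: undup_uniq.
- by move=> e /l0P[_ /rl].
- move=> q /cov[i il qi]; exists (true, i) => //; rewrite mem_undup.
  by apply/mapP; exists i.
by case=> b i /l0P[/= -> /zl].
Qed.

Lemma nval_sub (i v : 'I_M) : reach (dec i).2.2 -> reach (dec v).2.2 ->
  (dec v).2.1 \subset (dec i).2.1 -> nval k.+1 Z i <<= nval k.+1 Z v.
Proof.
move=> ri rv /subsetP sub; apply: (@nval_join [:: i]) => //.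
- by move=> j; rewrite inE => /eqP->.
- by move=> q /sub; exists i; rewrite ?inE.
- by move=> j; rewrite inE => /eqP->.
Qed.

(** The passage between levels: the constant [X0] at state [k] is exchanged for an entry [es] that
    dominates it and continues behind [kq]. *)
Lemma nval_up X0 (es : bool * 'I_M) (i v : 'I_M) :
  X0 <<= nval (klev kq es.1) (kenv kq Z X0 es.1) es.2 -> reach (dec es.2).2.2 ->
  (es.1 /\ kq \in (dec es.2).2.1) \/
  (~~ es.1 /\ ~~ mu k /\ exists a, nd kq = NCopy a /\ a \in (dec es.2).2.1) ->
  reach (dec i).2.2 -> reach (dec v).2.2 -> (dec v).2.1 \subset (dec i).2.1 ->
  nval k (upd Z k X0) i <<= nval k.+1 Z v.
Proof.
move=> X0_le es_reach es_spawn ri rv /subsetP sub.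
apply: (@joint _ _ V kr kt kt_card M enc dec encK decK enc_mono K lit gK krK
  kq Z X0 es X0_le es_reach es_spawn [:: (false, i)] v) => //.
- by move=> j; rewrite inE => /eqP->.
- by move=> q /sub; exists (false, i); rewrite ?inE.
- by move=> j; rewrite inE => /eqP->.
Qed.

Definition sidx q := idx ([set q], @dinit Q r kt).

Lemma sidx_reach q : reach (dec (sidx q)).2.2.
Proof. by rewrite /sidx /idx encK; exact: dreach_init. Qed.

Lemma sidx_set q : (dec (sidx q)).2.1 = [set q].
Proof. by rewrite /sidx /idx encK. Qed.

(* Prefixing a resolution by a propositional step at [kq]. *)
Lemma nbody_extend (i : 'I_M) (b : bool) : reach (dec i).2.2 ->
  (forall R, resol k.+1 (dec i).2.1 R -> forall q',
     (match nd kq with NAnd a a' => (q' == a) || (q' == a')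
      | NOr a a' => q' == (if (if kq \in R.1 then R.2 kq else b) then a else a')
      | NCopy a => q' == a | _ => false end) -> q' \in R.1) ->
  (match nd kq with NAnd _ _ | NOr _ _ | NCopy _ => True | _ => False end) ->
  nval k.+1 Z i <<= nval k.+1 Z (sidx kq).
Proof.
move=> ri hs nm; rewrite !nval_body; set y := hval _ M; apply/joins_le => R.
case: asboolP => // hR; have [sR cR vR] := hR.
pose R' : rho V := (kq |: R.1, [ffun q => if (q == kq) && (kq \notin R.1) then b else R.2 q]).
have ch q : q \in R.1 -> R'.2 q = R.2 q.
  by move=> qR; rewrite /= ffunE; case: eqP qR => //= -> ->.
have chk : R'.2 kq = if kq \in R.1 then R.2 kq else b.
  by rewrite /= ffunE eqxx /=; case: (kq \in R.1).
have edge q q' : q \in R.1 -> ledge k.+1 R' q q' = ledge k.+1 R q q'.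
  by move=> qR; rewrite /ledge (ch q qR) [q \in R'.1]inE qR orbT.
have edgek q' : ledge k.+1 R' kq q' -> q' \in R.1.
  by move=> /and3P[_ _]; rewrite chk; exact: hs.
have inR' q q' : ledge k.+1 R' q q' -> q' \in R.1.
  move=> e; have : q \in R'.1 by case/and3P: e.
  rewrite /= in_setU1 => /predU1P[eq|qR]; first by move: e; rewrite eq; exact: edgek.
  by apply: (cR q); rewrite -edge.
have hR' : resol k.+1 (dec (sidx kq)).2.1 R'.
  split.
  - by rewrite sidx_set; apply/subsetP => q; rewrite !inE => ->.
  - by move=> q q' /inR' h; rewrite /= in_setU1 h orbT.
  - move=> [f [x [fe lx mx]]]; apply: vR; exists (fun n => f (1 + n)), x; split => //.
      move=> n; rewrite -edge ?addnS //; rewrite add1n; exact: inR' (fe n).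
    by apply/(limsup_shift (fun n => f n)).
have mdE : mdia k.+1 R' = mdia k.+1 R.
  apply: funext => q; rewrite /mdia /= in_setU1; case: eqP => [->|] //=.
  by move: nm; case: (nd kq) => // *; rewrite !if_same.
have mbE : mbox k.+1 R' = mbox k.+1 R.
  apply: funext => q; rewrite /mbox /= in_setU1; case: eqP => [->|] //=.
  by move: nm; case: (nd kq) => // *; rewrite !if_same.
apply: ble_trans (le_joins _ R'); rewrite asboolT //; apply: meet_mono.
  apply/le_meets => q; rewrite /= in_setU1; case: eqP => [->|_] /=.
    by rewrite ltnSn; move: nm; case: (nd kq) => // *; exact: le_top.
  exact: (meets_le _ q).
apply: meets_mono => t.
have -> : tvalid kr k.+1 R' t = tvalid kr k.+1 R t by rewrite /tvalid mdE mbE.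
case: asboolP => // vt.
have -> : top (K := K) k.+1 R' t = top k.+1 R t by rewrite /top mdE mbE.
have tsE : tset kr k.+1 R' t = tset kr k.+1 R t.
  by apply/setP => c; rewrite !inE; congr (asbool _); rewrite /trel mdE mbE.
apply: top_mono; apply: nval_sub.
- by rewrite /nxt encK /=; exact: dreach_step.
- by rewrite /nxt encK /=; apply: dreach_step; exact: sidx_reach.
by rewrite /nxt !encK /= tsE.
Qed.

Lemma nfun_monoQ (n : vnode Lt Act r) (y z : nat -> K) : (forall q : Q, y q <<= z q) ->
  nfun lit n y <<= nfun lit n z.
Proof.
move=> yz; case: n => //= *.
- exact: meet_mono.
- exact: join_mono.
- exact: kdia_mono.
- exact: kbox_mono.
Qed.

Definition ny kk ZZ (n : nat) : K := if insub n is Some q then nval kk ZZ (sidx q) else btop.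

Lemma nyE kk ZZ (q : Q) : ny kk ZZ q = nval kk ZZ (sidx q).
Proof. by rewrite /ny valK. Qed.

(** At propositional nodes a resolution of the children is prefixed by [kq]; for a conjunction the
    two children are joined beforehand. At literals and modalities the resolution [R0], which visits
    [kq] alone, is used. *)
Lemma nval_unfold : nfun lit (nd kq) (ny k.+1 Z) <<= nval k.+1 Z (sidx kq).
Proof.
pose R0 : rho V := ([set kq], [ffun=> true]).
have leaf : (match nd kq with NAnd _ _ | NOr _ _ | NCopy _ => false | _ => true end) ->
    resol k.+1 (dec (sidx kq)).2.1 R0.
  move=> lf.
  have noedge q q' : ~~ ledge k.+1 R0 q q'.
    by apply/negP => /and3P[/=]; rewrite inE => /eqP-> _; case: (nd kq) lf.
  split; first by rewrite sidx_set.
    by move=> q q' h; have := noedge q q'; rewrite h.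
  by move=> [f [x [fe _ _]]]; have := noedge (f 0) (f 1); rewrite fe.
have inR0 q : q \in R0.1 -> q = kq by rewrite inE => /eqP.
case E: (nd kq) => [l|a b|a b|a c|a c|a] /=.
- rewrite nval_body; apply: ble_trans (le_joins _ R0); rewrite asboolT; last by apply: leaf; rewrite E.
  apply: le_meet; apply/le_meets.
    by move=> q; case: ifP => [/inR0->|_]; [rewrite ltnSn E | exact: le_top].
  move=> t; case: asboolP => [vt|_]; last exact: le_top.
  exfalso; case: t vt => [[q|q]|[q q']] /=.
  + by move=> [a [c /mdiaP[/inR0-> _]]]; rewrite E.
  + by move=> [a [c /mboxP[/inR0-> _]]]; rewrite E.
  + by move=> [_ [a [c [c' [/mdiaP[/inR0-> _]]]]]]; rewrite E.
- rewrite !nyE; set v := idx ([set a] :|: [set b], @dinit Q r kt).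
  have rv : reach (dec v).2.2 by rewrite /v /idx encK; exact: dreach_init.
  have vs : (dec v).2.1 = [set a; b] by rewrite /v /idx encK.
  apply: ble_trans (_ : _ <<= nval k.+1 Z v) _.
    apply: (@nval_join [:: sidx a; sidx b]) => //.
    + by move=> i; rewrite !inE => /orP[]/eqP->; exact: sidx_reach.
    + move=> q; rewrite vs !inE => /orP[]/eqP->; [exists (sidx a) | exists (sidx b)];
        by rewrite ?sidx_set ?inE ?eqxx ?orbT.
    + by move=> i; rewrite !inE => /orP[]/eqP->; [exact: meetl | exact: meetr].
  apply: (@nbody_extend v true) => //; rewrite E // => R [/subsetP sR _ _] q' /orP[]/eqP->; apply: sR;
    by rewrite vs !inE eqxx ?orbT.
- have key (c : Q) (h : bool) : (if h then a else b) = c -> ny k.+1 Z c <<= nval k.+1 Z (sidx kq).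
    move=> hc; rewrite nyE; apply: (@nbody_extend (sidx c) h); first exact: sidx_reach.
      rewrite E => R [/subsetP sR cR _] q'.
      case kR: (kq \in R.1) => /eqP->; last by rewrite hc; apply: sR; rewrite sidx_set inE.
      by apply: (cR kq); rewrite /ledge kR ltnSn E /=.
    by rewrite E.
  by apply/le_joinP; split; [apply: (key a true) | apply: (key b false)].
- rewrite nyE [X in _ <<= X]nval_body; apply: ble_trans (le_joins _ R0); rewrite asboolT; last by apply: leaf; rewrite E.
  have mk : mdia k.+1 R0 kq = Some (a, c) by apply: mdiaI; rewrite ?inE.
  apply: le_meet; apply/le_meets.
    by move=> q; case: ifP => [/inR0->|_]; [rewrite ltnSn E; exact: le_top | exact: le_top].
  move=> t; case: asboolP => [vt|_]; last exact: le_top.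
  case: t vt => [[q|q]|[q q']] /=.
  + move=> [a' [c' /mdiaP[/inR0-> _ _]]]; rewrite mk; apply: kdia_mono; apply: nval_sub.
    * exact: sidx_reach.
    * by rewrite /nxt encK /=; apply: dreach_step; exact: sidx_reach.
    rewrite /nxt encK sidx_set /=; apply/subsetP => q'; rewrite !inE => /asboolP[p [rp ep]].
    have [/inR0 pk _] := trel_dom (t := TD kq) (ex_intro _ a (ex_intro _ c mk)) rp.
    by move: ep; rewrite sidx_set inE pk /mchild E => -[->].
  + by move=> [a' [c' /mboxP[/inR0-> _]]]; rewrite E.
  + by move=> [_ [a' [c' [c0 [_ /mboxP[/inR0-> _]]]]]]; rewrite E.
- rewrite nyE [X in _ <<= X]nval_body; apply: ble_trans (le_joins _ R0); rewrite asboolT; last by apply: leaf; rewrite E.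
  have mk : mbox k.+1 R0 kq = Some (a, c) by apply: mboxI; rewrite ?inE.
  apply: le_meet; apply/le_meets.
    by move=> q; case: ifP => [/inR0->|_]; [rewrite ltnSn E; exact: le_top | exact: le_top].
  move=> t; case: asboolP => [vt|_]; last exact: le_top.
  case: t vt => [[q|q]|[q q']] /=.
  + by move=> [a' [c' /mdiaP[/inR0-> _]]]; rewrite E.
  + move=> [a' [c' /mboxP[/inR0-> _ _]]]; rewrite mk; apply: kbox_mono; apply: nval_sub.
    * exact: sidx_reach.
    * by rewrite /nxt encK /=; apply: dreach_step; exact: sidx_reach.
    rewrite /nxt encK sidx_set /=; apply/subsetP => q'; rewrite !inE => /asboolP[p [rp ep]].
    have [/inR0 pk _] := trel_dom (t := TB kq) (ex_intro _ a (ex_intro _ c mk)) rp.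
    by move: ep; rewrite sidx_set inE pk /mchild E => -[->].
  + by move=> [_ [a' [c' [c0 [/mdiaP[/inR0-> _]]]]]]; rewrite E.
rewrite nyE; apply: (@nbody_extend (sidx a) true); first exact: sidx_reach.
  rewrite E => R [/subsetP sR _ _] q' /eqP->; apply: sR; by rewrite sidx_set inE.
by rewrite E.
Qed.

End OneLevel.

Theorem sol_le_nval k (Z : nat -> K) (q : Q) : k <= r ->
  sol (vhes lit V) k Z q <<= nval k Z (sidx q).
Proof.
elim: k Z q => [|k IH] Z q kr'.
  pose R0 : rho V := ([set q], [ffun=> true]).
  rewrite nval_body; apply: ble_trans (le_joins _ R0); rewrite asboolT; last first.
    split; first by rewrite sidx_set.
      by move=> p p' /and3P[].
    by move=> [f [x [/(_ 0) /and3P[]]]].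
  apply: le_meet; apply/le_meets.
    by move=> p; case: ifP => [|_]; [rewrite inE /= => /eqP-> | exact: le_top].
  move=> t; case: asboolP => [vt|_]; last exact: le_top.
  exfalso; case: t vt => [[p|p]|[p p']] /=.
  + by move=> [a [c /mdiaP[]]]; rewrite ltn0.
  + by move=> [a [c /mboxP[]]]; rewrite ltn0.
  + by move=> [_ [a [c [c' [/mdiaP[]]]]]]; rewrite ltn0.
have gV := hes_def_good (vhes_def lit V).
pose kq : Q := Ordinal kr'; have kE : k = kq by [].
have levE x : lev (vhes lit V) k Z x = nfun lit (nd kq) (sol (vhes lit V) k (upd Z k x)).
  exact: (vhesE lit kq).
rewrite solS; set xs := fxp _ _ _.
case Emu : (mu k).
  (* Least fixpoint: [Y] serves as the constant and its own entry is spawned, which makes [Y]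
     prefixed for the equation of [k]. *)
  pose Y := nval k.+1 Z (sidx kq).
  have up p : nval k (upd Z k Y) (sidx p) <<= nval k.+1 Z (sidx p).
    apply: (@nval_up kq Z Y (true, sidx kq)) => //; try exact: sidx_reach.
    by left; rewrite sidx_set inE.
  have xY : xs <<= Y.
    rewrite /xs /fxp -[hmu _ _]/(mu k) Emu; apply: lfp_le; first exact: (hgood_lfp gV k Z btop).
    apply: ble_trans (meetl _ _) _; rewrite levE.
    apply: ble_trans (nval_unfold kq Z); apply: nfun_monoQ => p.
    rewrite nyE; apply: ble_trans (up p); exact: (IH (upd Z k Y) p (ltnW kr')).
  apply: ble_trans (up q); apply: ble_trans (IH _ _ (ltnW kr')).
  apply: sol_mono => // i _; rewrite /upd; case: eqP => //.
(* Greatest fixpoint: [xs] itself is the constant. Being a fixpoint, it is the solution at the body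
   [a], which the induction hypothesis bounds by the entry of level [k] for [a]. *)
have [a ea] : exists a, nd kq = NCopy a by apply: vmuP; rewrite -kE Emu.
apply: ble_trans (IH _ _ (ltnW kr')) _.
apply: (@nval_up kq Z xs (false, sidx a)); try exact: sidx_reach; last by [].
- have e : xs = lev (vhes lit V) k Z xs.
    have xsE : xs = gfpB (lev (vhes lit V) k Z) by rewrite /xs /fxp -[hmu _ _]/(mu k) Emu.
    by rewrite xsE (gfpE (@levmonof _ _ gV k Z) (hgood_gfp gV k Z)).
  rewrite {1}e levE ea /=; exact: (IH (upd Z k xs) a (ltnW kr')).
- by right; split => //; split; [rewrite -kE Emu | exists a; rewrite sidx_set inE].
Qed.

End Levels.

(** * Adding the global modality *)

Section Global.
Variables (Act : Type) (K : kozen Act).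
Implicit Types (y z : nat -> K).

(* A map is piecewise definable if finitely many monotone bits of its argument
   select which of finitely many definable maps it agrees with. *)
Definition piecewise (f : (nat -> K) -> K) : Prop :=
  exists (T : finType) (eps : (nat -> K) -> {set T}) (p : {set T} -> (nat -> K) -> K),
    [/\ forall S, kdef (p S),
        forall (S S' : {set T}) y, S \subset S' -> p S y <<= p S' y,
        forall y z, (forall i, y i <<= z i) -> eps y \subset eps z &
        forall y, f y = p (eps y) y].

Lemma upd_le y z j x x' : (forall i, y i <<= z i) -> x <<= x' ->
  forall i, upd y j x i <<= upd z j x' i.
Proof. by move=> yz xx' i; rewrite /upd; case: eqP. Qed.

Lemma pw_mono f : piecewise f -> forall y z, (forall i, y i <<= z i) -> f y <<= f z.
Proof.
case=> T [eps [p [dp mp me fE]]] y z yz; rewrite !fE.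
by apply: ble_trans (mp _ _ _ (me _ _ yz)) _; exact: kdef_mono.
Qed.

Lemma pw_def f : kdef f -> piecewise f.
Proof.
move=> df; exists unit, (fun=> set0), (fun _ => f); split => // *; exact: ble_refl.
Qed.

Section Pair.
Variables T1 T2 : finType.
Implicit Types (S : {set (T1 + T2)}) (A : {set T1}) (B : {set T2}).
Definition setL S : {set T1} := [set x | inl x \in S].
Definition setR S : {set T2} := [set x | inr x \in S].
Definition setLR (A : {set T1}) (B : {set T2}) : {set (T1 + T2)} :=
  [set x | match x with inl a => a \in A | inr b => b \in B end].
Lemma setLRl A B : setL (setLR A B) = A. Proof. by apply/setP => x; rewrite !inE. Qed.
Lemma setLRr A B : setR (setLR A B) = B. Proof. by apply/setP => x; rewrite !inE. Qed.
Lemma setLS S (S' : {set (T1 + T2)}) : S \subset S' -> setL S \subset setL S'.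
Proof. by move/subsetP => h; apply/subsetP => x; rewrite !inE; apply: h. Qed.
Lemma setRS S (S' : {set (T1 + T2)}) : S \subset S' -> setR S \subset setR S'.
Proof. by move/subsetP => h; apply/subsetP => x; rewrite !inE; apply: h. Qed.
Lemma setLR_sub A B (A' : {set T1}) (B' : {set T2}) : A \subset A' -> B \subset B' -> setLR A B \subset setLR A' B'.
Proof. by move=> /subsetP ha /subsetP hb; apply/subsetP => -[x|x]; rewrite !inE; auto. Qed.
End Pair.

Lemma pw_meet f g : piecewise f -> piecewise g -> piecewise (fun y => f y ⊓ g y).
Proof.
case=> T [eps [p [dp mp me fE]]] [T' [eps' [p' [dp' mp' me' gE]]]].
exists (T + T')%type, (fun y => setLR (eps y) (eps' y)),
  (fun S y => p (setL S) y ⊓ p' (setR S) y); split.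
- by move=> S; exact: kdef_meet.
- by move=> S S' y SS'; apply: meet_mono; [apply: mp; exact: setLS | apply: mp'; exact: setRS].
- by move=> y z yz; apply: setLR_sub; auto.
- by move=> y; rewrite setLRl setLRr fE gE.
Qed.

Lemma pw_dia a f : piecewise f -> piecewise (fun y => kdia a (f y)).
Proof.
case=> T [eps [p [dp mp me fE]]]; exists T, eps, (fun S y => kdia a (p S y)); split => //.
- by move=> S; exact: kdef_dia.
- by move=> S S' y SS'; apply: kdia_mono; exact: mp.
- by move=> y; rewrite fE.
Qed.

Lemma pw_neg f : piecewise f -> piecewise (fun y => bneg (f (fun i => bneg (y i)))).
Proof.
case=> T [eps [p [dp mp me fE]]].
exists T, (fun y => ~: eps (fun i => bneg (y i))), (fun S y => bneg (p (~: S) (fun i => bneg (y i)))); split.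
- by move=> S; exact: kdef_neg.
- by move=> S S' y SS'; apply: le_neg; apply: mp; rewrite setCS.
- by move=> y z yz; rewrite setCS; apply: me => i; exact: le_neg.
- by move=> y; rewrite fE setCK.
Qed.

Lemma pw_sub f g j : piecewise f -> piecewise g -> piecewise (fun y => f (upd y j (g y))).
Proof.
move=> pf pg; have mg := pw_mono pg.
case: pf => T [eps [p [dp mp me fE]]]; case: pg => T' [eps' [p' [dp' mp' me' gE]]].
exists (T + T')%type, (fun y => setLR (eps (upd y j (g y))) (eps' y)),
  (fun S y => p (setL S) (upd y j (p' (setR S) y))); split.
- by move=> S; exact: kdef_sub.
- move=> S S' y SS'; apply: ble_trans (mp _ _ _ (setLS SS')) _.
  by apply: kdef_mono => //; apply: upd_le => //; apply: mp'; exact: setRS.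
- by move=> y z yz; apply: setLR_sub; [apply: me; apply: upd_le; auto | exact: me'].
- by move=> y; rewrite setLRl setLRr fE -gE.
Qed.

Lemma pw_global f : piecewise f -> piecewise (fun y => bE (f y)).
Proof.
move=> pf; have mf := pw_mono pf.
exists unit, (fun y => [set x | `[< bnz (f y) >]]), (fun (S : {set unit}) _ => if tt \in S then (btop : K) else bbot); split.
- by move=> S; exact: kdef_const.
- by move=> S S' y /subsetP SS'; case: ifP => // /SS' ->; exact: ble_refl.
- move=> y z yz; apply/subsetP => x; rewrite !inE => /asboolP nz; apply/asboolP.
  exact: nz_le nz (mf _ _ yz).
- move=> y; rewrite inE /bE; case: pselect => h; first by rewrite asboolT.
  by rewrite asboolF.
Qed.

Section Lfp.
Variables (T : finType) (eps : (nat -> K) -> {set T}) (p : {set T} -> (nat -> K) -> K) (j : nat).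
Hypothesis dp : forall S, kdef (p S).
Hypothesis mp : forall (S S' : {set T}) y, S \subset S' -> p S y <<= p S' y.
Hypothesis me : forall y z, (forall i, y i <<= z i) -> eps y \subset eps z.

Definition pw_L S y : K := lfpB (fun x => p S (upd y j x)).
Definition pw_F y S : {set T} := eps (upd y j (pw_L S y)).
Definition pw_S y : {set T} := fixset (pw_F y).

Lemma pw_L_mono (S S' : {set T}) y z : S \subset S' -> (forall i, y i <<= z i) -> pw_L S y <<= pw_L S' z.
Proof.
move=> SS' yz; apply: lfp_mono; try exact: kdef_haslfp.
by move=> x; apply: ble_trans (mp _ SS') _; apply: kdef_mono => //; exact: upd_le.
Qed.

Lemma pw_F_mono y z (S S' : {set T}) : S \subset S' -> (forall i, y i <<= z i) -> pw_F y S \subset pw_F z S'.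
Proof. by move=> SS' yz; apply: me; apply: upd_le => //; exact: pw_L_mono. Qed.

Lemma pw_F_homo y : {homo pw_F y : S S' / S \subset S'}.
Proof. by move=> S S' SS'; apply: pw_F_mono. Qed.

Lemma pw_S_le y (S : {set T}) : pw_F y S \subset S -> pw_S y \subset S.
Proof.
move=> FS; rewrite /pw_S /fixset; elim: #|T| => [|n IH] /=; first exact: sub0set.
by apply: subset_trans FS; exact: pw_F_homo.
Qed.

(** Nested elimination between the algebra and a finite lattice: for fixed bits the map is definable
    and has the fixpoint [pw_L], and the bits are the least set reproduced by it. Conversely the
    bits of a prefixed point [z] are prefixed for [pw_F], so they contain [pw_S y]. *)
Lemma pw_islfp y : islfp (fun x => p (eps (upd y j x)) (upd y j x)) (pw_L (pw_S y) y).
Proof.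
have SE : pw_F y (pw_S y) = pw_S y by apply: fixsetK; exact: pw_F_homo.
split.
  rewrite -[eps _]/(pw_F y (pw_S y)) SE; rewrite /pw_L -[X in _ <<= X]lfpE //; last exact: kdef_haslfp.
  by move=> x x' xx'; apply: kdef_mono => //; exact: upd_le.
move=> z hz; have Lz : pw_L (eps (upd y j z)) y <<= z by apply: lfp_le => //; exact: kdef_haslfp.
apply: ble_trans Lz; apply: pw_L_mono => //; apply: pw_S_le.
apply: me; apply: upd_le => //; apply: lfp_le => //; exact: kdef_haslfp.
Qed.

Lemma pw_S_mono y z : (forall i, y i <<= z i) -> pw_S y \subset pw_S z.
Proof.
move=> yz; apply: pw_S_le; have SE : pw_F z (pw_S z) = pw_S z by apply: fixsetK; exact: pw_F_homo.
apply: subset_trans (_ : pw_F z (pw_S z) \subset _); last by rewrite SE.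
exact: pw_F_mono.
Qed.

End Lfp.

Lemma pw_haslfp f j y : piecewise f -> haslfp (fun x => f (upd y j x)).
Proof.
case=> T [eps [p [dp mp me fE]]]; exists (pw_L p j (pw_S eps p j y) y).
rewrite (_ : (fun x => _) = fun x => p (eps (upd y j x)) (upd y j x)); first exact: pw_islfp.
by apply: funext => x; rewrite fE.
Qed.

Lemma pw_lfp f j : piecewise f -> piecewise (fun y => lfpB (fun x => f (upd y j x))).
Proof.
case=> T [eps [p [dp mp me fE]]].
exists T, (pw_S eps p j), (fun S => pw_L p j S); split.
- by move=> S; exact: kdef_lfp.
- by move=> S S' y SS'; exact: pw_L_mono.
- exact: pw_S_mono.
move=> y; apply: lfp_eq.
rewrite (_ : (fun x => _) = fun x => p (eps (upd y j x)) (upd y j x)); first exact: pw_islfp.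
by apply: funext => x; rewrite fE.
Qed.

Definition kozenE : kozen Act :=
  @Kozen Act K (@kdia Act K) piecewise (@kdia_mono Act K) pw_mono
    (fun i => pw_def (@kdef_var Act K i)) (fun b => pw_def (@kdef_const Act K b))
    pw_meet pw_dia pw_neg pw_sub pw_haslfp pw_lfp.

Lemma kozenE_global : kglobal kozenE. Proof. exact: pw_global. Qed.

Lemma kozenE_normal : knormal K -> knormal kozenE. Proof. by []. Qed.

End Global.

(** * Syntax of recursive game logic *)

Scheme formula_game_ind := Induction for formula Sort Prop
with game_formula_ind := Induction for game Sort Prop.
Combined Scheme syntax_ind from formula_game_ind, game_formula_ind.

Section Syntax.
Variables Prp Act : Type.
Notation formula := (formula Prp Act).
Notation game := (game Prp Act).
Implicit Types (p q : formula) (a b : game) (x y z : nat).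

Lemma dualK a : dual (dual a) = a.
Proof. by elim: a => //= *; congruence. Qed.

Lemma complK p : compl (compl p) = p.
Proof. by elim: p => //= [p -> q ->|p -> q ->|a p ->]; rewrite ?dualK. Qed.

Lemma fvg_dual a : fvg (dual a) = fvg a.
Proof. by elim: a => //= *; congruence. Qed.

Lemma dfvg_dual a : dfvg (dual a) = dfvg a.
Proof. by elim: a => //= *; congruence. Qed.

Lemma normalg_dual a : normalg (dual a) = normalg a.
Proof. by elim: a => //= *; rewrite ?dfvg_dual; congruence. Qed.

Lemma rling_dual a : rling (dual a) = rling a.
Proof. by elim: a => //= *; rewrite ?fvg_dual; congruence. Qed.

Lemma fvf_compl p : fvf (compl p) = fvf p.
Proof. by elim: p => //= [p -> q ->|p -> q ->|a p ->]; rewrite ?fvg_dual. Qed.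

Lemma normalf_compl p : normalf (compl p) = normalf p.
Proof. by elim: p => //= [p -> q ->|p -> q ->|a p ->]; rewrite ?normalg_dual. Qed.

Lemma rlinf_compl p : rlinf (compl p) = rlinf p.
Proof. by elim: p => //= [p -> q ->|p -> q ->|a p ->]; rewrite ?rling_dual. Qed.

Lemma dfv_fv : (forall p, {subset dfvf p <= fvf p}) /\ (forall a, {subset dfvg a <= fvg a}).
Proof.
have sub_cat (s1 s2 t1 t2 : seq nat) : {subset s1 <= t1} -> {subset s2 <= t2} ->
    {subset s1 ++ s2 <= t1 ++ t2}.
  by move=> h1 h2 z; rewrite !mem_cat => /orP[/h1->|/h2->]; rewrite ?orbT.
have sub_filter (s t : seq nat) x : {subset s <= t} ->
    {subset [seq z <- s | z != x] <= [seq z <- t | z != x]}.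
  by move=> h z; rewrite !mem_filter => /andP[-> /h].
by apply: syntax_ind => //= *; first [exact: sub_cat | exact: sub_filter | move=> ?].
Qed.

Lemma subst_id x b : (forall p, x \notin fvf p -> substf x b p = p) /\
  (forall a, x \notin fvg a -> substg x b a = a).
Proof.
apply: syntax_ind => //=;
  try by move=> p hp q hq; rewrite mem_cat negb_or => /andP[/hp-> /hq->].
- by move=> z; rewrite inE eq_sym => /negbTE->.
- by move=> p hp /hp->.
- by move=> p hp /hp->.
- by move=> z a h; rewrite mem_filter negb_and negbK; case: eqVneq => [//|zx /= /h->].
- by move=> z a h; rewrite mem_filter negb_and negbK; case: eqVneq => [//|zx /= /h->].
Qed.

Lemma substf_closed x b p : closedf p -> substf x b p = p.
Proof. by move=> /nilP cp; apply: (subst_id x b).1; rewrite cp. Qed.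

Definition gok a := normalg a && rling a.
Definition fok p := rlGL p && closedf p.

(* Simultaneous substitution; the policy [fr] renames the binders met at depth [d]. *)
Fixpoint gsub (fr : nat -> nat -> nat) d (s : nat -> game) a : game :=
  match a with
  | GVar x => s x
  | GCup a b => GCup (gsub fr d s a) (gsub fr d s b)
  | GCap a b => GCap (gsub fr d s a) (gsub fr d s b)
  | GSeq a b => GSeq (gsub fr d s a) (gsub fr d s b)
  | GMu x a => GMu (fr d x) (gsub fr d.+1 (upd s x (GVar (fr d x))) a)
  | GNu x a => GNu (fr d x) (gsub fr d.+1 (upd s x (GVar (fr d x))) a)
  | _ => a
  end.

Lemma dfvg_nil_body x a : x \notin dfvg a -> nilp [seq z <- dfvg a | z != x] -> nilp (dfvg a).
Proof.
move=> xa; rewrite (_ : filter _ _ = dfvg a) //; apply/all_filterP/allP => w.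
by apply: contraTneq => ->.
Qed.

Lemma fvg_gsub fr d s a z : normalg a -> nilp (dfvg a) -> z \in fvg (gsub fr d s a) ->
  exists2 x, x \in fvg a & z \in fvg (s x).
Proof.
elim: a d s z => //=.
- by move=> x d s z _ _ h; exists x; rewrite ?inE.
- by move=> p d s z /andP[_ /nilP->].
- by move=> p d s z /andP[_ /nilP->].
- move=> a ha b hb d s z /andP[na nb]; rewrite cat_nilp => /andP[da db]; rewrite mem_cat.
  by case/orP => [/ha|/hb] [] // x xa zx; exists x; rewrite ?mem_cat ?xa ?orbT.
- move=> a ha b hb d s z /andP[na nb]; rewrite cat_nilp => /andP[da db]; rewrite mem_cat.
  by case/orP => [/ha|/hb] [] // x xa zx; exists x; rewrite ?mem_cat ?xa ?orbT.
- move=> a ha b hb d s z /andP[na nb]; rewrite cat_nilp => /andP[da db]; rewrite mem_cat.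
  by case/orP => [/ha|/hb] [] // x xa zx; exists x; rewrite ?mem_cat ?xa ?orbT.
- move=> x a ha d s z /andP[na xa] /(dfvg_nil_body xa) da; rewrite mem_filter => /andP[zf].
  case/ha => // x' x'a; rewrite /upd; case: eqVneq => [_|xx' zs]; first by rewrite inE (negbTE zf).
  by exists x' => //; rewrite mem_filter xx'.
- move=> x a ha d s z /andP[na xa] /(dfvg_nil_body xa) da; rewrite mem_filter => /andP[zf].
  case/ha => // x' x'a; rewrite /upd; case: eqVneq => [_|xx' zs]; first by rewrite inE (negbTE zf).
  by exists x' => //; rewrite mem_filter xx'.
Qed.

Lemma gsub_ok fr d s a : gok a -> nilp (dfvg a) ->
  (forall x, gok (s x) /\ nilp (dfvg (s x))) ->
  gok (gsub fr d s a) /\ nilp (dfvg (gsub fr d s a)).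
Proof.
rewrite /gok; elim: a d s => //=.
- move=> a ha b hb d s /andP[/andP[na nb] /andP[ra rb]]; rewrite !cat_nilp => /andP[da db] hs.
  have [/andP[-> ->] ->] := ha d s (introT andP (conj na ra)) da hs.
  by have [/andP[-> ->] ->] := hb d s (introT andP (conj nb rb)) db hs.
- move=> a ha b hb d s /andP[/andP[na nb] /andP[ra rb]]; rewrite !cat_nilp => /andP[da db] hs.
  have [/andP[-> ->] ->] := ha d s (introT andP (conj na ra)) da hs.
  by have [/andP[-> ->] ->] := hb d s (introT andP (conj nb rb)) db hs.
- move=> a ha b hb d s /andP[/andP[na nb] /and3P[ra rb ca]]; rewrite !cat_nilp => /andP[da db] hs.
  have -> : nilp (fvg (gsub fr d s a)).
    case E: (fvg _) => [//|z t]; have : z \in fvg (gsub fr d s a) by rewrite E mem_head.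
    by case/fvg_gsub => // x; rewrite (nilP ca).
  have [/andP[-> ->] ->] := ha d s (introT andP (conj na ra)) da hs.
  by have [/andP[-> ->] ->] := hb d s (introT andP (conj nb rb)) db hs.
- move=> x a ha d s /andP[/andP[na xa] ra] /(dfvg_nil_body xa) da hs.
  have [|/andP[-> ->] /nilP->//] := ha d.+1 (upd s x (GVar (fr d x))) (introT andP (conj na ra)) da.
  by move=> x'; rewrite /upd; case: eqP.
- move=> x a ha d s /andP[/andP[na xa] ra] /(dfvg_nil_body xa) da hs.
  have [|/andP[-> ->] /nilP->//] := ha d.+1 (upd s x (GVar (fr d x))) (introT andP (conj na ra)) da.
  by move=> x'; rewrite /upd; case: eqP.
Qed.

Notation ssub := (gsub (fun _ x => x) 0).

Lemma ssub_depth d d' s a : gsub (fun _ x => x) d s a = gsub (fun _ x => x) d' s a.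
Proof. by elim: a d d' s => //= [a ha b hb|a ha b hb|a ha b hb|x a h|x a h] d d' s; f_equal; auto. Qed.

Lemma ssub_var a : ssub GVar a = a.
Proof.
elim: a => //= [a -> b ->|a -> b ->|a -> b ->|x a h|x a h] //; rewrite (ssub_depth 1 0);
  by rewrite (_ : upd _ _ _ = GVar) ?h //; apply: funext => z; rewrite /upd; case: eqP => // ->.
Qed.

Lemma gsub_agree fr d s s' a : normalg a -> (forall x, x \in fvg a -> s x = s' x) ->
  gsub fr d s a = gsub fr d s' a.
Proof.
elim: a d s s' => //=.
- by move=> x d s s' _ ->; rewrite ?inE.
- move=> a ha b hb d s s' /andP[na nb] h; congr GCup; [apply: ha | apply: hb] => // x xa; apply: h;
    by rewrite mem_cat xa ?orbT.
- move=> a ha b hb d s s' /andP[na nb] h; congr GCap; [apply: ha | apply: hb] => // x xa; apply: h;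
    by rewrite mem_cat xa ?orbT.
- move=> a ha b hb d s s' /andP[na nb] h; congr GSeq; [apply: ha | apply: hb] => // x xa; apply: h;
    by rewrite mem_cat xa ?orbT.
- move=> x a ha d s s' /andP[na _] h; congr GMu; apply: ha => // z za; rewrite /upd; case: eqVneq => // zx.
  by rewrite h // mem_filter zx.
- move=> x a ha d s s' /andP[na _] h; congr GNu; apply: ha => // z za; rewrite /upd; case: eqVneq => // zx.
  by rewrite h // mem_filter zx.
Qed.

Lemma ssub_closed s a : normalg a -> nilp (fvg a) -> ssub s a = a.
Proof. by move=> na ca; rewrite -[RHS]ssub_var; apply: gsub_agree => // x; rewrite (nilP ca). Qed.

Lemma dual_gsub fr d s a : dual (gsub fr d s a) = gsub fr d (fun x => dual (s x)) (dual a).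
Proof.
have updE x z : (fun y => dual (upd s x (GVar z) y)) = upd (fun y => dual (s y)) x (GVar z).
  by apply: funext => y; rewrite /upd; case: eqP.
elim: a d s updE => //= [a ha b hb|a ha b hb|a ha b hb|x a h|x a h] d s updE; rewrite ?ha ?hb ?h ?updE //;
  by move=> y z; apply: funext => y'; rewrite /upd; do !case: eqP.
Qed.

Lemma substg_ssub x c s a : normalg a -> (forall z, nilp (fvg (s z)) \/ s z = GVar z) ->
  substg x c (ssub s a) = ssub (fun z => substg x c (s z)) a.
Proof.
elim: a s => //=.
- by move=> p s /andP[_ cp] _; rewrite substf_closed.
- by move=> p s /andP[_ cp] _; rewrite substf_closed.
- by move=> a ha b hb s /andP[na nb] hs; rewrite ha ?hb.
- by move=> a ha b hb s /andP[na nb] hs; rewrite ha ?hb.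
- by move=> a ha b hb s /andP[na nb] hs; rewrite ha ?hb.
- move=> z a h s /andP[na _] hs; rewrite !(ssub_depth 1 0); case: eqP => [->|/eqP zx].
    congr (GMu _ (ssub _ _)); apply: funext => z'; rewrite /upd; case: eqVneq => // z'x.
    by case: (hs z') => [/nilP e|->]; [rewrite (subst_id x c).2 // e | rewrite /= (negbTE z'x)].
  rewrite h //; last by move=> z'; rewrite /upd; case: eqP => // ->; right.
  congr (GMu _ (ssub _ _)); apply: funext => z'; rewrite /upd; case: eqVneq => // _ /=.
  by rewrite (negbTE zx).
- move=> z a h s /andP[na _] hs; rewrite !(ssub_depth 1 0); case: eqP => [->|/eqP zx].
    congr (GNu _ (ssub _ _)); apply: funext => z'; rewrite /upd; case: eqVneq => // z'x.
    by case: (hs z') => [/nilP e|->]; [rewrite (subst_id x c).2 // e | rewrite /= (negbTE z'x)].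
  rewrite h //; last by move=> z'; rewrite /upd; case: eqP => // ->; right.
  congr (GNu _ (ssub _ _)); apply: funext => z'; rewrite /upd; case: eqVneq => // _ /=.
  by rewrite (negbTE zx).
Qed.

End Syntax.

(** * Algebraic semantics of right-linear games *)

Section Semantics.
Variables (Prp Act : Type) (B : balg) (dia : Act -> B -> B) (v : Prp -> B).
Notation formula := (formula Prp Act).
Notation game := (game Prp Act).
Implicit Types (p q : formula) (a b : game) (x z : nat) (y : nat -> B -> B) (k c : B).

(* The value of a game at a continuation [k]. Since a bound variable of a
   right-linear game is only reached with the continuation of its binder,
   fixpoints are taken over constants. Tests are closed, so their free variables
   may be interpreted by the identity. *)
Fixpoint lf p : B :=
  match p with
  | FProp P => v P
  | FNProp P => bneg (v P)
  | FOr p q => lf p ⊔ lf q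
  | FAnd p q => lf p ⊓ lf q
  | FDia a p => lg a (fun _ => id) (lf p)
  end
with lg a y k : B :=
  match a with
  | GAct a => dia a k
  | GActD a => bneg (dia a (bneg k))
  | GVar x => y x k
  | GVarD x => bneg (y x (bneg k))
  | GTest p => lf p ⊓ k
  | GTestD p => bneg (lf p) ⊔ k
  | GCup a b => lg a y k ⊔ lg b y k
  | GCap a b => lg a y k ⊓ lg b y k
  | GSeq a b => lg a y (lg b y k)
  | GMu x a => lfpB (fun c => lg a (upd y x (fun=> c)) k)
  | GNu x a => gfpB (fun c => lg a (upd y x (fun=> c)) k)
  end.

Definition cenv (y : nat -> B) : nat -> B -> B := fun x _ => y x.

Lemma cenv_upd (y : nat -> B) x c : cenv (upd y x c) = upd (cenv y) x (fun=> c).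
Proof. by apply: funext => z; rewrite /cenv /upd; case: eqP. Qed.

Lemma neg_meet c k : bneg (c ⊓ k) = bneg c ⊔ bneg k.
Proof. by rewrite /bjoin !bnegK. Qed.

Lemma neg_join c k : bneg (c ⊔ k) = bneg c ⊓ bneg k.
Proof. by rewrite /bjoin !bnegK. Qed.

Lemma ldual : (forall p, lf (compl p) = bneg (lf p)) /\
  (forall a y k, lg (dual a) (fun x => fdual (y x)) (bneg k) = bneg (lg a y k)).
Proof.
apply: syntax_ind => //=.
- by move=> P; rewrite bnegK.
- by move=> p -> q ->; rewrite neg_join.
- by move=> p -> q ->; rewrite neg_meet.
- move=> a ha p ->; rewrite -ha; congr lg; apply: funext => _.
  by apply: funext => k; rewrite /fdual bnegK.
- by move=> a y k; rewrite bnegK.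
- by move=> a y k; rewrite bnegK.
- by move=> x y k; rewrite /fdual bnegK.
- by move=> x y k; rewrite /fdual !bnegK.
- by move=> p hp y k; rewrite neg_meet.
- by move=> p hp y k; rewrite neg_join bnegK.
- by move=> a ha b hb y k; rewrite ha hb neg_join.
- by move=> a ha b hb y k; rewrite ha hb neg_meet.
- by move=> a ha b hb y k; rewrite hb ha.
- move=> x a ha y k; rewrite -gfp_dual; congr gfpB; apply: funext => c.
  rewrite /fdual -ha; congr lg; apply: funext => z; rewrite /upd; case: eqP => // _.
  by apply: funext => k'; rewrite /fdual bnegK.
- move=> x a ha y k; rewrite -lfp_dual; congr lfpB; apply: funext => c.
  rewrite /fdual -ha; congr lg; apply: funext => z; rewrite /upd; case: eqP => // _.
  by apply: funext => k'; rewrite /fdual bnegK.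
Qed.

Lemma lf_compl p : lf (compl p) = bneg (lf p).
Proof. exact: ldual.1. Qed.

Lemma lg_dual a y k : lg (dual a) (fun x => fdual (y x)) (bneg k) = bneg (lg a y k).
Proof. exact: ldual.2. Qed.

(** In a right-linear game a free variable is evaluated only at the continuation [k] itself, or at
    its complement for an occurrence [x^d]: the first part of a sequence has no free variables. *)
Lemma lg_ext a y y' k : gok a ->
  (forall x, x \in fvg a -> y x k = y' x k) ->
  (forall x, x \in dfvg a -> y x (bneg k) = y' x (bneg k)) -> lg a y k = lg a y' k.
Proof.
rewrite /gok; elim: a y y' k => //=.
- by move=> x y y' k _ h _; apply: h; rewrite inE.
- by move=> x y y' k _ _ h; congr bneg; apply: h; rewrite inE.
- move=> a ha b hb y y' k /andP[/andP[na nb] /andP[ra rb]] h h'.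
  congr bjoin; [apply: ha | apply: hb]; rewrite ?na ?nb // => x xa;
    first [by apply: h; rewrite mem_cat xa ?orbT | by apply: h'; rewrite mem_cat xa ?orbT].
- move=> a ha b hb y y' k /andP[/andP[na nb] /andP[ra rb]] h h'.
  congr bmeet; [apply: ha | apply: hb]; rewrite ?na ?nb // => x xa;
    first [by apply: h; rewrite mem_cat xa ?orbT | by apply: h'; rewrite mem_cat xa ?orbT].
- move=> a ha b hb y y' k /andP[/andP[na nb] /and3P[ra rb /nilP ca]] h h'.
  have -> : lg b y k = lg b y' k.
    apply: hb; rewrite ?nb // => x xa; first by apply: h; rewrite mem_cat xa orbT.
    by apply: h'; rewrite mem_cat xa orbT.
  apply: ha; rewrite ?na //; first by rewrite ca.
  by move=> x /(dfv_fv _ _).2; rewrite ca.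
- move=> x a ha y y' k /andP[/andP[na xa] ra] h h'; congr lfpB; apply: funext => c.
  apply: ha => [|z za|z za]; first by rewrite na.
    by rewrite /upd; case: eqVneq => // zx; rewrite h // mem_filter zx.
  by rewrite /upd; case: eqVneq => // zx; rewrite h' // mem_filter zx.
- move=> x a ha y y' k /andP[/andP[na xa] ra] h h'; congr gfpB; apply: funext => c.
  apply: ha => [|z za|z za]; first by rewrite na.
    by rewrite /upd; case: eqVneq => // zx; rewrite h // mem_filter zx.
  by rewrite /upd; case: eqVneq => // zx; rewrite h' // mem_filter zx.
Qed.

Lemma lg_agree a y y' k : normalg a -> (forall x, x \in fvg a -> y x = y' x) -> lg a y k = lg a y' k.
Proof.
elim: a y y' k => //=.
- by move=> x y y' k _ ->; rewrite ?inE.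
- by move=> x y y' k _ ->; rewrite ?inE.
- move=> a ha b hb y y' k /andP[na nb] h.
  by rewrite (ha y y') ?(hb y y') // => x xa; rewrite h // mem_cat xa ?orbT.
- move=> a ha b hb y y' k /andP[na nb] h.
  by rewrite (ha y y') ?(hb y y') // => x xa; rewrite h // mem_cat xa ?orbT.
- move=> a ha b hb y y' k /andP[na nb] h.
  by rewrite (ha y y') ?(hb y y') // => x xa; rewrite h // mem_cat xa ?orbT.
- move=> x a ha y y' k /andP[na xa] h; congr lfpB; apply: funext => c.
  by apply: ha => // z za; rewrite /upd; case: eqVneq => // zx; rewrite h // mem_filter zx.
- move=> x a ha y y' k /andP[na xa] h; congr gfpB; apply: funext => c.
  by apply: ha => // z za; rewrite /upd; case: eqVneq => // zx; rewrite h // mem_filter zx.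
Qed.

Lemma lg_closed a y y' k : normalg a -> nilp (fvg a) -> lg a y k = lg a y' k.
Proof. by move=> na /nilP ca; apply: lg_agree => // x; rewrite ca. Qed.

Lemma lg_upd_const a y x (u : B -> B) k : gok a -> x \notin dfvg a ->
  lg a (upd y x u) k = lg a (upd y x (fun=> u k)) k.
Proof.
move=> oka xa; apply: lg_ext => // z zf; rewrite /upd; case: eqP => // zx.
by rewrite -zx zf in xa.
Qed.

(* Capture-avoiding substitution with the fresh binders d, d+1, ... *)
Lemma lg_gsub d (s : nat -> game) a y k : normalg a -> nilp (dfvg a) ->
  (forall x, normalg (s x)) ->
  (forall x z, x \in fvg a -> z \in fvg (s x) -> z < d) ->
  lg (gsub (fun d _ => d) d s a) y k = lg a (fun x => lg (s x) y) k.
Proof.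
elim: a d s y k => //=.
- move=> a ha b hb d s y k /andP[na nb]; rewrite cat_nilp => /andP[da db] hs fr.
  by rewrite ha ?hb // => x z xa; apply: (fr x z); rewrite mem_cat xa ?orbT.
- move=> a ha b hb d s y k /andP[na nb]; rewrite cat_nilp => /andP[da db] hs fr.
  by rewrite ha ?hb // => x z xa; apply: (fr x z); rewrite mem_cat xa ?orbT.
- move=> a ha b hb d s y k /andP[na nb]; rewrite cat_nilp => /andP[da db] hs fr.
  by rewrite ha ?hb // => x z xa; apply: (fr x z); rewrite mem_cat xa ?orbT.
- move=> x a ha d s y k /andP[na xa] /(dfvg_nil_body xa) da hs fr; congr lfpB; apply: funext => c.
  rewrite ha //; first last.
  + move=> x' z x'a; rewrite /upd; case: eqVneq => [_|xx' zs]; first by rewrite inE => /eqP->.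
    by apply/ltnW/(fr x') => //; rewrite mem_filter xx'.
  + by move=> x'; rewrite /upd; case: eqP.
  apply: lg_agree => // x' x'a; apply: funext => k'; rewrite {1 3}/upd; case: eqVneq => [_ /=|xx'].
    by rewrite upd_same.
  apply: lg_agree => // z zs; rewrite upd_ne // neq_ltn; apply/orP; left.
  by apply: (fr x'); rewrite ?mem_filter ?xx'.
- move=> x a ha d s y k /andP[na xa] /(dfvg_nil_body xa) da hs fr; congr gfpB; apply: funext => c.
  rewrite ha //; first last.
  + move=> x' z x'a; rewrite /upd; case: eqVneq => [_|xx' zs]; first by rewrite inE => /eqP->.
    by apply/ltnW/(fr x') => //; rewrite mem_filter xx'.
  + by move=> x'; rewrite /upd; case: eqP.
  apply: lg_agree => // x' x'a; apply: funext => k'; rewrite {1 3}/upd; case: eqVneq => [_ /=|xx'].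
    by rewrite upd_same.
  apply: lg_agree => // z zs; rewrite upd_ne // neq_ltn; apply/orP; left.
  by apply: (fr x'); rewrite ?mem_filter ?xx'.
Qed.

Lemma lg_substg x b a y k : normalg a -> normalg b -> x \notin dfvg a -> free_for b x a ->
  lg (substg x b a) y k = lg a (upd y x (lg b y)) k.
Proof.
move=> + nb; elim: a y k => //=.
- by move=> z y k _ _ _; rewrite /upd; case: eqP.
- by move=> z y k _; rewrite inE /upd eq_sym => /negbTE->.
- by move=> p y k /andP[_ cp] _ _; rewrite substf_closed.
- by move=> p y k /andP[_ cp] _ _; rewrite substf_closed.
- move=> a ha c hc y k /andP[na nc]; rewrite mem_cat negb_or => /andP[xa xc] /andP[fa fc].
  by rewrite ha ?hc.
- move=> a ha c hc y k /andP[na nc]; rewrite mem_cat negb_or => /andP[xa xc] /andP[fa fc].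
  by rewrite ha ?hc.
- move=> a ha c hc y k /andP[na nc]; rewrite mem_cat negb_or => /andP[xa xc] /andP[fa fc].
  by rewrite ha ?hc.
- move=> z a ha y k /andP[na za]; rewrite !mem_filter.
  case: (eqVneq z x) => [->|zx] /=.
    move=> _ _; congr lfpB; apply: funext => c; congr lg; apply: funext => w.
    by rewrite /upd; case: eqP.
  move=> xa /orP[xf|/andP[zb fa]]; congr lfpB; apply: funext => c.
    rewrite (subst_id x b).2 //; apply: lg_agree => // w wa; rewrite /upd; case: eqP => // _.
    by case: eqVneq wa xf => // -> ->.
  rewrite ha //; apply: lg_agree => // w wa; apply: funext => k'; rewrite /upd.
  case: eqVneq => [->|wx]; last by [].
  by rewrite eq_sym (negbTE zx); apply: lg_agree => // u ub; case: eqVneq ub zb => // -> ->.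
- move=> z a ha y k /andP[na za]; rewrite !mem_filter.
  case: (eqVneq z x) => [->|zx] /=.
    move=> _ _; congr gfpB; apply: funext => c; congr lg; apply: funext => w.
    by rewrite /upd; case: eqP.
  move=> xa /orP[xf|/andP[zb fa]]; congr gfpB; apply: funext => c.
    rewrite (subst_id x b).2 //; apply: lg_agree => // w wa; rewrite /upd; case: eqP => // _.
    by case: eqVneq wa xf => // -> ->.
  rewrite ha //; apply: lg_agree => // w wa; apply: funext => k'; rewrite /upd.
  case: eqVneq => [->|wx]; last by [].
  by rewrite eq_sym (negbTE zx); apply: lg_agree => // u ub; case: eqVneq ub zb => // -> ->.
Qed.

Section Monotone.
Hypothesis dia_mono : forall e : Act, monof (dia e).
Variable E : (B -> B) -> Prop.
Hypothesis E_mono : forall u, E u -> monof u.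
Hypothesis E_const : forall c, E (fun=> c).
Hypothesis E_dual : forall u, E u -> E (fdual u).
Variable P : game -> Prop.
Hypothesis P_lfp : forall x a y k, P a -> (forall z, E (y z)) ->
  monof (fun c => lg a (upd y x (fun=> c)) k) -> haslfp (fun c => lg a (upd y x (fun=> c)) k).
Hypothesis P_sub : forall a, P a -> match a with
  | GCup b c | GCap b c | GSeq b c => P b /\ P c
  | GMu x b | GNu x b => P b /\ x \notin dfvg b
  | _ => True end.
Hypothesis P_dual : forall a, P a -> P (dual a).

Lemma upd_E y x u : (forall z, E (y z)) -> E u -> forall z, E (upd y x u z).
Proof. by move=> Ey Eu z; rewrite /upd; case: eqP. Qed.

Lemma P_gfp x a y k : P a -> (forall z, E (y z)) ->
  monof (fun c => lg a (upd y x (fun=> c)) k) -> haslfp (fdual (fun c => lg a (upd y x (fun=> c)) k)).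
Proof.
move=> Pa Ey mo.
have e : fdual (fun c => lg a (upd y x (fun=> c)) k) =
    fun c => lg (dual a) (upd (fun z => fdual (y z)) x (fun=> c)) (bneg k).
  apply: funext => c; rewrite /fdual -lg_dual; congr lg; apply: funext => z; rewrite /upd; case: eqP => // _.
  by apply: funext => k'; rewrite /fdual bnegK.
have := fdual_mono mo; rewrite e => mo'.
by apply: P_lfp => //; [exact: P_dual | move=> z; exact: E_dual].
Qed.

(** The class [E] allows two uses: constant maps in the algebra of formulas, where fixpoints are
    known for definable maps only, and monotone maps in powerset algebras. [P_lfp] may assume the
    monotonicity that the induction provides. *)
Lemma lg_mono a y y' k k' : P a -> (forall x, E (y x)) -> (forall x, E (y' x)) ->
  (forall x c, y x c <<= y' x c) -> (forall x, x \in dfvg a -> y x = y' x) -> k <<= k' ->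
  lg a y k <<= lg a y' k'.
Proof.
elim: a y y' k k' => //=.
- by move=> a y y' k k' *; exact: dia_mono.
- by move=> a y y' k k' _ _ _ _ _ kk; apply: le_neg; apply: dia_mono; exact: le_neg.
- by move=> x y y' k k' _ Ey Ey' yy _ kk; apply: ble_trans (yy x k) _; exact: E_mono.
- move=> x y y' k k' _ Ey Ey' yy dd kk; rewrite dd ?inE //.
  by apply: le_neg; apply: E_mono => //; exact: le_neg.
- by move=> *; exact: meet_mono.
- by move=> *; exact: join_mono.
- move=> a ha b hb y y' k k' /P_sub[Pa Pb] Ey Ey' yy dd kk; apply: join_mono.
    by apply: ha => // x xa; apply: dd; rewrite mem_cat xa.
  by apply: hb => // x xa; apply: dd; rewrite mem_cat xa orbT.
- move=> a ha b hb y y' k k' /P_sub[Pa Pb] Ey Ey' yy dd kk; apply: meet_mono.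
    by apply: ha => // x xa; apply: dd; rewrite mem_cat xa.
  by apply: hb => // x xa; apply: dd; rewrite mem_cat xa orbT.
- move=> a ha b hb y y' k k' /P_sub[Pa Pb] Ey Ey' yy dd kk.
  apply: ha => //; first by move=> x xa; apply: dd; rewrite mem_cat xa.
  by apply: hb => // x xa; apply: dd; rewrite mem_cat xa orbT.
- move=> x a ha y y' k k' /P_sub[Pa xa] Ey Ey' yy dd kk.
  have mo (z : nat -> B -> B) l : (forall w, E (z w)) -> monof (fun c => lg a (upd z x (fun=> c)) l).
    move=> Ez c c' cc; apply: ha => //; try exact: upd_E.
      by move=> w d; rewrite /upd; case: eqP.
    by move=> w wa; rewrite /upd; case: eqP wa xa => // -> ->.
  apply: lfp_mono; try by apply: P_lfp => //; exact: mo.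
  move=> c; apply: ha => //; try exact: upd_E.
    by move=> w d; rewrite /upd; case: eqP.
  by move=> w wa; rewrite /upd; case: eqVneq => // wx; apply: dd; rewrite mem_filter wx.
- move=> x a ha y y' k k' /P_sub[Pa xa] Ey Ey' yy dd kk.
  have mo (z : nat -> B -> B) l : (forall w, E (z w)) -> monof (fun c => lg a (upd z x (fun=> c)) l).
    move=> Ez c c' cc; apply: ha => //; try exact: upd_E.
      by move=> w d; rewrite /upd; case: eqP.
    by move=> w wa; rewrite /upd; case: eqP wa xa => // -> ->.
  apply: gfp_mono; try by apply: P_gfp => //; exact: mo.
  move=> c; apply: ha => //; try exact: upd_E.
    by move=> w d; rewrite /upd; case: eqP.
  by move=> w wa; rewrite /upd; case: eqVneq => // wx; apply: dd; rewrite mem_filter wx.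
Qed.

End Monotone.
End Semantics.

(** * Formulas as equation systems *)

Section Compile.
Variables Prp Act : Type.
Notation formula := (formula Prp Act).
Notation game := (game Prp Act).

(* One less than the number of states. *)
Fixpoint ft (p : formula) : nat :=
  match p with
  | FOr p q | FAnd p q => (ft p).+1 + (ft q).+1
  | FDia a p => (ft p).+1 + gt a
  | _ => 0 end
with gt (a : game) : nat :=
  match a with
  | GTest p | GTestD p => (ft p).+1
  | GCup a b | GCap a b => (gt a).+1 + (gt b).+1
  | GSeq a b => (gt b).+1 + gt a
  | GMu _ a | GNu _ a => (gt a).+1
  | _ => 0 end.

Variable r : nat.
Notation node := (vnode (Prp * bool) Act r.+1 * bool)%type.
Notation ref := (@inord r).
Implicit Types (s : bool) (n k : nat) (e : nat -> nat) (l : seq node).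

Definition nconj s n k : node := ((if s then NAnd else NOr) (ref n) (ref k), true).
Definition nmodal s (a : Act) k : node := ((if s then NDia else NBox) a (ref k), true).

(* The states of [p], or of its complement if [~~ s], numbered from [n] with the
   root last. The continuation state [k] precedes the states of a game and the
   variables refer to later states, so that inner fixpoints have smaller
   indices. *)
Fixpoint cf s (p : formula) n : seq node :=
  match p with
  | FProp P => [:: (NLit (P, s), true)]
  | FNProp P => [:: (NLit (P, ~~ s), true)]
  | FOr p q => cf s p n ++ (cf s q (n + (ft p).+1) ++
      [:: nconj (~~ s) (n + ft p) (n + (ft p).+1 + ft q)])
  | FAnd p q => cf s p n ++ (cf s q (n + (ft p).+1) ++
      [:: nconj s (n + ft p) (n + (ft p).+1 + ft q)])
  | FDia a p => cf s p n ++ cg s a (n + (ft p).+1) (fun=> r.+1) (n + ft p)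
  end
with cg s (a : game) n e k : seq node :=
  match a with
  | GAct a => [:: nmodal s a k]
  | GActD a => [:: nmodal (~~ s) a k]
  | GVar x | GVarD x => [:: (NCopy (ref (e x)), true)]
  | GTest p => cf s p n ++ [:: nconj s (n + ft p) k]
  | GTestD p => cf (~~ s) p n ++ [:: nconj (~~ s) (n + ft p) k]
  | GCup a b => cg s a n e k ++ (cg s b (n + (gt a).+1) e k ++
      [:: nconj (~~ s) (n + gt a) (n + (gt a).+1 + gt b)])
  | GCap a b => cg s a n e k ++ (cg s b (n + (gt a).+1) e k ++
      [:: nconj s (n + gt a) (n + (gt a).+1 + gt b)])
  | GSeq a b => cg s b n e k ++ cg s a (n + (gt b).+1) e (n + gt b)
  | GMu x a => cg s a n (upd e x (n + (gt a).+1)) k ++ [:: (NCopy (ref (n + gt a)), s)]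
  | GNu x a => cg s a n (upd e x (n + (gt a).+1)) k ++ [:: (NCopy (ref (n + gt a)), ~~ s)]
  end.

Lemma size_c : (forall p s n, size (cf s p n) = (ft p).+1) /\
  (forall a s n e k, size (cg s a n e k) = (gt a).+1).
Proof.
apply: syntax_ind => //=.
- by move=> p hp q hq s n; rewrite !size_cat hp hq /=; lia.
- by move=> p hp q hq s n; rewrite !size_cat hp hq /=; lia.
- by move=> a ha p hp s n; rewrite size_cat hp ha; lia.
- by move=> p hp s n e k; rewrite size_cat hp /=; lia.
- by move=> p hp s n e k; rewrite size_cat hp /=; lia.
- by move=> a ha b hb s n e k; rewrite !size_cat ha hb /=; lia.
- by move=> a ha b hb s n e k; rewrite !size_cat ha hb /=; lia.
- by move=> a ha b hb s n e k; rewrite !size_cat ha hb /=; lia.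
- by move=> x a ha s n e k; rewrite size_cat ha /=; lia.
- by move=> x a ha s n e k; rewrite size_cat ha /=; lia.
Qed.

Definition copy_flag (nd : node) : bool :=
  nd.2 || match nd.1 with NCopy _ => true | _ => false end.

Lemma copy_c : (forall p s n, all copy_flag (cf s p n)) /\
  (forall a s n e k, all copy_flag (cg s a n e k)).
Proof.
apply: syntax_ind => //=.
- by move=> p hp q hq s n; rewrite !all_cat hp hq.
- by move=> p hp q hq s n; rewrite !all_cat hp hq.
- by move=> a ha p hp s n; rewrite all_cat hp ha.
- by move=> p hp s n e k; rewrite all_cat hp.
- by move=> p hp s n e k; rewrite all_cat hp.
- by move=> a ha b hb s n e k; rewrite !all_cat ha hb.
- by move=> a ha b hb s n e k; rewrite !all_cat ha hb.
- by move=> a ha b hb s n e k; rewrite !all_cat ha hb.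
- by move=> x a ha s n e k; rewrite all_cat ha /= /copy_flag orbT.
- by move=> x a ha s n e k; rewrite all_cat ha /= /copy_flag orbT.
Qed.

Variables (K : kozen Act) (v : Prp -> K).
Definition plit (l : Prp * bool) : K := if l.2 then v l.1 else bneg (v l.1).
Variable h : hes K.
Hypothesis good : hes_good h.
Notation lf := (lf (@kdia Act K) v).
Notation lg := (lg (@kdia Act K) v).

Definition placed n l := forall nd l1 l2, l = l1 ++ nd :: l2 ->
  (forall y, hfun h (n + size l1) y = nfun plit nd.1 y) /\ hmu h (n + size l1) = nd.2.

Lemma placed_cat n l1 l2 : placed n (l1 ++ l2) -> placed n l1 /\ placed (n + size l1) l2.
Proof.
move=> pl; split=> nd m1 m2 e.
  by apply: (pl nd m1 (m2 ++ l2)); rewrite e -catA.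
by rewrite -addnA -size_cat; apply: (pl nd (l1 ++ m1) m2); rewrite e catA.
Qed.

Lemma placed1 n nd : placed n [:: nd] -> (forall y, hfun h n y = nfun plit nd.1 y) /\ hmu h n = nd.2.
Proof. by move=> /(_ nd [::] [::] erefl); rewrite addn0. Qed.

Definition sdf s (p : formula) := if s then p else compl p.
Definition sdg s (a : game) := if s then a else dual a.

Definition isol n (y : nat -> K) := sol h n y = y.

Lemma isol_le n n' y : n <= n' -> isol n' y -> isol n y.
Proof. by move=> nn e; rewrite /isol -e sol_idem. Qed.

Lemma isolE n i y : i < n -> isol n y -> y i = hfun h i y.
Proof. by move=> ni e; rewrite -{1}e sol_lt // e. Qed.

(** The continuation precedes the states of the game and is thus formally solved inside its
    fixpoints. With [J] beyond the game this says that it does not refer to them. *)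
Definition indep n k J := forall z z', isol n z -> isol n z' ->
  (forall i, J <= i -> z i = z' i) -> z k = z' k.

Lemma indep_mono n n' k J J' : n <= n' -> J' <= J -> indep n k J -> indep n' k J'.
Proof.
move=> nn JJ ik z z' sz sz' zz; apply: ik; try exact: isol_le nn _.
by move=> i Ji; apply: zz; exact: leq_trans JJ Ji.
Qed.

Lemma nconj_val s n k y : n < r.+1 -> k < r.+1 ->
  nfun plit (nconj s n k).1 y = if s then y n ⊓ y k else y n ⊔ y k.
Proof. by move=> nr kr; case: s; rewrite /= !inordK. Qed.

(** The body reaches its binder through the copy node [n + m.+1] only. Letting that component range
    over [c] yields the map whose fixpoint is taken; by [indep] the continuation stays the same
    meanwhile. *)
Lemma binder_val (G : (nat -> K -> K) -> K -> K) n m e k x y b :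
  k < n -> n + m.+1 <= r -> (forall z, n + m.+1 < e z) ->
  indep n k (n + m.+1).+1 -> isol (n + m.+1).+1 y ->
  placed (n + m.+1) [:: (NCopy (ref (n + m)), b)] ->
  (forall z, isol (n + m).+1 z -> z (n + m) = G (cenv (fun w => z (upd e x (n + m.+1) w))) (z k)) ->
  y (n + m.+1) = if b then lfpB (fun c => G (upd (cenv (fun w => y (e w))) x (fun=> c)) (y k))
                 else gfpB (fun c => G (upd (cenv (fun w => y (e w))) x (fun=> c)) (y k)).
Proof.
move=> kn nr ex ik sy /placed1[hE muE] hz.
have E c : lev h (n + m.+1) y c = G (upd (cenv (fun w => y (e w))) x (fun=> c)) (y k).
  rewrite /lev hE /= inordK; last by lia.
  set z := sol h _ _; have sz : isol (n + m.+1) z by rewrite /isol /z sol_idem.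
  rewrite hz; last by rewrite -addnS.
  have zE i : n + m.+1 <= i -> z i = upd y (n + m.+1) c i by move=> ni; rewrite /z sol_ge.
  congr G.
    rewrite -cenv_upd; congr cenv; apply: funext => w; rewrite {1 2}/upd; case: eqVneq => _.
      by rewrite zE // upd_same.
    by rewrite zE ?(ltnW (ex w)) // upd_ne // neq_ltn ex orbT.
  apply: ik; [apply: isol_le sz; lia | apply: isol_le sy; lia | move=> i ni].
  by rewrite zE ?(ltnW ni) // upd_ne // neq_ltn ni orbT.
rewrite -{1}sy sol_fxp // sy muE /fxp; case: b {muE hE} => /=.
  by congr lfpB; apply: funext => c; rewrite meet_top E.
by congr gfpB; apply: funext => c; rewrite E.
Qed.

Lemma compile_ok :
  (forall p s n y, normalf p -> closedf p -> placed n (cf s p n) -> n + ft p <= r ->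
     isol (n + ft p).+1 y -> y (n + ft p) = lf (sdf s p)) /\
  (forall a s n e k y, normalg a -> nilp (dfvg a) -> placed n (cg s a n e k) -> n + gt a <= r ->
     k < n -> (forall x, n + gt a < e x) -> (forall x, x \in fvg a -> e x <= r) ->
     indep n k (n + gt a).+1 -> isol (n + gt a).+1 y ->
     y (n + gt a) = lg (sdg s a) (cenv (fun x => y (e x))) (y k)).
Proof.
apply: syntax_ind => /=.
- move=> P s n y _ _ /placed1[hE _] nr; rewrite addn0 => /(isolE (ltnSn _)) ->.
  by rewrite hE; case: s {hE}.
- move=> P s n y _ _ /placed1[hE _] nr; rewrite addn0 => /(isolE (ltnSn _)) ->.
  by rewrite hE; case: s {hE}; rewrite //= bnegK.
- move=> p hp q hq s n y /andP[np nq]; rewrite -[closedf _]/(nilp (fvf p ++ fvf q)) cat_nilp => /andP[cp cq].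
  move=> /placed_cat[pp]; rewrite size_c.1 => /placed_cat[pq]; rewrite size_c.1 => /placed1[hE _] nr sy.
  have yp : y (n + ft p) = lf (sdf s p) by apply: hp => //; [lia | apply: isol_le sy; lia].
  have yq : y (n + (ft p).+1 + ft q) = lf (sdf s q) by apply: hq => //; [lia | apply: isol_le sy; lia].
  rewrite (isolE (ltnSn _) sy) addnA hE.
  by rewrite nconj_val ?yp ?yq; [case: s {hE yp yq pp pq} | lia | lia].
- move=> p hp q hq s n y /andP[np nq]; rewrite -[closedf _]/(nilp (fvf p ++ fvf q)) cat_nilp => /andP[cp cq].
  move=> /placed_cat[pp]; rewrite size_c.1 => /placed_cat[pq]; rewrite size_c.1 => /placed1[hE _] nr sy.
  have yp : y (n + ft p) = lf (sdf s p) by apply: hp => //; [lia | apply: isol_le sy; lia].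
  have yq : y (n + (ft p).+1 + ft q) = lf (sdf s q) by apply: hq => //; [lia | apply: isol_le sy; lia].
  rewrite (isolE (ltnSn _) sy) addnA hE.
  by rewrite nconj_val ?yp ?yq; [case: s {hE yp yq pp pq} | lia | lia].
- move=> a ha p hp s n y /andP[na np]; rewrite -[closedf _]/(nilp (fvg a ++ fvf p)) cat_nilp => /andP[ca cp].
  move=> /placed_cat[pp]; rewrite size_c.1 => pa nr sy.
  have py z : isol (n + ft p).+1 z -> z (n + ft p) = lf (sdf s p) by apply: hp => //; lia.
  have da : nilp (dfvg a).
    by case E: (dfvg a) => [//|x t]; have := (dfv_fv _ _).2 a x; rewrite E mem_head (nilP ca) => /(_ isT).
  (* The game is closed and reads no variable; [r.+1] lies beyond all states, as is required of an
     environment. *)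
  rewrite addnA (ha s _ (fun=> r.+1) (n + ft p)) //; try by lia.
  + rewrite py; last by apply: isol_le sy; lia.
    by case: s {pp pa py}; rewrite /=; apply: lg_closed; rewrite ?normalg_dual ?fvg_dual.
  + by move=> x; rewrite (nilP ca).
  + by move=> z z' sz sz' _; rewrite !py //; [move: sz' | move: sz]; apply: isol_le; lia.
  + by apply: isol_le sy; lia.
- move=> a s n e k y _ _ /placed1[hE _] nr kn ex ef ik; rewrite addn0 => /(isolE (ltnSn _)) ->.
  by rewrite hE; case: s {hE} => /=; rewrite inordK //; lia.
- move=> a s n e k y _ _ /placed1[hE _] nr kn ex ef ik; rewrite addn0 => /(isolE (ltnSn _)) ->.
  by rewrite hE; case: s {hE} => /=; rewrite inordK //; lia.
- move=> x s n e k y _ _ /placed1[hE _] nr kn ex ef ik; rewrite addn0 => /(isolE (ltnSn _)) ->.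
  have exr : e x <= r by apply: ef; rewrite inE.
  by rewrite hE; case: s {hE} => /=; rewrite inordK.
- by [].
- move=> p hp s n e k y /andP[np cp] _ /placed_cat[pp]; rewrite size_c.1 => /placed1[hE _] nr kn ex ef ik sy.
  have yp : y (n + ft p) = lf (sdf s p) by apply: hp => //; [lia | apply: isol_le sy; lia].
  rewrite (isolE (ltnSn _) sy) hE nconj_val ?yp; try lia.
  by case: s {hE yp pp} => //=; rewrite lf_compl.
- move=> p hp s n e k y /andP[np cp] _ /placed_cat[pp]; rewrite size_c.1 => /placed1[hE _] nr kn ex ef ik sy.
  have yp : y (n + ft p) = lf (sdf (~~ s) p) by apply: hp => //; [lia | apply: isol_le sy; lia].
  rewrite (isolE (ltnSn _) sy) hE nconj_val ?yp; try lia.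
  by case: s {hE yp pp} => //=; rewrite lf_compl.
- move=> a ha b hb s n e k y /andP[na nb]; rewrite cat_nilp => /andP[da db].
  move=> /placed_cat[pa]; rewrite size_c.2 => /placed_cat[pb]; rewrite size_c.2 => /placed1[hE _] nr kn ex ef ik sy.
  have ya : y (n + gt a) = lg (sdg s a) (cenv (fun x => y (e x))) (y k).
    apply: ha => //; try by lia.
    + by move=> x; have := ex x; lia.
    + by move=> x xa; apply: ef; rewrite mem_cat xa.
    + by apply: indep_mono ik; lia.
    + by apply: isol_le sy; lia.
  have yb : y (n + (gt a).+1 + gt b) = lg (sdg s b) (cenv (fun x => y (e x))) (y k).
    apply: hb => //; try by lia.
    + by move=> x; have := ex x; lia.
    + by move=> x xa; apply: ef; rewrite mem_cat xa orbT.
    + by apply: indep_mono ik; lia.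
    + by apply: isol_le sy; lia.
  rewrite (isolE (ltnSn _) sy) addnA hE.
  by rewrite nconj_val ?ya ?yb; [case: s {hE ya yb pa pb} | lia | lia].
- move=> a ha b hb s n e k y /andP[na nb]; rewrite cat_nilp => /andP[da db].
  move=> /placed_cat[pa]; rewrite size_c.2 => /placed_cat[pb]; rewrite size_c.2 => /placed1[hE _] nr kn ex ef ik sy.
  have ya : y (n + gt a) = lg (sdg s a) (cenv (fun x => y (e x))) (y k).
    apply: ha => //; try by lia.
    + by move=> x; have := ex x; lia.
    + by move=> x xa; apply: ef; rewrite mem_cat xa.
    + by apply: indep_mono ik; lia.
    + by apply: isol_le sy; lia.
  have yb : y (n + (gt a).+1 + gt b) = lg (sdg s b) (cenv (fun x => y (e x))) (y k).
    apply: hb => //; try by lia.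
    + by move=> x; have := ex x; lia.
    + by move=> x xa; apply: ef; rewrite mem_cat xa orbT.
    + by apply: indep_mono ik; lia.
    + by apply: isol_le sy; lia.
  rewrite (isolE (ltnSn _) sy) addnA hE.
  by rewrite nconj_val ?ya ?yb; [case: s {hE ya yb pa pb} | lia | lia].
- move=> a ha b hb s n e k y /andP[na nb]; rewrite cat_nilp => /andP[da db].
  move=> /placed_cat[pb]; rewrite !size_c.2 => pa nr kn ex ef ik sy.
  have yb z : isol (n + gt b).+1 z -> z (n + gt b) = lg (sdg s b) (cenv (fun x => z (e x))) (z k).
    move=> sz; apply: hb => //; try by lia.
    + by move=> x; have := ex x; lia.
    + by move=> x xa; apply: ef; rewrite mem_cat xa orbT.
    + by apply: indep_mono ik; lia.
  rewrite addnA (ha s _ e (n + gt b)) //; try by lia.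
  + rewrite yb; first by case: s {pa pb yb}.
    by apply: isol_le sy; lia.
  + by move=> x; have := ex x; lia.
  + by move=> x xa; apply: ef; rewrite mem_cat xa.
  + move=> z z' sz sz' zz; rewrite !yb; try by [move: sz; apply: isol_le; lia | move: sz'; apply: isol_le; lia].
    have -> : z k = z' k.
      apply: ik; [move: sz | move: sz' |]; try by apply: isol_le; lia.
      by move=> i Ji; apply: zz; lia.
    by have -> : (fun x => z (e x)) = (fun x => z' (e x)) by apply: funext => x; apply: zz; have := ex x; lia.
  + by apply: isol_le sy; lia.
- move=> x a ha s n e k y /andP[na xa] /(dfvg_nil_body xa) da.
  move=> /placed_cat[pa]; rewrite size_c.2 => pb nr kn ex ef ik sy.
  rewrite (@binder_val (lg (sdg s a)) n (gt a) e k x y s) //; first by case: s {pa pb}.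
  move=> z sz; apply: ha => //; try by lia.
  + by move=> w; rewrite /upd; case: eqP => _; [lia | have := ex w; lia].
  + move=> w wa; rewrite /upd; case: eqVneq => [_|wx]; first by lia.
    by apply: ef; rewrite mem_filter wx.
  + by apply: indep_mono ik; lia.
- move=> x a ha s n e k y /andP[na xa] /(dfvg_nil_body xa) da.
  move=> /placed_cat[pa]; rewrite size_c.2 => pb nr kn ex ef ik sy.
  rewrite (@binder_val (lg (sdg s a)) n (gt a) e k x y (~~ s)) //; first by case: s {pa pb}.
  move=> z sz; apply: ha => //; try by lia.
  + by move=> w; rewrite /upd; case: eqP => _; [lia | have := ex w; lia].
  + move=> w wa; rewrite /upd; case: eqVneq => [_|wx]; first by lia.
    by apply: ef; rewrite mem_filter wx.
  + by apply: indep_mono ik; lia.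
Qed.

End Compile.

Section Automaton.
Variables (Prp Act : Type) (p : formula Prp Act).
Notation r := (ft p).
Notation nodes := (cf r true p 0).
Notation dflt := (NCopy (ord0 : 'I_r.+1), true).

Lemma faut_mu (q : 'I_r.+1) : ~~ (nth dflt nodes q).2 -> exists a, (nth dflt nodes q).1 = NCopy a.
Proof.
have := all_nthP dflt ((copy_c Prp Act r).1 p true 0) q.
rewrite (size_c Prp Act r).1 ltn_ord => /(_ isT); rewrite /copy_flag => /orP[->//|].
by case: (nth _ _ _).1 => // a _ _; exists a.
Qed.

Definition faut : vaut (Prp * bool) Act :=
  @Vaut (Prp * bool) Act r.+1 (fun q => (nth dflt nodes q).1) (fun n => (nth dflt nodes n).2) faut_mu.

Lemma faut_sol (K : kozen Act) (v : Prp -> K) y : normalf p -> closedf p ->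
  sol (vhes (plit v) faut) r.+1 y r = lf (@kdia Act K) v p.
Proof.
move=> np cp; have gd := hes_def_good (vhes_def (plit v) faut).
have := (@compile_ok Prp Act r K v _ gd).1 p true 0 (sol (vhes (plit v) faut) r.+1 y) np cp.
rewrite add0n; apply => //; last by rewrite /isol sol_idem.
move=> nd l1 l2 e; have lt : size l1 < r.+1.
  have := (@size_c Prp Act r).1 p true 0; rewrite e size_cat /=; lia.
have nthE : nth dflt nodes (size l1) = nd by rewrite e nth_cat ltnn subnn.
rewrite add0n; split; last by rewrite /= nthE.
by move=> z; have := vhesE (plit v) (V := faut) (Ordinal lt) z; rewrite /= => ->; rewrite nthE.
Qed.

End Automaton.

(** * The Lindenbaum algebra *)

Section Provability.
Variables (Prp Act : Type) (P0 : Prp) (Ax : formula Prp Act -> Prop).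
Hypothesis Ax_rlGL : forall p, axiom_rlGL p -> Ax p.
Notation formula := (formula Prp Act).
Notation game := (game Prp Act).
Implicit Types (p q t : formula) (a b : game).
Notation prov := (provable P0 Ax).
Notation imp p q := (prov (FImp p q)).

Lemma rlGL_compl p : rlGL (compl p) = rlGL p.
Proof. by rewrite /rlGL normalf_compl rlinf_compl. Qed.

Lemma rlGL_or p q : rlGL (FOr p q) = rlGL p && rlGL q.
Proof. by rewrite /rlGL /= andbACA. Qed.

Lemma rlGL_and p q : rlGL (FAnd p q) = rlGL p && rlGL q.
Proof. by rewrite /rlGL /= andbACA. Qed.

Lemma rlGL_dia a p : rlGL (FDia a p) = gok a && rlGL p.
Proof. by rewrite /rlGL /gok /= andbACA. Qed.

Lemma rlGL_imp p q : rlGL (FImp p q) = rlGL p && rlGL q.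
Proof. by rewrite /FImp rlGL_or rlGL_compl. Qed.

Lemma closedf_bin (s t : seq nat) : nilp (s ++ t) = nilp s && nilp t.
Proof. exact: cat_nilp. Qed.

Lemma fok_compl p : fok (compl p) = fok p.
Proof. by rewrite /fok /closedf rlGL_compl fvf_compl. Qed.

Lemma fok_or p q : fok (FOr p q) = fok p && fok q.
Proof. by rewrite /fok rlGL_or andbACA; congr (_ && _); exact: closedf_bin. Qed.

Lemma fok_and p q : fok (FAnd p q) = fok p && fok q.
Proof. by rewrite /fok rlGL_and andbACA; congr (_ && _); exact: closedf_bin. Qed.

Lemma fok_dia a p : fok (FDia a p) = [&& gok a, nilp (fvg a) & fok p].
Proof.
rewrite /fok rlGL_dia (_ : closedf (FDia a p) = nilp (fvg a) && closedf p); last exact: closedf_bin.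
by rewrite andbACA -andbA andbCA.
Qed.

Lemma fok_bot : fok (FBot Act P0). Proof. by []. Qed.
Lemma fok_top : fok (FTop Act P0). Proof. by []. Qed.

Lemma fok_rlGL p : fok p -> rlGL p. Proof. by case/andP. Qed.

Lemma provable_ok p : prov p -> rlGL p.
Proof. by case. Qed.

Lemma prov_taut p : tautology p -> rlGL p -> prov p.
Proof. by move=> tp rp; apply: prv_ax => //; apply: Ax_rlGL; exact: ax_taut. Qed.

Lemma prov_taut1 p t : prov p -> rlGL t -> tautology (FImp p t) -> prov t.
Proof.
move=> pp rt tt; apply: (prv_mp pp _ rt); apply: prov_taut => //.
by rewrite rlGL_imp rt (provable_ok pp).
Qed.

Lemma prov_taut2 p q t : prov p -> prov q -> rlGL t -> tautology (FImp p (FImp q t)) -> prov t.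
Proof.
move=> pp pq rt tt; apply: (prv_mp pq _ rt); apply: (prov_taut1 pp _ tt).
by rewrite rlGL_imp rt (provable_ok pq).
Qed.

Ltac taut := let w := fresh in let wc := fresh in let wo := fresh in let wa := fresh in
  intros w wc wo wa; rewrite /FIff /FImp !(wc, wo, wa);
  repeat match goal with |- context [w ?p] => case: (w p) end; by [].

Lemma imp_rlGL p q : imp p q -> rlGL p /\ rlGL q.
Proof. by move=> /provable_ok; rewrite rlGL_imp => /andP. Qed.

Lemma imp_refl p : rlGL p -> imp p p.
Proof. by move=> rp; apply: prov_taut; [taut | rewrite rlGL_imp rp]. Qed.

Lemma imp_trans q p t : imp p q -> imp q t -> imp p t.
Proof.
move=> pq qt; have [rp _] := imp_rlGL pq; have [_ rt] := imp_rlGL qt.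
by apply: (prov_taut2 pq qt); [rewrite rlGL_imp rp | taut].
Qed.

Lemma imp_and p q t : rlGL p -> rlGL q -> imp t (FAnd p q) <-> imp t p /\ imp t q.
Proof.
move=> rp rq; split=> [h|[h1 h2]].
  have [rt _] := imp_rlGL h.
  by split; apply: (prov_taut1 h); rewrite ?rlGL_imp ?rt //; taut.
have [rt _] := imp_rlGL h1.
by apply: (prov_taut2 h1 h2); rewrite ?rlGL_imp ?rlGL_and ?rt ?rp //; taut.
Qed.

Lemma taut_bot w : (forall p, w (compl p) = ~~ w p) ->
  (forall p q, w (FAnd p q) = w p && w q) -> w (FBot Act P0) = false.
Proof. by move=> wc wa; rewrite wa (wc (FProp P0)) andbN. Qed.

Lemma imp_bot p : rlGL p -> imp (FBot Act P0) p.
Proof.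
move=> rp; apply: prov_taut; last by rewrite rlGL_imp rp.
by move=> w wc wo wa; rewrite wo wc (taut_bot wc wa).
Qed.

Lemma imp_compl p q : imp p q -> imp (compl q) (compl p).
Proof.
move=> h; have [rp rq] := imp_rlGL h.
by apply: (prov_taut1 h); [rewrite rlGL_imp !rlGL_compl rp rq | taut].
Qed.

Lemma imp_adj p q : imp (FAnd p q) (FBot Act P0) <-> imp p (compl q).
Proof.
split=> h; have [r1 r2] := imp_rlGL h.
  apply: (prov_taut1 h); first by rewrite rlGL_imp rlGL_compl -rlGL_and.
  move=> w wc wo wa; rewrite !(wo, wc) (taut_bot wc wa) wa.
  by case: (w p); case: (w q).
apply: (prov_taut1 h); first by rewrite rlGL_imp rlGL_and r1 -rlGL_compl r2.
move=> w wc wo wa; rewrite !(wo, wc) (taut_bot wc wa) wa.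
by case: (w p); case: (w q).
Qed.

Lemma imp_provable p : rlGL p -> imp (compl p) (FBot Act P0) -> prov p.
Proof. move=> rp h; apply: (prov_taut1 h) => // w wc wo wa; rewrite !(wo, wc) (taut_bot wc wa).
by case: (w p). Qed.

Lemma iff_imp p q : prov (FIff p q) -> imp p q /\ imp q p.
Proof.
move=> h; have := provable_ok h; rewrite rlGL_and => /andP[r1 r2].
by split; apply: (prov_taut1 h) => //; taut.
Qed.

Lemma imp_dia a p q : gok a -> imp p q -> imp (FDia a p) (FDia a q).
Proof.
move=> oka h; have [rp rq] := imp_rlGL h.
by apply: prv_mon => //; rewrite rlGL_imp !rlGL_dia oka rp rq.
Qed.

Lemma ax_iff p q : Ax (FIff p q) -> rlGL p -> rlGL q -> imp p q /\ imp q p.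
Proof.
move=> ax rp rq; apply: iff_imp; apply: prv_ax => //.
by rewrite rlGL_and !rlGL_imp rp rq.
Qed.

(* An element is represented by the set of closed formulas below it. *)
Definition lcls p : formula -> Prop := fun q => fok q /\ imp q p.
Record lcar := LCar { lset : formula -> Prop; lsetP : exists2 p, fok p & lset = lcls p }.
Implicit Types (x y z : lcar).

(** Makes [mk] total: anything that is not a closed formula of the fragment is sent to the
    bottom. *)
Definition fix_ok p := if fok p then p else FBot Act P0.
Lemma fix_okP p : fok (fix_ok p). Proof. by rewrite /fix_ok; case: ifP. Qed.
Definition mk p : lcar := LCar (ex_intro2 _ (fun q => lcls (fix_ok p) = lcls q) _ (fix_okP p) erefl).
Definition rep x : formula := s2val (cid2 (lsetP x)).
Lemma rep_ok x : fok (rep x). Proof. exact: (s2valP (cid2 (lsetP x))). Qed.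
Lemma lset_rep x : lset x = lcls (rep x). Proof. exact: (s2valP' (cid2 (lsetP x))). Qed.

Lemma lcar_eq x y : lset x = lset y -> x = y.
Proof. by case: x y => [s hs] [s' hs'] /= e; subst s'; congr LCar; exact: Prop_irrelevance. Qed.

Definition lle x y := imp (rep x) (rep y).

Lemma lset_mk p : fok p -> lset (mk p) = lcls p.
Proof. by move=> okp; rewrite /= /fix_ok okp. Qed.

Lemma rep_mk p : fok p -> imp (rep (mk p)) p /\ imp p (rep (mk p)).
Proof.
move=> okp; have e : lcls (rep (mk p)) = lcls p by rewrite -lset_rep lset_mk.
split.
  have : lcls p (rep (mk p)).
    by rewrite -e; split; [exact: rep_ok | apply: imp_refl; exact: fok_rlGL (rep_ok _)].
  by case.
have : lcls (rep (mk p)) p by rewrite e; split => //; apply: imp_refl; exact: fok_rlGL.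
by case.
Qed.

Lemma mk_le p q : fok p -> fok q -> lle (mk p) (mk q) <-> imp p q.
Proof.
move=> okp okq; have [p1 p2] := rep_mk okp; have [q1 q2] := rep_mk okq; split=> h.
  exact: imp_trans p2 (imp_trans h q1).
exact: imp_trans p1 (imp_trans h q2).
Qed.

Lemma lle_refl x : lle x x.
Proof. by apply: imp_refl; exact: fok_rlGL (rep_ok x). Qed.

Lemma lle_trans y x z : lle x y -> lle y z -> lle x z.
Proof. exact: imp_trans. Qed.

Lemma lle_anti x y : lle x y -> lle y x -> x = y.
Proof.
move=> xy yx; apply: lcar_eq; rewrite !lset_rep; apply: funext => p; apply: propext.
by split=> -[okp h]; split => //; [exact: imp_trans h xy | exact: imp_trans h yx].
Qed.

Lemma mk_eq p q : fok p -> fok q -> imp p q -> imp q p -> mk p = mk q.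
Proof. by move=> okp okq h h'; apply: lle_anti; apply/mk_le. Qed.

Lemma mk_rep x : mk (rep x) = x.
Proof. by apply: lcar_eq; rewrite lset_mk ?rep_ok // -lset_rep. Qed.

Definition lmeet x y := mk (FAnd (rep x) (rep y)).
Definition lneg x := mk (compl (rep x)).
Definition lbot := mk (FBot Act P0).

Lemma mk_ind (T : lcar -> Prop) : (forall p, fok p -> T (mk p)) -> forall x, T x.
Proof. by move=> h x; rewrite -[x]mk_rep; apply: h; exact: rep_ok. Qed.

Lemma mk_and p q : fok p -> fok q -> lmeet (mk p) (mk q) = mk (FAnd p q).
Proof.
move=> okp okq; have [p1 p2] := rep_mk okp; have [q1 q2] := rep_mk okq.
have [rp rq] := (fok_rlGL okp, fok_rlGL okq); have [r1 _] := imp_rlGL p1; have [r2 _] := imp_rlGL q1.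
apply: mk_eq; rewrite ?fok_and ?rep_ok ?okp //.
  have h : imp (FAnd (rep (mk p)) (rep (mk q))) (FAnd (rep (mk p)) (rep (mk q))).
    by apply: imp_refl; rewrite rlGL_and r1.
  have [h1 h2] := (imp_and _ r1 r2).1 h.
  by apply/imp_and => //; split; [exact: imp_trans h1 p1 | exact: imp_trans h2 q1].
have h : imp (FAnd p q) (FAnd p q) by apply: imp_refl; rewrite rlGL_and rp.
have [h1 h2] := (imp_and _ rp rq).1 h.
by apply/imp_and => //; split; [exact: imp_trans h1 p2 | exact: imp_trans h2 q2].
Qed.

Lemma mk_neg p : fok p -> lneg (mk p) = mk (compl p).
Proof.
by move=> okp; have [p1 p2] := rep_mk okp; apply: mk_eq; rewrite ?fok_compl ?rep_ok //; exact: imp_compl.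
Qed.

Lemma lle_meet x y z : lle z (lmeet x y) <-> lle z x /\ lle z y.
Proof.
elim/mk_ind: x => p okp; elim/mk_ind: y => q okq; elim/mk_ind: z => t okt.
by rewrite mk_and // !mk_le ?fok_and ?okp // imp_and //; exact: fok_rlGL.
Qed.

Lemma lbot_le x : lle lbot x.
Proof. by elim/mk_ind: x => p okp; apply/mk_le => //; apply: imp_bot; exact: fok_rlGL. Qed.

Lemma lneg_adj x y : lle (lmeet x y) lbot <-> lle x (lneg y).
Proof.
elim/mk_ind: x => p okp; elim/mk_ind: y => q okq.
by rewrite mk_and // mk_neg // !mk_le ?fok_and ?fok_compl ?okp // imp_adj.
Qed.

Lemma lnegK x : lneg (lneg x) = x.
Proof. by elim/mk_ind: x => p okp; rewrite !mk_neg ?fok_compl // complK. Qed.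

Definition lbalg : balg := Balg lle_refl lle_trans lle_anti lle_meet lbot_le lneg_adj lnegK.

Definition ldia (e : Act) (x : lbalg) : lbalg := mk (FDia (GAct e) (rep x)).

Lemma mk_dia a p q : fok p -> fok q -> gok a -> nilp (fvg a) -> mk p = mk q ->
  mk (FDia a p) = mk (FDia a q).
Proof.
move=> okp okq oka ca e; have [h1 h2] : imp p q /\ imp q p.
  by split; apply/mk_le => //; rewrite e; exact: lle_refl.
by apply: mk_eq; rewrite ?fok_dia ?oka ?ca //; exact: imp_dia.
Qed.

Lemma ldia_mono e : monof (ldia e).
Proof.
move=> x y xy; apply/mk_le; rewrite ?fok_dia ?rep_ok //.
exact: imp_dia.
Qed.

Notation B := lbalg.
Definition lval (P : Prp) : B := mk (FProp P).
Notation lf := (lf ldia lval).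
Notation lg := (lg ldia lval).
Notation ssub := (gsub (fun _ n => n) 0).
Implicit Types (s : nat -> game) (Y : nat -> B -> B) (k c : B).

Lemma mk_negE p : fok p -> mk (compl p) = bneg (mk p : B).
Proof. by move=> okp; rewrite -mk_neg. Qed.

Lemma mk_andE p q : fok p -> fok q -> mk (FAnd p q) = (mk p : B) ⊓ mk q.
Proof. by move=> okp okq; rewrite -mk_and. Qed.

Lemma mk_orE p q : fok p -> fok q -> mk (FOr p q) = (mk p : B) ⊔ mk q.
Proof.
move=> okp okq; have okp' : fok (compl p) by rewrite fok_compl.
have okq' : fok (compl q) by rewrite fok_compl.
rewrite /bjoin -(mk_negE okp) -(mk_negE okq) -(mk_andE okp' okq') -mk_negE ?fok_and ?okp' //=.
by rewrite !complK.
Qed.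

Lemma mk_topE : mk (FTop Act P0) = (btop : B).
Proof.
rewrite mk_orE // -[FNProp _]/(compl (FProp P0)) mk_negE // /bjoin bnegK meetC.
by rewrite (_ : _ ⊓ _ = bbot) //; apply: ble_anti => //; exact: meet_neg.
Qed.

Lemma mk_act e p : fok p -> mk (FDia (GAct e) p) = ldia e (mk p).
Proof. by move=> okp; apply: mk_dia; rewrite ?rep_ok // mk_rep. Qed.

Lemma mk_dual a p : gok a -> nilp (fvg a) -> fok p ->
  mk (FDia (dual a) p) = bneg (mk (FDia a (compl p)) : B).
Proof. by move=> oka ca okp; rewrite -mk_negE ?fok_dia ?oka ?ca ?fok_compl //= complK. Qed.

Lemma mk_ax p q : Ax (FIff p q) -> fok p -> fok q -> mk p = mk q.
Proof.
move=> ax okp okq; have [h1 h2] := ax_iff ax (fok_rlGL okp) (fok_rlGL okq).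
exact: mk_eq.
Qed.

Lemma dfv_nil a : nilp (fvg a) -> nilp (dfvg a).
Proof.
move=> ca; case E: (dfvg a) => [//|x t].
by have := (dfv_fv _ _).2 a x; rewrite E mem_head (nilP ca) => /(_ isT).
Qed.

(* The shape of the game substituted by the induction rule; its value is [p]
   at every continuation. *)
Definition cst p : game :=
  GSeq (GTest (FTop Act P0)) (GSeq (GTest p) (GTestD (FBot Act P0))).

Lemma cst_ok p : fok p -> gok (cst p) /\ nilp (fvg (cst p)).
Proof.
by move=> /andP[/andP[np rp] cp]; rewrite /gok /= np cp rp /=; rewrite (nilP cp).
Qed.

Lemma mk_test p q : fok p -> fok q -> mk (FDia (GTest p) q) = (mk p : B) ⊓ mk q.
Proof.
move=> okp okq; have ok : fok (FDia (GTest p) q).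
  by rewrite fok_dia okq /gok /= andbT; case/andP: okp => /andP[-> ->] cp; rewrite cp.
rewrite (@mk_ax _ (FAnd p q)) ?mk_andE ?fok_and ?okp //.
by apply: Ax_rlGL; exact: ax_test.
Qed.

Lemma mk_seq a b p : gok a -> gok b -> nilp (fvg a) -> nilp (fvg b) -> fok p ->
  mk (FDia (GSeq a b) p) = mk (FDia a (FDia b p)).
Proof.
move=> oka okb ca cb okp; apply: mk_ax; rewrite ?fok_dia ?oka ?okb ?ca ?cb ?okp //.
  by apply: Ax_rlGL; exact: ax_seq.
rewrite /= cat_nilp ca cb andbT.
by move: oka okb => /andP[na ra] /andP[nb rb]; rewrite /gok /= na nb ra rb ca.
Qed.

Lemma mk_cst p q : fok p -> fok q -> mk (FDia (cst p) q) = mk p.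
Proof.
move=> okp okq; have [okt|] := boolP (fok (FDia (GTestD (FBot Act P0)) q)); last first.
  by rewrite fok_dia okq.
have ok2 : gok (GTest p) by rewrite /gok /=; case/andP: okp => /andP[-> ->] ->.
have cp : nilp (fvg (GTest (Act := Act) p)) by case/andP: okp.
have ok3 : fok (FDia (GSeq (GTest p) (GTestD (FBot Act P0))) q).
  rewrite fok_dia okq andbT; have [] := cst_ok okp; rewrite /gok /= => + cf.
  by rewrite cf !andbT.
rewrite mk_seq //; try by move: ok3; rewrite fok_dia => /and3P[].
rewrite mk_test // mk_topE meetC meet_top mk_seq // mk_test //.
have -> : mk (FDia (GTestD (FBot Act P0)) q) = (btop : B).
  rewrite -[GTestD _]/(dual (GTest (FBot Act P0))) mk_dual // mk_test ?fok_compl //.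
  by rewrite -[mk (FBot _ _)]/(bbot : B) (_ : _ ⊓ _ = bbot) //; apply: ble_anti => //; exact: meetl.
by rewrite meet_top.
Qed.

(** Closed games realize the maps of an environment, so that the value of an open game can be read
    off from provability of closed formulas. *)
Record lreal s Y : Prop := LReal { lr_ok : forall n, gok (s n); lr_closed : forall n, nilp (fvg (s n));
  lr_val : forall n p, fok p -> mk (FDia (s n) p) = Y n (mk p) }.

Lemma lreal_upd s Y (x : nat) a (u : B -> B) : lreal s Y -> gok a -> nilp (fvg a) ->
  (forall p, fok p -> mk (FDia a p) = u (mk p)) -> lreal (upd s x a) (upd Y x u).
Proof. by move=> [h1 h2 h3] oka ca hu; split=> z *; rewrite /upd; case: eqP => *; auto. Qed.

Lemma lreal_dual s Y : lreal s Y -> lreal (fun n => dual (s n)) (fun n => fdual (Y n)).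
Proof.
move=> [h1 h2 h3]; split=> x; first by have := h1 x; rewrite /gok normalg_dual rling_dual.
  by rewrite fvg_dual.
by move=> p okp; rewrite mk_dual // h3 ?fok_compl // mk_negE.
Qed.

Lemma free_for_closed b : nilp (fvg b) ->
  (forall p (x : nat), free_forf b x p) /\ (forall a (x : nat), free_for b x a).
Proof.
move=> /nilP cb; apply: syntax_ind => //= *; rewrite ?cb ?orbT //.
all: repeat match goal with h : forall _, _ |- _ => rewrite h {h} end; by rewrite ?orbT.
Qed.

Lemma lreal_fok s Y a p : lreal s Y -> gok a -> nilp (dfvg a) -> fok p -> fok (FDia (ssub s a) p).
Proof.
move=> rs oka da okp; rewrite fok_dia okp andbT; apply/andP; split.
  have [] // := @gsub_ok _ _ (fun _ n => n) 0 s a oka da.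
  by move=> n; split; [exact: lr_ok rs n | apply: dfv_nil; exact: lr_closed rs n].
case E: (fvg _) => [//|n t]; have : n \in fvg (ssub s a) by rewrite E mem_head.
by case/andP: oka => na _; case/fvg_gsub => // n' _; rewrite (nilP (lr_closed rs n')).
Qed.

Definition gval_ok a := forall s Y p, lreal s Y -> fok p ->
  mk (FDia (ssub s a) p) = lg a Y (mk p).

Lemma gval_ok_dual a : gok a -> nilp (dfvg a) -> gval_ok a -> gval_ok (dual a).
Proof.
move=> oka da ha s Y p rs okp; have rs' := lreal_dual rs.
have -> : ssub s (dual a) = dual (ssub (fun n => dual (s n)) a).
  rewrite dual_gsub; congr gsub; apply: funext => n; rewrite dualK //.
have /and3P[ok' c' _] : [&& gok (ssub (fun n => dual (s n)) a),
    nilp (fvg (ssub (fun n => dual (s n)) a)) & fok p] by rewrite -fok_dia (lreal_fok rs').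
rewrite mk_dual //.
rewrite (ha _ _ _ rs') ?fok_compl // mk_negE // -lg_dual bnegK.
by rewrite (_ : (fun n => fdual (fdual (Y n))) = Y) //; apply: funext => n; rewrite fdualK.
Qed.

(** Both halves substitute a closed game for [x]: the fixpoint game itself for the axiom, and
    [cst q] for the rule. The map denoted by that game counts only through its value at [mk p],
    which is why elements can replace maps. *)
Lemma mu_islfp a (x : nat) s Y p : gok a -> nilp (dfvg a) -> gval_ok a -> lreal s Y -> fok p ->
  islfp (fun c => lg a (upd Y x (fun=> c)) (mk p))
    (mk (FDia (GMu x (ssub (upd s x (GVar x)) a)) p)).
Proof.
move=> oka da ha rs okp; set a' := ssub _ a.
have [na ra] := andP oka.
have s'ok n : gok (upd s x (GVar x) n) /\ nilp (dfvg (upd s x (GVar x) n)).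
  by rewrite /upd; case: eqP => // _; split; [exact: lr_ok rs n | apply: dfv_nil; exact: lr_closed rs n].
have [oka' da'] : gok a' /\ nilp (dfvg a') by exact: gsub_ok.
have fva' : {subset fvg a' <= [:: x]}.
  move=> n /fvg_gsub[] // n' _; rewrite /upd; case: eqP => // _.
  by rewrite (nilP (lr_closed rs n')).
have okmu : gok (GMu x a').
  by case/andP: oka' => na' ra'; rewrite /gok /= na' ra' (nilP da').
have cmu : nilp (fvg (GMu x a')).
  rewrite /=; case E: (filter _ _) => [//|n t].
  have : n \in [seq z <- fvg a' | z != x] by rewrite E mem_head.
  by rewrite mem_filter => /andP[nx /fva']; rewrite inE (negbTE nx).
have sub b : nilp (fvg b) -> substg x b a' = ssub (upd s x b) a.
  move=> cb; rewrite substg_ssub //; last first.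
    move=> n; rewrite /upd; case: eqP => [->|_]; first by right.
    by left; exact: lr_closed rs n.
  congr gsub; apply: funext => n; rewrite /upd; case: eqP => /= [_|_]; first by rewrite eqxx.
  by rewrite (subst_id x b).2 // (nilP (lr_closed rs n)).
have val b (u : B -> B) : gok b -> nilp (fvg b) -> (forall q, fok q -> mk (FDia b q) = u (mk q)) ->
    mk (FDia (substg x b a') p) = lg a (upd Y x (fun=> u (mk p))) (mk p).
  move=> okb cb hu; rewrite sub // (ha _ _ _ (lreal_upd x rs okb cb hu) okp).
  by rewrite (@lg_upd_const _ _ _ ldia lval a Y x u) // (nilP da).
have okfmu : fok (FDia (GMu x a') p) by rewrite fok_dia okmu cmu.
split.
  pose u (c : B) : B := mk (FDia (GMu x a') (rep c)).
  have hu q : fok q -> mk (FDia (GMu x a') q) = u (mk q).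
    by move=> okq; apply: mk_dia => //; [exact: rep_ok | rewrite mk_rep].
  rewrite [X in lg _ (upd _ _ (fun=> X))]hu // -(val _ _ okmu cmu hu).
  have oks : fok (FDia (substg x (GMu x a') a') p).
    by rewrite sub // (lreal_fok (lreal_upd x rs okmu cmu hu)).
  apply/mk_le => //; apply: prv_ax; last by rewrite rlGL_imp !fok_rlGL.
  by apply: Ax_rlGL; apply: ax_unfold; exact: (free_for_closed cmu).2.
elim/mk_ind => q okq; have [okc cc] := cst_ok okq.
have ok1 : fok (FDia (GTest (FTop Act P0)) q) by rewrite fok_dia okq.
(* The rule concludes a diamond formula; with the test of [FTop] as its game [b], that formula has
   the value of [q]. *)
have vq : mk (FDia (GTest (FTop Act P0)) q) = mk q by rewrite mk_test // mk_topE meetC meet_top.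
have hu q' : fok q' -> mk (FDia (cst q) q') = (fun=> mk q) (mk q') by exact: mk_cst.
rewrite -[lg _ _ _]/(lg a (upd Y x (fun=> (fun=> mk q) (mk p))) (mk p)) -(val _ _ okc cc hu) -vq.
have oks : fok (FDia (substg x (cst q) a') p).
  by rewrite sub // (lreal_fok (@lreal_upd _ _ x _ (fun=> mk q) rs okc cc hu)).
move=> /(mk_le oks ok1).1 h; apply/mk_le => //; apply: prv_fix h _.
by rewrite rlGL_imp !fok_rlGL.
Qed.

Lemma gval_cup a b : gok (GCup a b) -> nilp (dfvg (GCup a b)) -> gval_ok a -> gval_ok b ->
  gval_ok (GCup a b).
Proof.
move=> /= oka; rewrite cat_nilp => /andP[da db] ha hb s Y p rs okp.
have [oka' okb'] : gok a /\ gok b.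
  by move: oka; rewrite /gok /= => /andP[/andP[-> ->] /andP[-> ->]].
rewrite /= -(ha _ _ _ rs okp) -(hb _ _ _ rs okp).
have fa := lreal_fok rs oka' da okp; have fb := lreal_fok rs okb' db okp.
rewrite -[RHS](mk_orE fa fb); apply: mk_ax; [apply: Ax_rlGL; exact: ax_cup | | by rewrite fok_or fa].
by apply: (lreal_fok (a := GCup a b) rs) => //=; rewrite cat_nilp da.
Qed.

Lemma gval_mu (x : nat) a : gok a -> nilp (dfvg a) -> gval_ok a -> gval_ok (GMu x a).
Proof.
move=> oka da ha s Y p rs okp; rewrite /= (ssub_depth 1 0).
by rewrite (lfp_eq (mu_islfp x oka da ha rs okp)).
Qed.

Lemma gok_mu (x : nat) a : gok (GMu x a) = gok a && (x \notin dfvg a).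
Proof. by rewrite /gok /= andbAC. Qed.

Lemma lreal_id : lreal (fun=> GTest (FTop Act P0)) (fun=> id).
Proof. by split=> // n p okp; rewrite mk_test // mk_topE meetC meet_top. Qed.

Lemma lvalE : (forall p, fok p -> lf p = mk p) /\
  (forall a, gok a -> nilp (dfvg a) -> gval_ok a).
Proof.
have testE p : gok (GTest p) -> fok p by rewrite /gok /fok /rlGL /= => /andP[/andP[-> ->] ->].
have vtest p : (fok p -> lf p = mk p) -> gok (GTest p) -> gval_ok (GTest p).
  by move=> hp /testE okp s Y q rs okq; rewrite /= mk_test // hp.
have vact e : gval_ok (GAct e) by move=> s Y p rs okp; rewrite /= mk_act.
apply: syntax_ind.
- by [].
- by move=> P _; rewrite -[FNProp P]/(compl (FProp P)) mk_negE.
- by move=> p hp q hq; rewrite fok_or => /andP[okp okq]; rewrite /= hp ?hq // mk_orE.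
- by move=> p hp q hq; rewrite fok_and => /andP[okp okq]; rewrite /= hp ?hq // mk_andE.
- move=> a ha p hp; rewrite fok_dia => /and3P[oka ca okp]; rewrite /= hp //.
  have [na _] := andP oka.
  by rewrite -(ha oka (dfv_nil ca) _ _ _ lreal_id okp) ssub_closed.
- by [].
- by move=> e _ _; apply: (@gval_ok_dual (GAct e)).
- by move=> n _ _ s Y p rs okp; exact: lr_val rs n p okp.
- by [].
- by move=> p hp okt _; exact: vtest.
- by move=> p hp okt dt; apply: (@gval_ok_dual (GTest p)) => //; exact: vtest.
- move=> a ha b hb oka da; have [[oka' okb'] [da' db']] : (gok a /\ gok b) /\ (nilp (dfvg a) /\ nilp (dfvg b)).
    by move: oka da; rewrite /gok /= cat_nilp => /andP[/andP[-> ->] /andP[-> ->]] /andP[-> ->].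
  exact: gval_cup (ha oka' da') (hb okb' db').
- move=> a ha b hb oka da; have [[oka' okb'] [da' db']] : (gok a /\ gok b) /\ (nilp (dfvg a) /\ nilp (dfvg b)).
    by move: oka da; rewrite /gok /= cat_nilp => /andP[/andP[-> ->] /andP[-> ->]] /andP[-> ->].
  rewrite -[GCap a b]dualK; apply: gval_ok_dual.
  + by rewrite /gok normalg_dual rling_dual.
  + by rewrite dfvg_dual.
  apply: gval_cup; try by rewrite -[GCup _ _]/(dual (GCap a b)) /gok ?normalg_dual ?rling_dual ?dfvg_dual.
    by apply: gval_ok_dual => //; exact: ha.
  by apply: gval_ok_dual => //; exact: hb.
- move=> a ha b hb oka; rewrite /= cat_nilp => /andP[da db].
  have [[oka' okb'] ca] : (gok a /\ gok b) /\ nilp (fvg a).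
    by move: oka; rewrite /gok /= => /andP[/andP[-> ->] /and3P[-> -> ->]].
  move=> s Y p rs okp; have fb := lreal_fok rs okb' db okp; have fa := lreal_fok rs oka' da fb.
  rewrite /= -(hb okb' db _ _ _ rs okp) -(ha oka' da _ _ _ rs fb).
  by move: fa fb; rewrite !fok_dia => /and3P[? ? _] /and3P[? ? _]; exact: mk_seq.
- move=> n a ha; rewrite gok_mu => /andP[oka na] /(dfvg_nil_body na) da; exact: gval_mu (ha oka da).
move=> n a ha oka da; have [na oka'] : n \notin dfvg a /\ gok a.
  by move: oka; rewrite -[gok _]/(gok (GMu n a)) gok_mu => /andP[].
have da' := dfvg_nil_body na da.
rewrite -[GNu n a]dualK; apply: gval_ok_dual.
- by rewrite /gok normalg_dual rling_dual.
- by rewrite dfvg_dual.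
apply: gval_mu; [by rewrite /gok normalg_dual rling_dual | by rewrite dfvg_dual |].
by apply: gval_ok_dual => //; exact: ha.
Qed.

(** The value must not depend on [k], so that the game denotes a map of its variables. Constants are
    games of this kind through [cst], and [GMu] provides closure under least fixpoints. *)
Definition ldef (f : (nat -> B) -> B) : Prop := exists a, [/\ gok a, nilp (dfvg a) &
  forall (y : nat -> B) k, f y = lg a (cenv y) k].

Definition cenv_game (y : nat -> B) : nat -> game := fun n => cst (rep (y n)).

Lemma cenv_real (y : nat -> B) : lreal (cenv_game y) (cenv y).
Proof.
split=> n; try by case: (cst_ok (rep_ok (y n))).
by move=> p okp; rewrite mk_cst ?rep_ok // mk_rep.
Qed.

Lemma ldef_islfp a (n : nat) (y : nat -> B) k : gok a -> nilp (dfvg a) ->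
  haslfp (fun c => lg a (upd (cenv y) n (fun=> c)) k).
Proof.
move=> oka da; have h := mu_islfp n oka da (lvalE.2 a oka da) (cenv_real y) (rep_ok k).
by rewrite mk_rep in h; eexists; exact: h.
Qed.

Lemma ldef_mono f : ldef f -> forall y z : nat -> B, (forall n, y n <<= z n) -> f y <<= f z.
Proof.
move=> [a [oka da hf]] y z yz; rewrite (hf y bbot) (hf z bbot).
pose E (u : B -> B) := exists c, u = fun=> c.
pose P b := gok b /\ nilp (dfvg b).
apply: (@lg_mono _ _ _ ldia lval ldia_mono E _ _ _ P); try by [].
- by move=> _ [c ->] c1 c2 _; exact: ble_refl.
- by move=> c; exists c.
- by move=> _ [c ->]; exists (bneg c).
- move=> n b Y k [okb db] EY _.
  have -> : Y = cenv (fun n => Y n bbot).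
    by apply: funext => m; apply: funext => c; rewrite /cenv; case: (EY m) => c' ->.
  exact: ldef_islfp.
- rewrite /P /gok; case=> //=.
  + by move=> b c; rewrite cat_nilp => -[/andP[/andP[-> ->] /andP[-> ->]] /andP[-> ->]].
  + by move=> b c; rewrite cat_nilp => -[/andP[/andP[-> ->] /andP[-> ->]] /andP[-> ->]].
  + by move=> b c; rewrite cat_nilp => -[/andP[/andP[-> ->] /and3P[-> -> _]] /andP[-> ->]].
  + by move=> n b [/andP[/andP[-> nb] ->] /(dfvg_nil_body nb) db].
  + by move=> n b [/andP[/andP[-> nb] ->] /(dfvg_nil_body nb) db].
- by move=> b [okb db]; rewrite /P /gok normalg_dual rling_dual dfvg_dual.
- by move=> n; exists (y n).
- by move=> n; exists (z n).
- by move=> n c; exact: yz.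
- by move=> n; rewrite (nilP da).
Qed.

Lemma ldef_var (n : nat) : ldef (fun y : nat -> B => y n).
Proof. by exists (GVar n). Qed.

Lemma ldef_const (c : B) : ldef (fun=> c).
Proof.
have okc := rep_ok c; have [ok1 ok2] := cst_ok okc.
exists (cst (rep c)); split => //; first exact: dfv_nil.
move=> y k; have := lvalE.2 _ ok1 (dfv_nil ok2) _ _ _ (cenv_real y) (rep_ok k).
by rewrite mk_rep => <-; rewrite ssub_closed ?mk_cst ?rep_ok ?mk_rep //; case/andP: ok1.
Qed.

Lemma ldef_meet f g : ldef f -> ldef g -> ldef (fun y : nat -> B => f y ⊓ g y).
Proof.
move=> [a [/andP[na ra] da hf]] [b [/andP[nb rb] db hg]]; exists (GCap a b); split.
- by rewrite /gok /= na ra nb rb.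
- by rewrite /= cat_nilp da.
- by move=> y k; rewrite (hf y k) (hg y k).
Qed.

Lemma ldef_dia e f : ldef f -> ldef (fun y : nat -> B => ldia e (f y)).
Proof.
move=> [a [/andP[na ra] da hf]]; exists (GSeq (GAct e) a); split => //.
- by rewrite /gok /= na ra.
- by move=> y k; rewrite (hf y k).
Qed.

Lemma ldef_neg f : ldef f -> ldef (fun y : nat -> B => bneg (f (fun n => bneg (y n)))).
Proof.
move=> [a [oka da hf]]; exists (dual a); split.
- by rewrite /gok normalg_dual rling_dual.
- by rewrite dfvg_dual.
move=> y k; rewrite (hf _ (bneg k)) -lg_dual bnegK.
rewrite (_ : (fun _ => fdual _) = cenv y) //; apply: funext => n; apply: funext => c.
by rewrite /fdual /cenv bnegK.
Qed.

Lemma ldef_sub f g (n : nat) : ldef f -> ldef g -> ldef (fun y : nat -> B => f (upd y n (g y))).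
Proof.
move=> [a [oka da hf]] [b [okb db hg]].
(* [d] exceeds all free variables of both games, so the binders [d], [d.+1], ... capture none of
   them. *)
pose s := upd GVar n b; pose d := (sumn (fvg a ++ fvg b)).+1.
have hd m : m \in fvg a ++ fvg b -> m < d.
  rewrite /d ltnS; elim: (_ ++ _) => //= m' l IH; rewrite inE => /predU1P[->|/IH h].
    exact: leq_addr.
  exact: leq_trans h (leq_addl _ _).
have sok m : gok (s m) /\ nilp (dfvg (s m)) by rewrite /s /upd; case: eqP.
have [ok' da'] := gsub_ok (fun d _ => d) d oka da sok.
exists (gsub (fun d _ => d) d s a); split => // y k.
rewrite lg_gsub //; first last.
- move=> m m' ma; rewrite /s /upd; case: eqP => [_|_ /=]; last first.
    by rewrite inE => /eqP->; apply: hd; rewrite mem_cat ma.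
  by move=> mb; apply: hd; rewrite mem_cat mb orbT.
- by move=> m; case: (sok m) => /andP[].
- by case/andP: oka.
rewrite (hf _ k) (_ : (fun m => _) = cenv (upd y n (g y))) //.
apply: funext => m; apply: funext => c; rewrite /s /cenv /upd; case: eqP => // _.
Qed.

Lemma ldef_haslfp f (n : nat) (y : nat -> B) : ldef f -> haslfp (fun c => f (upd y n c)).
Proof.
move=> [a [oka da hf]].
rewrite (_ : (fun c => _) = fun c => lg a (upd (cenv y) n (fun=> c)) bbot); first exact: ldef_islfp.
by apply: funext => c; rewrite (hf _ bbot) cenv_upd.
Qed.

Lemma ldef_lfp f (n : nat) : ldef f -> ldef (fun y : nat -> B => lfpB (fun c => f (upd y n c))).
Proof.
move=> [a [oka da hf]]; exists (GMu n a); split.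
- by rewrite gok_mu oka (nilP da).
- by rewrite /= (nilP da).
move=> y k; congr lfpB; apply: funext => c; by rewrite (hf _ k) cenv_upd.
Qed.

Definition lkozen : kozen Act :=
  @Kozen Act lbalg ldia ldef ldia_mono ldef_mono ldef_var ldef_const ldef_meet ldef_dia
    ldef_neg ldef_sub ldef_haslfp ldef_lfp.

Lemma lkozen_normal : (forall p, axiom_G P0 p -> Ax p) -> knormal lkozen.
Proof.
move=> axG.
have boxE e p : fok p -> mk (FBox e p) = kbox e (mk p : lkozen).
  by move=> okp; rewrite -[FBox e p]/(FDia (dual (GAct e)) p) mk_dual // mk_act ?fok_compl // mk_negE.
have okbox e p : fok (FBox e p) = fok p by rewrite fok_dia.
have bneg0 e : kdia e bbot <<= (bbot : lkozen).
  have h : mk (FBox e (FTop Act P0)) = (btop : B).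
    rewrite -mk_topE; apply: mk_eq; rewrite ?okbox //.
      apply: prov_taut => //; move=> w wc wo wa; rewrite /FImp wo [w (FTop _ _)]wo.
      by rewrite -[FNProp _]/(compl (FProp P0)) (wc (FProp P0)) orbN orbT.
    apply: prov_taut1 (_ : prov (FBox e (FTop Act P0))) _ _ => //.
      by apply: prv_ax => //; apply: axG; exact: ax_box_top.
    by move=> w wc wo wa; rewrite /FImp !wo !wc; case: (w (FBox _ _)); rewrite /= ?orbT.
  have h' : kbox e (btop : lkozen) = btop by rewrite -[RHS]h (boxE e _ fok_top) mk_topE.
  by have := congr1 (@bneg lkozen) h'; rewrite /kbox /btop !bnegK => ->; exact: ble_refl.
split; last exact: bneg0.
move=> e x y.
have box_or (u w : lkozen) : kbox e (u ⊔ w) <<= kdia e u ⊔ kbox e w.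
  rewrite -[u](mk_rep (u : lcar)) -[w](mk_rep (w : lcar)); set p := rep _; set q := rep _.
  have [okp okq] : fok p /\ fok q by split; exact: rep_ok.
  rewrite -[kdia e _]/(ldia e (mk p)) -mk_act // -boxE // -[X in kbox e X](mk_orE okp okq).
  have okd : fok (FDia (GAct e) p) by rewrite fok_dia.
  rewrite -boxE ?fok_or ?okp // -[X in _ <<= X](mk_orE okd) ?okbox //.
  apply/mk_le; rewrite ?okbox ?fok_or ?okp ?okd ?okbox //.
  apply: prv_ax; first by apply: axG; exact: ax_box_or.
  by rewrite rlGL_imp !fok_rlGL ?fok_or ?okbox ?fok_or ?okp ?okd.
(* As [y] lies below [(x ⊓ y) ⊔ bneg x], the axiom on boxes of disjunctions bounds [kbox e y]; its
   second disjunct is excluded by [kdia e x]. *)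
apply: ble_trans (_ : kdia e x ⊓ (kdia e (x ⊓ y) ⊔ kbox e (bneg x)) <<= _).
  apply: meet_mono => //; apply: ble_trans (box_or _ _); apply: kbox_mono.
  apply/le_nz => nz; rewrite neg_join bnegK in nz.
  by apply: nz; rewrite [bneg _ ⊓ _]meetC meetA [y ⊓ x]meetC; exact: meet_neg.
apply/le_nz; rewrite meetC meetA => /nz_join[]; apply.
  by rewrite -meetA [_ ⊓ kdia e (_ ⊓ _)]meetC meetA; apply: ble_trans (meetl _ _) _; rewrite meetC; exact: meet_neg.
rewrite /kbox bnegK -meetA; apply: ble_trans (meetr _ _) _; exact: meet_neg.
Qed.

End Provability.

From mathcomp Require Import classical_sets.

(** * Powerset algebras *)

Section SetAlgebra.
Variable W : Type.
Local Open Scope classical_set_scope.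

Lemma set_adj (A B : set W) : (A `&` B `<=` set0) <-> (A `<=` ~` B).
Proof. by split=> h w; [move=> Aw Bw; apply: (h w) | move=> [Aw Bw]; apply: (h w)]. Qed.

Lemma set_anti (A B : set W) : A `<=` B -> B `<=` A -> A = B.
Proof. by move=> AB BA; apply/seteqP. Qed.

Lemma set_meet (A B C : set W) : C `<=` A `&` B <-> C `<=` A /\ C `<=` B.
Proof. by rewrite subsetI. Qed.

Lemma set_le_refl (A : set W) : A `<=` A. Proof. by []. Qed.

Lemma set_le_trans (B A C : set W) : A `<=` B -> B `<=` C -> A `<=` C.
Proof. by move=> AB BC w /AB /BC. Qed.

Definition set_balg : balg := @Balg (set W) (fun A B => A `<=` B) setI setC set0
  set_le_refl set_le_trans set_anti set_meet (@sub0set W) set_adj (@setCK W).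

Lemma set_haslfp (g : set_balg -> set_balg) : monof g -> haslfp g.
Proof.
move=> mg; pose x : set_balg := fun w => forall z : set_balg, g z <<= z -> z w.
have xle z : g z <<= z -> x <<= z by move=> gz w xw; exact: (xw z gz).
exists x; split => // w gw z gz; exact: (gz w (mg _ _ (xle z gz) w gw)).
Qed.

End SetAlgebra.

Section SetKozen.
Variables (Prp Act : Type) (N : mnstruct Prp Act).
Notation B := (set_balg N).

Definition set_def (f : (nat -> B) -> B) := forall y z, (forall i, y i <<= z i) -> f y <<= f z.

Lemma set_def_upd f (y : nat -> B) j : set_def f -> monof (fun x => f (upd y j x)).
Proof. by move=> df x x' xx'; apply: df => i; rewrite /upd; case: eqP. Qed.

Lemma nbhd_mono a : monof (@mnbhd _ _ N a : B -> B).
Proof. by move=> x y; exact: mnbhd_monotone. Qed.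

Definition set_kozen : kozen Act.
Proof.
refine (@Kozen Act B (@mnbhd _ _ N) set_def nbhd_mono _ _ _ _ _ _ _ _ _) => //.
- move=> i y z yz; exact: yz.
- move=> b y z _; exact: ble_refl.
- by move=> f g df dg y z yz; apply: meet_mono; [exact: df | exact: dg].
- by move=> a f df y z yz; apply: nbhd_mono; exact: df.
- by move=> f df y z yz; apply: le_neg; apply: df => i; exact: le_neg.
- move=> f g j df dg y z yz; apply: df => i; rewrite /upd; case: eqP => // _; exact: dg.
- by move=> f j y df; apply: set_haslfp; exact: set_def_upd.
move=> f j df y z yz; apply: lfp_mono; try by apply: set_haslfp; exact: set_def_upd.
by move=> x; apply: df => i; rewrite /upd; case: eqP.
Defined.

Definition set_lit (l : Prp * bool) : set_kozen := if l.2 then mval (m := N) l.1 else bneg (mval (m := N) l.1 : B).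

End SetKozen.

(** * From parity conditions on paths to values of fixpoint systems *)

Section Adequacy.
Variables (Prp Act : Type) (N : mnstruct Prp Act) (Lt : Type) (lit : Lt -> set_kozen N).
Variable V : vaut Lt Act.
Notation Q := 'I_(vsize V).
Notation h := (vhes lit V).
Notation node := (N * Q)%type.
Variables (dom : node -> Prop) (E : node -> node -> Prop).
Hypothesis dom_E : forall p p', dom p -> E p p' -> dom p'.
Hypothesis local : forall (w : N) (q : Q) (Y : nat -> set_kozen N), dom (w, q) ->
  (forall p', E (w, q) p' -> Y p'.2 p'.1) -> nfun lit (vnd q) Y w.
Hypothesis good_path : forall (f : nat -> node) x, (forall n, dom (f n)) ->
  (forall n, E (f n) (f n.+1)) -> limsup_is (fun n => (f n).2) x -> ~~ @vmu _ _ V x.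

Fixpoint exits k n (p p' : node) : Prop :=
  if n is n'.+1 then p.2 < k /\ exists2 p1, E p p1 & exits k n' p1 p'
  else k <= p.2 /\ p = p'.

Lemma exits_ge k n p p' : exits k n p p' -> k <= p'.2.
Proof. by elim: n p => [|n IH] p /=; [case=> ? <- | case=> _ [p1 _ /IH]]. Qed.

Lemma exits_dom k n p p' : exits k n p p' -> dom p -> dom p'.
Proof.
elim: n p => [|n IH] p /=; first by case=> _ <-.
by case=> _ [p1 e /IH h] dp; apply: h; exact: dom_E dp e.
Qed.

Lemma exits_up k n p p' : exits k n p p' -> k < p'.2 -> exits k.+1 n p p'.
Proof.
elim: n p => [|n IH] p /=; first by case=> _ ->.
by case=> pk [p1 e /IH h] /h {}h; split; [exact: ltnW | exists p1].
Qed.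

Lemma exits_trans k n n' p p' p'' : exits k n p p' -> exits k.+1 n' p' p'' ->
  exists n'', exits k.+1 n'' p p''.
Proof.
elim: n p => [|n IH] p /=; first by case=> _ <-; exists n'.
move=> [pk [p1 e h1]] h2; have [n'' h] := IH p1 h1 h2.
by exists n''.+1; split; [exact: ltnW | exists p1].
Qed.

Lemma good_h : hes_good h. Proof. exact: hes_def_good (vhes_def _ _). Qed.

(** [A] consists of the worlds at which every path from [kq] leaving the indices up to [k] ends
    well. For a greatest fixpoint [A] is postfixed. For a least one, a world of [A] outside the
    fixpoint leads back to [kq] at another such world, forever; the concatenated returns form a path
    with limsup [k]. *)
Lemma adequacy_level k (Z : nat -> set_kozen N) p : dom p -> k <= vsize V ->
  (forall n p', exits k n p p' -> Z p'.2 p'.1) -> sol h k Z p.2 p.1.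
Proof.
elim: k Z p => [|k IH] Z p dp kr hZ; first exact: (hZ 0 p).
pose kq : Q := Ordinal kr.
have levE x : lev h k Z x = nfun lit (vnd kq) (sol h k (upd Z k x)).
  exact: (vhesE lit kq).
rewrite solS; set xs := fxp _ _ _.
pose A : set_kozen N := fun w => dom (w, kq) /\
  forall n p', exits k.+1 n (w, kq) p' -> Z p'.2 p'.1.
have step (Y : set_kozen N) p1 : dom p1 ->
    (forall n p', exits k.+1 n p1 p' -> Z p'.2 p'.1) ->
    (forall n p', exits k n p1 p' -> p'.2 = kq -> A p'.1 -> Y p'.1) ->
    sol h k (upd Z k Y) p1.2 p1.1.
  move=> d1 z1 y1; apply: IH => //; first exact: ltnW.
  move=> n p' e; rewrite /upd; case: eqP => [pk|/eqP pk].
    have pk' : p'.2 = kq by exact: ord_inj.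
    apply: (y1 n) => //; split; first by rewrite -pk' -surjective_pairing; exact: exits_dom e d1.
    move=> n' p''; rewrite -pk' -surjective_pairing => e'.
    by have [n'' e''] := exits_trans e e'; exact: z1 e''.
  apply: (z1 n); apply: (exits_up e).
  by rewrite ltn_neqAle eq_sym pk (exits_ge e).
suff Ax : A <<= xs by apply: step => // n p' _ _ /Ax.
have next w p1 : A w -> E (w, kq) p1 -> dom p1 /\
    forall n p', exits k.+1 n p1 p' -> Z p'.2 p'.1.
  move=> [dw zw] e; split; first exact: dom_E dw e.
  by move=> n p' e'; apply: (zw n.+1); split => //=; exists p1.
case Emu: (@vmu _ _ V k); last first.
  have -> : xs = gfpB (lev h k Z) by rewrite /xs /fxp -[hmu _ _]/(@vmu _ _ V k) Emu.
  apply: gfp_ge; first exact: (hgood_gfp good_h).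
  move=> w Aw; rewrite levE; apply: local; first by case: Aw.
  by move=> p1 e; have [d1 z1] := next w p1 Aw e; exact: step.
have xE : xs = lev h k Z xs by exact: (fxp_fix good_h k Z).
pose S w w' := A w' /\ exists p1 n, E (w, kq) p1 /\ exits k n p1 (w', kq).
move=> w0 Aw0; apply: contrapT => no0.
have nextS w : A w /\ ~ xs w -> exists2 w', A w' /\ ~ xs w' & S w w'.
  move=> [Aw no]; apply: contrapT => nS; apply: no; rewrite xE levE.
  apply: local; first by case: Aw.
  move=> p1 e; have [d1 z1] := next w p1 Aw e; apply: step => // n p' e' pk Ap.
  apply: contrapT => nx; apply: nS; exists p'.1 => //; split => //; exists p1, n; split => //.
  by rewrite -pk -surjective_pairing.
have [c [c0 cP cS]] := dependent_choice (conj Aw0 no0) nextS.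
(* A position on the concatenated path: the current node, the number of the return under way, and
   the steps left until it is completed. *)
pose Pt (s : node * nat * nat) := exits k s.2 s.1.1 (c s.1.2, kq).
pose Rt (s s' : node * nat * nat) := E s.1.1 s'.1.1 /\ (if s.2 is m.+1 then s'.2 = m else True).
have nextP s : Pt s -> exists2 s', Pt s' & Rt s s'.
  case: s => [[p1 j] [|n]]; rewrite /Pt /=.
    by move=> [_ ->]; have [_ [p2 [n [e h2]]]] := cS j; exists ((p2, j.+1), n).
  by move=> [pk [p2 e h2]]; exists ((p2, j), n).
have P0 : Pt ((c 0, kq), 0, 0) by split.
have [f [f0 fP fR]] := dependent_choice P0 nextP.
have fk n : (f n).1.1.2 <= k.
  have := fP n; rewrite /Pt; case: (f n).2 => [|m] /=; first by case=> _ ->.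
  by case=> /ltnW.
have io : inf_often (fun n => (f n).1.1.2 = k :> nat).
  move=> M; move: {2}((f M).2) (erefl (f M).2) => m; elim: m M => [|m IHm] M em.
    exists M => //; have := fP M; rewrite /Pt em /= => -[ge e].
    by rewrite e.
  have [_] := fR M; rewrite em => /IHm[n Mn fn]; exists n => //; exact: ltnW.
have d n : dom (f n).1.1.
  elim: n => [|n IHn]; first by rewrite f0; case: (cP 0) => -[].
  exact: dom_E IHn (fR n).1.
have := @good_path (fun n => (f n).1.1) k d (fun n => (fR n).1).
rewrite Emu; have h : limsup_is (fun n => (f n).1.1.2) k by split; [exists 0 => n _; exact: fk | exact: io].
by move=> /(_ h).
Qed.

End Adequacy.

(** Connects the indices along a path with trace labels, each label being the maximum over the block
    between two modal steps. *)
Lemma limsup_blocks (f l st : nat -> nat) x : (forall j, st j < st j.+1) ->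
  (forall j n, st j <= n -> n < st j.+1 -> f n <= l j) ->
  (forall j, exists n, [/\ st j <= n, n < st j.+1 & f n = l j]) ->
  limsup_is f x -> limsup_is l x.
Proof.
move=> st_lt fl lf [[N hN] io].
have st_id j : j <= st j by elim: j => // j IH; exact: leq_ltn_trans IH (st_lt j).
have blk n : st 0 <= n -> exists2 j, st j <= n & n < st j.+1.
  move=> n0; elim: n n0 => [|n IH]; rewrite leq_eqVlt => /predU1P[e|].
  - by exists 0; rewrite ?e // -e; exact: st_lt.
  - by [].
  - by exists 0; rewrite ?e // -e; exact: st_lt.
  rewrite ltnS => /IH[j jn nj].
  have [nj'|nj'] := ltnP n.+1 (st j.+1); first by exists j => //; exact: leqW.
  have e : n.+1 = st j.+1 by apply/eqP; rewrite eqn_leq nj nj'.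
  by exists j.+1; rewrite e.
split.
  exists N => j Nj; have [n [jn _ <-]] := lf j; apply: hN.
  exact: leq_trans Nj (leq_trans (st_id j) jn).
move=> J; have [n nJ fn] := io (maxn (st 0) (st (maxn J N))).
move: nJ; rewrite geq_max => /andP[n0 nJ]; have [j jn nj] := blk n n0.
have st_mono i d : st i <= st (i + d).
  by elim: d => [|d IH]; rewrite ?addn0 // addnS; exact: leq_trans IH (ltnW (st_lt _)).
have jJ : maxn J N <= j.
  rewrite leqNgt; apply/negP => jJ; move: nJ; rewrite leqNgt => /negP; apply.
  by apply: leq_trans nj _; rewrite -(subnKC jJ); exact: st_mono.
move: jJ; rewrite geq_max => /andP[jJ jN]; exists j => //.
have lx : x <= l j by rewrite -fn; exact: fl.
apply/eqP; rewrite eqn_leq lx andbT.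
have [n' [jn' nj' <-]] := lf j; apply: hN.
by apply: leq_trans jn'; apply: leq_trans (st_id j).
Qed.

(** * The model of nonzero configurations *)

Section Model.
Variables (Prp Act : Type) (V : vaut (Prp * bool) Act) (kr : bool).
Notation r := (vsize V).
Notation Q := 'I_r.
Notation nd := (@vnd _ _ V).
Notation mu := (@vmu _ _ V).
Notation mdiaP := (@mdiaP _ Act V).
Notation mboxP := (@mboxP _ Act V).
Variable kt : nat.
Hypothesis kt_card : #|{: option (letter Q r)}| = kt.
Notation dmem := (dstate Q r kt).
Notation macro := ({set Q} * dmem)%type.
Variable M : nat.
Variables (enc : 'I_(dbound kt) * macro -> 'I_M) (dec : 'I_M -> 'I_(dbound kt) * macro).
Hypothesis encK : cancel enc dec.
Hypothesis decK : cancel dec enc.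
Hypothesis enc_mono : forall (p p' : 'I_(dbound kt)) (x x' : macro),
  p < p' -> enc (p, x) < enc (p', x').
Variables (K : kozen Act) (lit : Prp * bool -> K).
Hypothesis gK : kglobal K.
Hypothesis krK : kr -> knormal K.
Hypothesis lit_cons : forall P, lit (P, true) ⊓ lit (P, false) <<= bbot.
Variable Z : nat -> K.

Definition mh (_ : unit) : hes K := nhes kr enc dec lit r Z.

Lemma mh_good h : hes_good (mh h).
Proof. by apply: hes_def_good; exact: nhes_def. Qed.

(* The worlds are the nonzero configurations with a single thread. *)
Record mworld := MWorld {
  wc : conf K unit M 1;
  wi : 'I_M;
  wcu : cu wc ord0 = Some (tt, wi);
  wok : conf_ok wc;
  wnz : bnz (cval mh wc);
  wreach : dreach (dm dec wi) }.
Implicit Types w : mworld.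

Definition wenv w : nat -> K := env (mh tt) M (t_next mh (wc w) ord0).

Lemma wrho_ex w : exists R : rho V, resol r (gam dec (wi w)) R /\
  bnz (rlit lit r Z R ⊓ nmod kr enc r R (dec (wi w)).2 (wenv w)).
Proof.
have := fval_nz mh_good (@wnz w); rewrite /fval => nz.
have : bnz (btop ⊓ nbody kr enc lit r Z (dec (wi w)).2 (wenv w)).
  apply: nz_le nz _; apply: le_meet; first exact: le_top.
  apply: ble_trans (meets_le _ ord0) _.
  by rewrite wcu -[mh tt]/(nhes kr enc dec lit r Z) nhesE.
move/nz_joins => [R]; case: asboolP => [hR nzR|_ []]; last exact: meetr.
by exists R; split => //; apply: nz_le nzR _; exact: meetr.
Qed.

Definition wrho w : rho V := projT1 (cid (wrho_ex w)).
Lemma wrho_resol w : resol r (gam dec (wi w)) (wrho w).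
Proof. by rewrite /wrho; case: (cid _) => R []. Qed.
Lemma wrho_nz w : bnz (rlit lit r Z (wrho w) ⊓ nmod kr enc r (wrho w) (dec (wi w)).2 (wenv w)).
Proof. by rewrite /wrho; case: (cid _) => R []. Qed.

Definition wnxt w t : 'I_M := nxt kr enc r (wrho w) (dec (wi w)).2 t.

(** The targets for which the model needs a successor. A box alone demands none; it is served at the
    successors belonging to diamonds. *)
Definition demand w (t : tgt V) : Prop := tvalid kr r (wrho w) t /\
  match t with inl (inl _) => kr | inr _ => ~~ kr | _ => false end.

Lemma demand_nz w t : demand w t -> bnz (wenv w (wnxt w t)).
Proof.
move=> [vt dt]; have nz := @wrho_nz w.
have {nz} : bnz (btop ⊓ top r (wrho w) t (wenv w (wnxt w t))).
  apply: nz_le nz _; apply: le_meet; first exact: le_top.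
  apply: ble_trans (meetr _ _) _; apply: ble_trans (meets_le _ t) _.
  by rewrite asboolT.
case: t vt dt => [[q|q]|qq] //= vt dt; last by move=> h; exact: nz_bE h.
case: vt => a [c ->] nz le; apply: nz; apply: ble_trans (meetr _ _) _.
apply: ble_trans (@kdia_mono _ K a _ _ le) _; exact: (krK dt).2.
Qed.

Lemma wnext_ex w t : exists w', demand w t ->
  wc w' = cnext mh (wc w) [ffun=> Some (tt, wnxt w t)] pred0 /\ wi w' = wnxt w t.
Proof.
have [dt|nd] := pselect (demand w t); last by exists w.
pose c' := cnext mh (wc w) [ffun=> Some (tt, wnxt w t)] pred0.
have cu' : cu c' ord0 = Some (tt, wnxt w t) by rewrite /= ffunE.
have nz' : bnz (cval mh c').
  rewrite cval_next; last first.
    by move=> s _; exists tt, (wi w), (wnxt w t); rewrite ffunE [s]ord1 wcu.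
  by apply: nz_le (demand_nz dt) _; apply/le_meets => s; rewrite ffunE [s]ord1.
have rc : dreach (dm dec (wnxt w t)).
  by rewrite /dm /wnxt /nxt encK /=; apply: dreach_step; exact: wreach w.
by exists (MWorld cu' (cnext_ok _ _ _ (wok w)) nz' rc).
Qed.

Definition wnext w t : mworld := projT1 (cid (wnext_ex w t)).
Lemma wnextP w t : demand w t ->
  wc (wnext w t) = cnext mh (wc w) [ffun=> Some (tt, wnxt w t)] pred0 /\
  wi (wnext w t) = wnxt w t.
Proof. by rewrite /wnext; case: (cid _). Qed.

Local Open Scope classical_set_scope.

Definition model_val (P : Prp) : set mworld :=
  [set w | exists2 q : Q, q \in (wrho w).1 & nd q = NLit (P, true)].

(** Without normality, each diamond state [q] for [a] contributes one neighbourhood: the successors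
    for [q] paired with each box for [a]. It is empty if there is no such box. *)
Definition model_nbhd (a : Act) (A : set mworld) : set mworld :=
  [set w | exists q c, mdia r (wrho w) q = Some (a, c) /\
     if kr then A (wnext w (TD q)) else
     forall q', tvalid kr r (wrho w) (TP q q') -> A (wnext w (TP q q'))].

Lemma model_nbhd_monotone a : monotone_map (model_nbhd a).
Proof.
move=> A B AB w [q [c [e h]]]; exists q, c; split => //.
by case: kr h => [/AB//|h q' v]; apply: AB; exact: h.
Qed.

Definition model : mnstruct Prp Act :=
  MNStruct model_val model_nbhd_monotone.

Lemma model_kripke : kr -> is_kripke model.
Proof.
move=> hkr a; exists (fun w w' => exists q c, mdia r (wrho w) q = Some (a, c) /\ w' = wnext w (TD q)).
move=> A; apply/seteqP; split=> [w [q [c [e]]]|w [w' Aw' [q [c [e ew']]]]].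
  by rewrite hkr => h; exists (wnext w (TD q)) => //; exists q, c.
by exists q, c; rewrite hkr -ew'.
Qed.

Definition mdom (p : model * Q) : Prop := p.2 \in (wrho p.1).1.
Definition mstep (p p' : model * Q) (t : tgt V) : Prop :=
  [/\ demand p.1 t, trel kr r (wrho p.1) t p.2, mchild p.2 = Some p'.2 & p'.1 = wnext p.1 t].
Definition medge (p p' : model * Q) : Prop :=
  (p'.1 = p.1 /\ ledge r (wrho p.1) p.2 p'.2) \/ exists t, mstep p p' t.

Lemma mstep_gam p p' t : mstep p p' t -> p'.2 \in gam dec (wi p'.1).
Proof.
case=> dt rp cp ->; have [_ ->] := wnextP dt.
rewrite /gam /wnxt /nxt encK /= inE; apply/asboolP; by exists p.2.
Qed.

Lemma gam_dom p : p.2 \in gam dec (wi p.1) -> mdom p.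
Proof. by case: (wrho_resol p.1) => /fintype.subsetP s _ _ /s. Qed.

Lemma mdom_edge p p' : mdom p -> medge p p' -> mdom p'.
Proof.
move=> dp [[e1 e2]|[t /mstep_gam/gam_dom//]]; rewrite /mdom e1.
by case: (wrho_resol p.1) => _ cl _; exact: cl e2.
Qed.

Lemma model_local (w : model) (q : Q) (Y : nat -> set_kozen model) : mdom (w, q) ->
  (forall p', medge (w, q) p' -> Y p'.2 p'.1) -> nfun (@set_lit _ _ model) (nd q) Y w.
Proof.
rewrite /mdom /= => qw hY.
have loc q' : ledge r (wrho w) q q' -> Y q' w.
  by move=> e; apply: (hY (w, q')); left.
rewrite /ledge qw ltn_ord /= in loc.
case E: (nd q) => [[P [|]]|a b|a b|a c|a c|a] /=; rewrite ?E in loc.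
- by exists q.
(* A violated negative literal would put both literals of [P] into one resolution and make its value
   zero. *)
- move=> [q' q'w E']; apply: (@wrho_nz w).
  apply: ble_trans (meetl _ _) _; apply: ble_trans (lit_cons P); apply: le_meet.
    by apply: ble_trans (meets_le _ q') _; rewrite q'w ltn_ord E'.
  by apply: ble_trans (meets_le _ q) _; rewrite qw ltn_ord E.
- by split; apply: loc; rewrite eqxx ?orbT.
- rewrite /setC /= => -[na nb]; case B: ((wrho w).2 q) loc => loc.
    by apply: na; apply: loc.
  by apply: nb; apply: loc.
- have mq := mdiaI qw (ltn_ord q) E.
  exists q, c; split => //; case Ekr: kr.
    apply: (hY (_, c)); right; exists (TD q); split => //=; try by rewrite /mchild E.
    - by split => //=; exists a, c.
    - by left.
  move=> q' v; apply: (hY (_, c)); right; exists (TP q q'); split => //=; try by rewrite /mchild E.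
  - by rewrite -Ekr in v; split => //; rewrite Ekr.
  - by left.
- have mq := mboxI qw (ltn_ord q) E.
  move=> [q0 [c0 [m0]]]; case Ekr: kr.
    apply; apply: (hY (_, c)); right; exists (TD q0); split => //=; try by rewrite /mchild E.
    - by split => //=; exists a, c0.
    - by right; split => //; exists a, c0, c.
  have v : tvalid kr r (wrho w) (TP q0 q) by split; [rewrite Ekr | exists a, c0, c].
  rewrite -Ekr; move/(_ q v) => h; apply: h.
  apply: (hY (_, c)); right; exists (TP q0 q); split => //=; try by rewrite /mchild E.
  - by split => //; rewrite Ekr.
  - by right.
by apply: loc.
Qed.

Lemma lpath_seq k (R : rho V) (q : nat -> Q) n :
  (forall i, i < n -> ledge k R (q i) (q i.+1)) ->
  exists m : nat, [/\ lpath k R (q 0) (q n) m, forall i, i <= n -> q i <= m &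
    exists2 i, i <= n & m = q i].
Proof.
elim: n q => [|n IH] q e.
  exists (q 0); split; [exact: lpath_refl| |by exists 0].
  by move=> i; rewrite leqn0 => /eqP->.
have [m [pm mx [i0 i0n mi]]] := IH (fun i => q i.+1) (fun i => e i.+1).
exists (maxn (q 0) m); split.
- exact: lpath_step (e 0 isT) pm.
- by move=> [|i] iN; rewrite leq_max ?leqnn // mx ?orbT.
case: (leqP (q 0) m) => h; last by exists 0.
by exists i0.+1.
Qed.

(** A bad path with finitely many modal steps contradicts the validity of a single resolution.
    Otherwise its blocks form a bad trace of the word read along the worlds, and a run of nonzero
    configurations would have a least fixpoint as its limsup. *)
Lemma model_good_path (f : nat -> model * Q) x : (forall n, mdom (f n)) ->
  (forall n, medge (f n) (f n.+1)) -> limsup_is (fun n => (f n).2) x -> ~~ mu x.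
Proof.
move=> fd fe hx; apply/negP => mx.
pose md n := exists t, mstep (f n) (f n.+1) t.
have loc n : ~ md n -> (f n.+1).1 = (f n).1 /\ ledge r (wrho (f n).1) (f n).2 (f n.+1).2.
  by case: (fe n).
have [io|fin] := pselect (inf_often md); last first.
  have [N hN] := not_inf_often fin.
  have cw d : (f (N + d)).1 = (f N).1.
    by elim: d => [|d <-]; rewrite ?addn0 // addnS; case: (loc _ (hN _ (leq_addr d N))).
  case: (wrho_resol (f N).1) => _ _; apply; exists (fun n => (f (N + n)).2), x; split => //.
    by move=> n; rewrite -(cw n) addnS; case: (loc _ (hN _ (leq_addr n N))).
  exact/(limsup_shift (fun n => (f n).2)).
have nextm n : {m | n <= m /\ md m & forall i, n <= i -> i < m -> ~ md i}.
  have ex : exists m, (n <= m) && `[< md m >].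
    by have [m nm mm] := io n; exists m; rewrite nm; apply/asboolP.
  have [] := ex_minnP ex; move=> m /andP[nm /asboolP mm] min.
  exists m => // i ni im /asboolP mi; have := min i; rewrite ni mi leqNgt im.
  by move=> /(_ isT).
pose pos n := s2val (nextm n).
have posP n : n <= pos n /\ md (pos n) := s2valP (nextm n).
have posN n i : n <= i -> i < pos n -> ~ md i := s2valP' (nextm n) i.
pose st := fix st j := if j is j'.+1 then (pos (st j')).+1 else 0.
have stS j : st j.+1 = (pos (st j)).+1 by [].
have st_lt j : st j < st j.+1 by rewrite stS ltnS; case: (posP (st j)).
pose W j : model := (f (st j)).1.
have Wc j d : st j + d <= pos (st j) -> (f (st j + d)).1 = W j.
  elim: d => [|d IH]; first by rewrite addn0.
  rewrite addnS => le; rewrite -(IH (ltnW le)).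
  by case: (loc (st j + d)) => //; apply: posN le; exact: leq_addr.
have [T hT] : exists T : nat -> tgt V, forall j, mstep (f (pos (st j))) (f (st j.+1)) (T j).
  have tP j : {t | mstep (f (pos (st j))) (f (st j.+1)) t} by apply: cid; case: (posP (st j)).
  by exists (fun j => sval (tP j)) => j; exact: (svalP (tP j)).
have posW j : (f (pos (st j))).1 = W j.
  by rewrite -(subnKC (posP (st j)).1) Wc // subnKC //; case: (posP (st j)).
have hl j : exists m : 'I_r, [/\ lpath r (wrho (W j)) (f (st j)).2 (f (pos (st j))).2 m,
    forall n, st j <= n -> n < st j.+1 -> (f n).2 <= m &
    exists n, [/\ st j <= n, n < st j.+1 & (f n).2 = m :> nat]].
  have le := (posP (st j)).1.
  have [] := @lpath_seq r (wrho (W j)) (fun d => (f (st j + d)).2) (pos (st j) - st j).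
    move=> i il; have lt : st j + i < pos (st j) by rewrite -ltn_subRL.
    rewrite -(Wc j i (ltnW lt)) addnS; apply: (loc _ _).2; apply: posN lt; exact: leq_addr.
  move=> m; rewrite addn0 subnKC // => -[pm mxm [i0 i0l mi]].
  exists (f (st j + i0)).2; rewrite -mi; split => //.
    move=> n jn nj; rewrite -(subnKC jn); apply: mxm; apply: leq_sub2r; exact: nj.
  exists (st j + i0); split => //; first exact: leq_addr.
  by rewrite stS ltnS -leq_subRL.
have [l hL] : exists l : nat -> 'I_r, forall j,
   [/\ lpath r (wrho (W j)) (f (st j)).2 (f (pos (st j))).2 (l j),
    forall n, st j <= n -> n < st j.+1 -> (f n).2 <= l j &
    exists n, [/\ st j <= n, n < st j.+1 & (f n).2 = l j :> nat]].
  by exists (fun j => projT1 (cid (hl j))) => j; case: (cid (hl j)).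
have lx : limsup_is (fun j => l j) x.
  by apply: limsup_blocks st_lt _ _ hx => j; case: (hL j).
pose wd j := tlet kr r (wrho (W j)) (gam dec (wi (W j))) (T j).
have WS j : W j.+1 = wnext (W j) (T j) by rewrite -[W j.+1]/(f (st j.+1)).1; case: (hT j) => _ _ _ ->; rewrite posW.
have dT j : demand (W j) (T j) by case: (hT j); rewrite posW.
have bad : bad_word mu wd.
  exists (fun j => (f (st j)).2), l, x; split => //.
  (* The first state need not belong to the macrostate of its world; every later block begins behind
     a modal step and so inside the macrostate. *)
  exists 1 => -[//|j] _; rewrite ffunE inE; apply/asboolP; split.
    exact: mstep_gam (hT j).
  have [_ rp cp _] := hT j.+1; exists (f (pos (st j.+1))).2; split => //.
    by rewrite -posW.
  by case: (hL j.+1).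
have run j : (dec (wi (W j.+1))).1 = dpri mu (dm dec (wi (W j))) (wd j) :> nat /\
    dm dec (wi (W j.+1)) = dstep (dm dec (wi (W j))) (wd j).
  by rewrite WS; have [_ ->] := wnextP (dT j); rewrite /dm /wnxt /nxt encK.
have [i hi hib] := @thread_word _ _ V kt kt_card M enc dec decK enc_mono
  (fun j => wi (W j)) wd (wreach (W 0)) run.
have csS j : wc (W j.+1) = cnext mh (wc (W j)) (cu (wc (W j.+1))) pred0.
  by rewrite WS; have [-> _] := wnextP (dT j).
have hs j : 0 <= j -> ~~ @pred0 'I_1 ord0 /\
    exists2 k : 'I_M, cu (wc (W j)) ord0 = Some (tt, k) & wi (W j) = k :> nat.
  by move=> _; split => //; exists (wi (W j)) => //; exact: wcu.
have := @thread_limsup K unit M 1 mh mh_good (fun j => wc (W j)) (fun=> pred0)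
  (@wok (W 0)) csS (fun j => @wnz (W j)) ord0 tt (fun j => wi (W j)) i 0 hs hi.
by rewrite -[hmu _ _]/(hmu (nhes kr enc dec lit r Z) i) nhes_mu hib.2.
Qed.

Lemma model_sat (q : Q) Y : bnz (nval kr enc dec lit r Z (sidx enc q)) ->
  exists w : model, sol (vhes (@set_lit _ _ model) V) r Y q w.
Proof.
set i := sidx enc q => nz.
pose c : conf K unit M 1 := @cinit K unit M 1 [ffun=> Some (tt, i)].
have cu0 : cu c ord0 = Some (tt, i) by rewrite ffunE.
have nzc : bnz (cval mh c).
  by apply: nz_le nz _; apply/le_meets => s; rewrite [s]ord1 cu0; exact: (ble_refl (nval kr enc dec lit r Z i)).
have rc : dreach (dm dec i) by rewrite /dm /i /sidx /idx encK; exact: dreach_init.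
pose w := MWorld cu0 (@cinit_ok K unit M 1 _) nzc rc; exists w.
have dw : mdom (w, q).
  by apply: gam_dom; rewrite /gam /= /i /sidx /idx encK inE.
apply: (@adequacy_level _ _ model _ (@set_lit _ _ model) V mdom medge mdom_edge model_local
  model_good_path r Y (w, q) dw (leqnn _)) => n p' /exits_ge.
by rewrite leqNgt ltn_ord.
Qed.

End Model.

Lemma lex_coding k (T : finType) : exists M (enc : 'I_k * T -> 'I_M) (dec : 'I_M -> 'I_k * T),
  [/\ cancel enc dec, cancel dec enc &
      forall (p p' : 'I_k) (x x' : T), p < p' -> enc (p, x) < enc (p', x')].
Proof.
have [m cT] : exists m, #|T| = m by eexists.
have [m0|m0] := posnP m.
  have noT (x : T) : False by have := card0_eq (etrans cT m0) x; rewrite inE.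
  exists 0, (fun px => match noT px.2 with end), (fun i : 'I_0 => match notF (ltn_ord i) with end).
  split=> [[p x]|[i]//|p p' x]; by case: (noT x).
have hx (x : T) : enum_rank x < m by rewrite -cT.
have henc (px : 'I_k * T) : px.1 * m + enum_rank px.2 < k * m.
  apply: leq_trans (_ : px.1.+1 * m <= _); first by rewrite mulSn addnC ltn_add2r.
  by rewrite leq_mul2r ltn_ord orbT.
have hd1 (i : 'I_(k * m)) : i %/ m < k by rewrite ltn_divLR.
have hd2 (i : 'I_(k * m)) : i %% m < #|T| by rewrite cT ltn_mod.
exists (k * m), (fun px => Ordinal (henc px)),
  (fun i => (Ordinal (hd1 i), enum_val (Ordinal (hd2 i)))).
split.
- move=> [p x]; congr pair; first by apply: ord_inj; rewrite /= divnMDl // divn_small ?addn0.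
  rewrite -[RHS]enum_rankK; congr enum_val; apply: ord_inj.
  by rewrite /= modnMDl modn_small.
- by move=> i; apply: ord_inj; rewrite /= enum_valK /= -divn_eq.
move=> p p' x x' pp' /=; apply: leq_trans (_ : p.+1 * m <= _).
  by rewrite mulSn addnC ltn_add2r.
by apply: leq_trans (leq_addr _ _); rewrite leq_mul2r pp' orbT.
Qed.

Theorem sol_satisfiable (Prp Act : Type) (V : vaut (Prp * bool) Act) (kr : bool)
    (K : kozen Act) (lit : Prp * bool -> K) (q : 'I_(vsize V)) Z :
  kglobal K -> (kr -> knormal K) -> (forall P, lit (P, true) ⊓ lit (P, false) <<= bbot) ->
  bnz (sol (vhes lit V) (vsize V) Z q) ->
  exists N : mnstruct Prp Act, (kr -> is_kripke N) /\
    forall Y, exists w : N, sol (vhes (@set_lit _ _ N) V) (vsize V) Y q w.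
Proof.
move=> gK krK lc nz.
have [kt ktE] : exists kt, #|{: option (letter 'I_(vsize V) (vsize V))}| = kt by eexists.
have [M [enc [dec [eK dK em]]]] := @lex_coding (dbound kt) ({set 'I_(vsize V)} * dstate 'I_(vsize V) (vsize V) kt)%type.
have nz' := nz_le nz (@sol_le_nval _ _ V kr kt ktE M enc dec eK dK em K lit gK krK _ Z q (leqnn _)).
exists (@model _ _ V kr kt M enc dec eK K lit gK krK Z); split; first exact: model_kripke.
by move=> Y; exact: (@model_sat _ _ V kr kt ktE M enc dec eK dK em K lit gK krK lc Z q Y nz').
Qed.

(** * Soundness *)

Section Soundness.
Variables (Prp Act : Type) (N : mnstruct Prp Act).
Notation B := (set_balg N).
Notation formula := (formula Prp Act).
Notation game := (game Prp Act).
Notation dia := (@kdia Act (set_kozen N)).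
Notation v := (mval (m := N) : Prp -> B).
Notation lf := (lf dia v).
Notation lg := (lg dia v).
Implicit Types (p q : formula) (a b : game) (x y z : nat) (c k : B) (I : nat -> B -> B) (w : N).

Lemma slg_mono a I I' k k' : normalg a -> (forall x, monof (I x)) -> (forall x, monof (I' x)) ->
  (forall x c, I x c <<= I' x c) -> (forall x, x \in dfvg a -> I x = I' x) -> k <<= k' ->
  lg a I k <<= lg a I' k'.
Proof.
apply: (@lg_mono _ _ _ dia v (@kdia_mono _ (set_kozen N)) (@monof B) _ _ _ (fun a => normalg a)) => //.
- by move=> c c' d _; exact: ble_refl.
- exact: fdual_mono.
- by move=> *; exact: set_haslfp.
- by case=> //= *; apply/andP.
- by move=> b; rewrite normalg_dual.
Qed.

Lemma upd_mono I x u : (forall y, monof (I y)) -> monof u -> forall y, monof (upd I x u y).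
Proof. by move=> mI mu y; rewrite /upd; case: eqP. Qed.

Lemma cst_mono c : monof (fun=> c : B). Proof. by move=> d d' _; exact: ble_refl. Qed.

Lemma slg_cmono a I x k : normalg a -> x \notin dfvg a -> (forall y, monof (I y)) ->
  monof (fun c => lg a (upd I x (fun=> c)) k).
Proof.
move=> na xa mI c c' cc; apply: slg_mono => //; try by apply: upd_mono => //; exact: cst_mono.
  by move=> y d; rewrite /upd; case: eqP.
by move=> y ya; rewrite /upd; case: eqP ya xa => // -> ->.
Qed.

Lemma le_imp (c k : B) : bneg c ⊔ k = btop <-> c <<= k.
Proof.
rewrite /bjoin bnegK; split=> [/(congr1 (@bneg B))|h].
  by rewrite bnegK neg_top => h; rewrite -[k]bnegK; apply/bneg_adj; rewrite h.
by rewrite (_ : c ⊓ bneg k = bbot) //; apply: ble_anti => //; apply/bneg_adj; rewrite bnegK.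
Qed.

Lemma lf_imp p q : lf (FImp p q) = btop <-> lf p <<= lf q.
Proof. by rewrite /= lf_compl le_imp. Qed.

Lemma lf_iff p q : lf p = lf q -> lf (FIff p q) = btop.
Proof.
move=> e; rewrite -[lf _]/(lf (FImp p q) ⊓ lf (FImp q p)).
have h r s : lf r = lf s -> lf (FImp r s) = btop by move=> rs; apply/lf_imp; rewrite rs; exact: ble_refl.
by rewrite !h // meet_top.
Qed.

Lemma lf_bot P0 : lf (FBot Act P0) = bbot.
Proof. by apply: ble_anti => //; exact: meet_neg. Qed.

Lemma lf_top P0 : lf (FTop Act P0) = btop.
Proof. by apply: ble_anti; [exact: le_top | move=> w _ /= -[] ]. Qed.

Lemma taut_sound p : tautology p -> lf p = btop.
Proof.
move=> tp; apply: ble_anti; first exact: le_top.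
move=> w _; apply/asboolP; apply: (tp (fun q => `[< lf q w >])) => [q|q r|q r].
- by rewrite lf_compl -asbool_neg.
- rewrite -asbool_or; congr asbool; apply: propext; split=> [h|[h|h]].
  + by apply: contrapT => no; apply: h; split=> h; apply: no; [left | right].
  + by case.
  + by case.
- by rewrite -asbool_and.
Qed.

Notation idI := (fun _ : nat => (id : B -> B)).
Lemma id_mono x : monof (idI x). Proof. by []. Qed.

Lemma unfold_sound x a k : gok a -> x \notin dfvg a -> free_for (GMu x a) x a ->
  lg (substg x (GMu x a) a) idI k = lg (GMu x a) idI k.
Proof.
move=> oka xa fa; have [na _] := andP oka.
rewrite lg_substg //; last by rewrite /= na.
have mo := @slg_cmono a idI x k na xa id_mono.
by rewrite lg_upd_const //; exact: (lfpE mo (set_haslfp mo)).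
Qed.

Lemma free_for_var y x : (forall p, y \notin varsf p -> free_forf (GVar y : game) x p) /\
  (forall a, y \notin varsg a -> free_for (GVar y : game) x a).
Proof.
apply: syntax_ind => //=; try by move=> p hp q hq; rewrite mem_cat negb_or => /andP[/hp-> /hq->].
- by move=> z a h; rewrite inE negb_or => /andP[yz /h->]; rewrite inE eq_sym yz orbT.
- by move=> z a h; rewrite inE negb_or => /andP[yz /h->]; rewrite inE eq_sym yz orbT.
Qed.

Lemma fv_vars : (forall p, {subset fvf p <= varsf p}) /\ (forall a, {subset fvg a <= varsg a}).
Proof.
have sub_cat (s1 s2 t1 t2 : seq nat) : {subset s1 <= t1} -> {subset s2 <= t2} ->
    {subset s1 ++ s2 <= t1 ++ t2}.
  by move=> h1 h2 z; rewrite !mem_cat => /orP[/h1->|/h2->]; rewrite ?orbT.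
have sub_filter (s t : seq nat) x : {subset s <= t} -> {subset [seq z <- s | z != x] <= x :: t}.
  by move=> h z; rewrite mem_filter inE => /andP[_ /h->]; rewrite orbT.
by apply: syntax_ind => //= *; first [exact: sub_cat | exact: sub_filter | move=> ?].
Qed.

Lemma rename_val x y a c k : normalg a -> x \notin dfvg a -> y \notin varsg a ->
  lg (substg x (GVar y) a) (upd idI y (fun=> c)) k = lg a (upd idI x (fun=> c)) k.
Proof.
move=> na xa ya; rewrite lg_substg //; last exact: (free_for_var y x).2.
apply: lg_agree => // z za; have [->|zx] := eqVneq z x.
  by rewrite !upd_same; apply: funext => k' /=; rewrite upd_same.
have zy : z != y by apply: contraNneq ya => <-; exact: (fv_vars.2 a).
by rewrite !upd_ne.
Qed.

(** Serves the fixpoint rule: if the variable occurs, well-formedness of the premise passes to the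
    substituted sequence, whose first part is therefore closed. *)
Lemma subst_occ x b a : x \in fvg a -> x \notin dfvg a -> normalg a ->
  gok (substg x b a) -> gok b.
Proof.
rewrite /gok; elim: a => //=.
- by move=> z; rewrite inE => /eqP->; rewrite eqxx.
- by move=> z; rewrite inE => ->.
- by move=> p xp _ /andP[_ /nilP cp]; rewrite cp in xp.
- by move=> p xp _ /andP[_ /nilP cp]; rewrite cp in xp.
- move=> a ha c hc; rewrite !mem_cat negb_or => xa /andP[da dc] /andP[na nc].
  move=> /andP[/andP[n1 n2] /andP[r1 r2]]; case/orP: xa => [xa|xc]; [apply: ha|apply: hc] => //;
    by rewrite ?n1 ?n2.
- move=> a ha c hc; rewrite !mem_cat negb_or => xa /andP[da dc] /andP[na nc].
  move=> /andP[/andP[n1 n2] /andP[r1 r2]]; case/orP: xa => [xa|xc]; [apply: ha|apply: hc] => //;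
    by rewrite ?n1 ?n2.
- move=> a ha c hc; rewrite !mem_cat negb_or => xa /andP[da dc] /andP[na nc].
  move=> /andP[/andP[n1 n2] /and3P[r1 r2 _]]; case/orP: xa => [xa|xc]; [apply: ha|apply: hc] => //;
    by rewrite ?n1 ?n2.
- move=> z a ha; rewrite !mem_filter; case: (eqVneq x z) => //= xz xa da /andP[na _].
  by move=> /andP[/andP[n1 _] r1]; apply: ha; rewrite ?n1.
- move=> z a ha; rewrite !mem_filter; case: (eqVneq x z) => //= xz xa da /andP[na _].
  by move=> /andP[/andP[n1 _] r1]; apply: ha; rewrite ?n1.
Qed.

(** The dual test of [FBot] is true at every continuation, so the substituted game takes the
    constant value of [<b>q], and the premise says that this value is prefixed. *)
Lemma fix_sound P0 x a b p q : gok (GMu x a) -> gok b ->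
  gok (substg x (GSeq b (GSeq (GTest q) (GTestD (FBot Act P0)))) a) ->
  lg (substg x (GSeq b (GSeq (GTest q) (GTestD (FBot Act P0)))) a) idI (lf p) <<= lg b idI (lf q) ->
  lg (GMu x a) idI (lf p) <<= lg b idI (lf q).
Proof.
set d := GSeq b _ => okmu okb oks h; have [oka xa] : gok a /\ x \notin dfvg a.
  by move: okmu; rewrite gok_mu => /andP[].
have [na ra] := andP oka.
rewrite -[lg (GMu x a) _ _]/(lfpB (fun c => lg a (upd idI x (fun=> c)) (lf p))).
apply: lfp_le; first exact: set_haslfp (slg_cmono na xa id_mono).
have [xf|xf] := boolP (x \in fvg a); last first.
  rewrite (subst_id x d).2 // in h; rewrite (_ : lg a _ _ = lg a idI (lf p)) //.
  by apply: lg_agree => // y ya; rewrite /upd; case: eqP ya xf => // -> ->.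
have /andP[nd rd] := subst_occ xf xa na oks.
move: (nd) (rd); rewrite /d /= => /andP[nb /andP[/andP[nq cq] _]] /and3P[rb _ cb].
have fd : free_for d x a by apply: (free_for_closed _).2; rewrite /d /= (nilP cb) (nilP cq).
rewrite lg_substg // in h; rewrite (_ : upd _ _ (fun=> _) = upd idI x (lg d idI)) //.
congr upd; apply: funext => k; rewrite -[lg d _ k]/(lg b idI (lf q ⊓ (bneg (lf (FBot Act P0)) ⊔ k))).
have -> : bneg (lf (FBot Act P0)) ⊔ k = btop.
  by apply/le_imp; rewrite lf_bot.
by rewrite meet_top.
Qed.

Lemma kripke_sound P0 p : is_kripke N -> axiom_G P0 p -> lf p = btop.
Proof.
move=> kN [e q r|e q r|e]; have [R hR] := kN e.
- apply: lf_iff; apply: set_anti => w; rewrite /= !hR.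
    move=> [h1 h2] [s ns Rs]; apply: ns; split; apply: contrapT => h; [apply: h1 | apply: h2];
      by exists s.
  by move=> h; split=> -[s ns Rs]; apply: h; exists s => // -[qs rs]; exact: ns.
- apply/lf_imp => w; rewrite /= !hR => h [h1 h2].
  apply: h2 => -[s nr Rs]; apply: h; exists s => // no; apply: no; split => // qs.
  by apply: h1; exists s.
apply: ble_anti; first exact: le_top.
rewrite -[lf _]/(bneg (dia e (bneg (lf (FTop Act P0)))) : B) lf_top.
by move=> w _; rewrite /= hR => -[s ns _]; apply: ns.
Qed.

Lemma axiom_sound p : axiom_rlGL p -> rlGL p -> lf p = btop.
Proof.
have mu_ok x a q : rlGL (FDia (GMu x a) q) -> gok a /\ x \notin dfvg a.
  by rewrite rlGL_dia gok_mu => /andP[/andP[]].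
have nu_ok x a q : rlGL (FDia (GNu x a) q) -> gok a /\ x \notin dfvg a.
  by rewrite rlGL_dia -[gok _]/(gok (GMu x a)) gok_mu => /andP[/andP[]].
case=> {p}.
- by move=> p /taut_sound.
- by move=> a p _; apply: lf_iff; rewrite /= complK.
- by move=> p q _; exact: lf_iff.
- by move=> a b p _; exact: lf_iff.
- by move=> a b p _; exact: lf_iff.
- move=> x a p fa; rewrite rlGL_imp => /andP[_ /mu_ok[oka xa]].
  by apply/lf_imp; rewrite /= unfold_sound //; exact: ble_refl.
- move=> x y a p ya; rewrite /FIff rlGL_and !rlGL_imp => /andP[/andP[/mu_ok[oka xa] _] _].
  apply: lf_iff; apply: (congr1 (@lfpB B)); apply: funext => c.
  by apply/esym; apply: rename_val => //; case/andP: oka.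
- move=> x y a p ya; rewrite /FIff rlGL_and !rlGL_imp => /andP[/andP[/nu_ok[oka xa] _] _].
  apply: lf_iff; apply: (congr1 (@gfpB B)); apply: funext => c.
  by apply/esym; apply: rename_val => //; case/andP: oka.
Qed.

Theorem soundness P0 (Ax : formula -> Prop) p :
  (forall q, Ax q -> axiom_rlGL q \/ is_kripke N /\ axiom_G P0 q) ->
  provable P0 Ax p -> lf p = btop.
Proof.
move=> hAx; elim=> {p}.
- by move=> p /hAx[/axiom_sound|[kN /(kripke_sound kN)]].
- move=> p q _ hp _ /lf_imp h _; apply: ble_anti; first exact: le_top.
  by rewrite -hp.
- move=> x a b p q pr /lf_imp h rl; apply/lf_imp.
  have := provable_ok pr; rewrite !rlGL_imp !rlGL_dia => /andP[/andP[oks _] /andP[okb _]].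
  by move: rl; rewrite rlGL_imp !rlGL_dia => /andP[/andP[okmu _] _]; exact: fix_sound h.
move=> a p q pr /lf_imp h rl; apply/lf_imp.
move: rl; rewrite rlGL_imp !rlGL_dia => /andP[/andP[/andP[na _] _] _].
by apply: (slg_mono na id_mono id_mono _ _ h) => // x c; exact: ble_refl.
Qed.

Section Fixpoints.
Local Open Scope classical_set_scope.

Lemma lfp_uniq (F : (set N -> set N) -> set N -> set N) (U : set N -> set N) :
  fixpoint_of F U -> (forall u, fixpoint_of F u -> map_le U u) -> lfp F = U.
Proof.
move=> fU leU; have [] : [set u | fixpoint_of F u /\ forall u', fixpoint_of F u' -> map_le u u'] (lfp F).
  by apply: xgetPex; exists U.
by move=> fF leF; apply: funext => A; apply: set_anti; [exact: leF | exact: leU].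
Qed.

Lemma gfp_uniq (F : (set N -> set N) -> set N -> set N) (U : set N -> set N) :
  fixpoint_of F U -> (forall u, fixpoint_of F u -> map_le u U) -> gfp F = U.
Proof.
move=> fU leU; have [] : [set u | fixpoint_of F u /\ forall u', fixpoint_of F u' -> map_le u' u] (gfp F).
  by apply: xgetPex; exists U.
by move=> fF leF; apply: funext => A; apply: set_anti; [exact: leU | exact: leF].
Qed.

End Fixpoints.

(** At a binder the elementwise fixpoints are assembled into one map of the argument [A], which is
    monotone and a fixpoint. Any monotone fixpoint [u] gives a fixpoint [u A] at each argument, so
    the assembled map is extremal. *)
Lemma sem_lg : (forall p I, fok p -> (forall x, monotone_map (I x)) -> semf I p = lf p) /\
  (forall a I, gok a -> (forall x, monotone_map (I x)) -> semg I a = lg a I).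
Proof.
have joinE (A C : set N) : (A `|` C)%classic = (A : B) ⊔ C.
  apply: set_anti => w; first by move=> [h|h] [h1 h2].
  by move=> h; apply: contrapT => no; apply: h; split=> h; apply: no; [left | right].
have testE p : gok (GTest p) -> fok p by rewrite /gok /fok /rlGL /= => /andP[/andP[-> ->] ->].
have semE a I (A : B) : gok a -> (forall x, monotone_map (I x)) ->
    (forall J, (forall x, monotone_map (J x)) -> semg J a = lg a J) ->
    forall x, x \notin dfvg a -> forall u : set N -> set N, monotone_map u ->
    semg (update I x u) a A = lg a (upd I x (fun=> u A)) A.
  move=> oka mI h x xa u mu; rewrite h; first by rewrite -lg_upd_const.
  by move=> y; rewrite /update; case: eqP.
apply: syntax_ind => //=.
- by move=> p hp q hq I; rewrite fok_or => /andP[okp okq] mI; rewrite hp ?hq.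
- by move=> p hp q hq I; rewrite fok_and => /andP[okp okq] mI; rewrite hp ?hq.
- move=> a ha p hp I; rewrite fok_dia => /and3P[oka ca okp] mI; rewrite hp // ha //.
  by have [na _] := andP oka; exact: (@lg_closed _ _ B dia v a I idI (lf p) na ca).
- by move=> p hp I /testE okp mI; apply: funext => A; rewrite hp.
- by move=> p hp I /testE okp mI; apply: funext => A; rewrite hp // joinE.
- move=> a ha b hb I; rewrite /gok /= => /andP[/andP[na nb] /andP[ra rb]] mI; apply: funext => A.
  by rewrite ha ?hb // ?joinE // /gok ?na ?nb.
- move=> a ha b hb I; rewrite /gok /= => /andP[/andP[na nb] /andP[ra rb]] mI; apply: funext => A.
  by rewrite ha ?hb // /gok ?na ?nb.
- move=> a ha b hb I; rewrite /gok /= => /andP[/andP[na nb] /and3P[ra rb _]] mI; apply: funext => A.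
  by rewrite ha ?hb // /gok ?na ?nb.
- move=> x a ha I; rewrite gok_mu => /andP[oka xa] mI; have [na _] := andP oka.
  have sE u A := @semE a I A oka mI (fun J => ha J oka) x xa u.
  have mo A := @slg_cmono a I x A na xa mI; have hl A := set_haslfp (mo A).
  apply: lfp_uniq.
    have mU : monotone_map (fun A => lg (GMu x a) I A : set N).
      move=> A C AC; have nm : normalg (GMu x a) by rewrite /= na.
      by apply: (slg_mono nm mI mI _ _ AC) => // y c; exact: ble_refl.
    split => //; apply: funext => A; rewrite sE //; exact: lfpE (mo A) (hl A).
  move=> u [mu Fu] A; apply: (lfp_le (hl A)); rewrite -sE // Fu; exact: ble_refl.
move=> x a ha I; rewrite -[gok _]/(gok (GMu x a)) gok_mu => /andP[oka xa] mI; have [na _] := andP oka.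
have sE u A := @semE a I A oka mI (fun J => ha J oka) x xa u.
have mo A := @slg_cmono a I x A na xa mI; have hl A := set_haslfp (fdual_mono (mo A)).
apply: gfp_uniq.
  have mU : monotone_map (fun A => lg (GNu x a) I A : set N).
    move=> A C AC; have nm : normalg (GNu x a) by rewrite /= na.
      by apply: (slg_mono nm mI mI _ _ AC) => // y c; exact: ble_refl.
  split => //; apply: funext => A; rewrite sE //; exact: gfpE (mo A) (hl A).
move=> u [mu Fu] A; apply: (gfp_ge (hl A)); rewrite -sE // Fu; exact: ble_refl.
Qed.

End Soundness.

(** * Models of consistent formulas *)

Section Completeness.
Variables (Prp Act : Type) (P0 : Prp).
Notation formula := (formula Prp Act).
Implicit Types (p : formula) (Ax : formula -> Prop) (N : mnstruct Prp Act).

Lemma true_in_lf N p : fok p -> true_in N p <->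
  lf (@kdia Act (set_kozen N)) (mval (m := N) : Prp -> set_balg N) p = btop.
Proof.
move=> okp; have topE : (btop : set_balg N) = [set: N]%classic.
  by apply: set_anti => // w _ [].
split=> h.
  have mI (x : nat) : monotone_map (id : set N -> set N) by [].
  rewrite topE; exact: etrans (esym ((sem_lg N).1 p _ okp mI)) (h _ mI).
by move=> I mI; rewrite -topE -h; exact: ((sem_lg N).1 p I okp mI).
Qed.

(** Passing to [kozenE K] keeps the carrier, its order and the modalities, and only enlarges the
    class of definable maps; the value of [p] is unchanged and still nonzero. *)
Lemma satisfiable (kr : bool) (K : kozen Act) (v : Prp -> K) p : (kr -> knormal K) -> fok p ->
  bnz (lf (@kdia Act K) v p) ->
  exists N, (kr -> is_kripke N) /\
    exists w : N, lf (@kdia Act (set_kozen N)) (mval (m := N) : Prp -> set_balg N) p w.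
Proof.
move=> nK okp nz; have /andP[/andP[np _] cp] := okp.
pose q : 'I_(vsize (faut p)) := ord_max.
have nz' : bnz (sol (vhes (plit (v : Prp -> kozenE K)) (faut p)) (vsize (faut p)) (fun=> bbot) q).
  by rewrite (@faut_sol _ _ p (kozenE K) v _ np cp).
have lc P : plit (v : Prp -> kozenE K) (P, true) ⊓ plit (v : Prp -> kozenE K) (P, false) <<= bbot.
  exact: meet_neg.
have [N [kN hN]] := sol_satisfiable (@kozenE_global _ K) (fun h => kozenE_normal (nK h)) lc nz'.
exists N; split => //; have [w hw] := hN (fun=> btop); exists w.
by rewrite -(@faut_sol _ _ p (set_kozen N) _ (fun=> btop) np cp).
Qed.

Lemma completeness (kr : bool) Ax p : (forall q, axiom_rlGL q -> Ax q) ->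
  (kr -> forall q, axiom_G P0 q -> Ax q) -> fok p ->
  (forall N, (kr -> is_kripke N) -> true_in N p) -> provable P0 Ax p.
Proof.
move=> axR axG okp valid; apply: contrapT => np.
have okc : fok (compl p) by rewrite fok_compl.
have nz : bnz (lf (@kdia Act (lkozen P0 axR)) (lval P0 axR) (compl p) : lkozen P0 axR).
  rewrite -[lf _ _ _]/(lf (@ldia _ _ P0 Ax axR) (lval P0 axR) _).
  rewrite ((lvalE P0 axR).1 _ okc)  => /(mk_le P0 axR okc (fok_bot Act P0)).1.
  by move/(imp_provable axR (fok_rlGL okp)).
have [N [kN [w]]] := satisfiable (fun h => lkozen_normal axR (axG h)) okc nz.
by rewrite lf_compl; rewrite ((true_in_lf N okp).1 (valid N kN)); apply.
Qed.

End Completeness.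

Theorem theorem6p10 (Prp Act : Type) (P0 : Prp) (phi : formula Prp Act) :
  rlGL phi -> closedf phi ->
  (provable_rlGL_G P0 phi <->
     forall N : mnstruct Prp Act, is_kripke N -> true_in N phi) /\
  (provable_rlGL P0 phi <->
     forall N : mnstruct Prp Act, true_in N phi).
Proof.
move=> rp cp; have okp : fok phi by rewrite /fok rp.
split; split=> h.
- move=> N kN; apply/true_in_lf => //; apply: soundness h => q [|]; first by left.
  by right.
- apply: (@completeness _ _ P0 true) => //; [by left | by right |].
  by move=> N kN; apply: h; exact: kN.
- by move=> N; apply/true_in_lf => //; apply: soundness h => q; left.
by apply: (@completeness _ _ P0 false).
Qed.
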